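(* Let $\Omega\subset\mathbb{R}^3$ be a bounded, simply connected open set with $C^4$ boundary and let $\alpha\in(0,\frac12)$. There exists a divergence-free velocity field $u\in C^{0,\alpha}(\Omega)$ such that $(u\cdot n)|_{\partial\Omega}=0$ and $$\partial_n(u\cdot n)^2\big|_{\partial\Omega}\notin\mathcal{D}'(\partial\Omega).$$ In particular, the pressure $p\in C^{0,\alpha}(\Omega)$ associated with $u$ (see context) has the property $$\partial_np\,\big|_{\partial\Omega}\notin\mathcal{D}'(\partial\Omega).$$ In the endpoint case $\alpha=\frac12$, there exists a divergence-free velocity field $u\in C^{0,1/2}(\Omega)$ with $(u\cdot n)|_{\partial\Omega}=0$ such that $$\partial_n(u\cdot n)^2\big|_{\partial\Omega}\neq0 .$$
   Context: $n$ is the outward unit normal of $\partial\Omega$; points within a small distance $2\delta$ of $\partial\Omega$ have a unique nearest boundary point $\widetilde\sigma(x)$ and $n$ is extended by $n(x)=n(\widetilde\sigma(x))$. Divergence-free is meant in the sense of distributions. Meaning of the normal derivative at the boundary: for a function $f$ continuous on $\overline\Omega$ near $\partial\Omega$ and a test function $\theta\in\mathcal{D}(\partial\Omega)$ (test functions on $\partial\Omega$, of the regularity $C^4$ of $\partial\Omega$), set $$\langle\partial_nf|_{\partial\Omega},\theta\rangle:=\lim_{s\to0+}\int_{\partial\Omega}\frac{f(y)-f(y-s\,n(y))}{s}\,\theta(y)\,dS(y).$$ ''$\partial_nf|_{\partial\Omega}\notin\mathcal{D}'(\partial\Omega)$'' means that this does not define a distribution: there is a $\theta\in\mathcal{D}(\partial\Omega)$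 for which the limit does not exist as a finite number. ''$\partial_nf|_{\partial\Omega}\ne0$'' means that it is not the case that the limit exists and equals $0$ for every $\theta$. Pressure associated with $u$: let $\phi(x)=\widetilde\phi(d(x,\partial\Omega))$ with $\widetilde\phi:[0,\infty)\to[0,1]$ smooth nonincreasing, equal to $1$ on $[0,\delta]$ and $0$ on $[2\delta,\infty)$. Then $p:=P-\phi(u\cdot n)^2$, where $P\in C^{0,\alpha}(\Omega)$ is the unique function such that $-\Delta P=\partial_i\partial_j(u_iu_j)-\Delta(\phi(u\cdot n)^2)$ in the sense of distributions in $\Omega$; $s\mapsto\partial_sP(\cdot,s)\in C([0,\delta);H^{-2}(\partial\Omega))$, where $P(y,s):=P(y-s\,n(y))$ for $y\in\partial\Omega$; $\partial_nP:=-\partial_sP(\cdot,0)=u_iu_j\partial_in_j$ in $H^{-2}(\partial\Omega)$; and $\int_\Omega P\,dx=\int_\Omega\phi(u\cdot n)^2dx$. Existence and uniqueness of this $P$ may be taken as known. *)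

(* Defs.v *)
From HB Require Import structures.
From mathcomp Require Import all_boot all_order all_algebra.
From mathcomp Require Import all_classical all_reals all_analysis.
Set Implicit Arguments.
Unset Strict Implicit.
Unset Printing Implicit Defensive.
Import Order.TTheory GRing.Theory Num.Theory.
Import numFieldNormedType.Exports.
Local Open Scope classical_set_scope.
Local Open Scope ring_scope.

(* The norm of the library on 'rV[R]_n is the sup norm. It induces the right
   topology, but distances and unit vectors need the Euclidean norm. *)
Definition dot (R : realType) (n : nat) (x y : 'rV[R]_n) : R :=
  \sum_(i < n) x 0 i * y 0 i.

Definition enorm (R : realType) (n : nat) (x : 'rV[R]_n) : R :=
  Num.sqrt (dot x x).

Definition basis_vec (R : realType) (n : nat) (i : 'I_n) : 'rV[R]_n :=
  delta_mx 0 i.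

Definition pderiv (R : realType) (n : nat) (i : 'I_n) (f : 'rV[R]_n -> R) :
  'rV[R]_n -> R := fun x => 'D_(basis_vec R i) f x.

Definition laplacian (R : realType) (n : nat) (f : 'rV[R]_n -> R)
    (x : 'rV[R]_n) : R :=
  \sum_(i < n) pderiv i (pderiv i f) x.

(* C^k on U, meant for open sets U *)
Fixpoint Ck (R : realType) (n k : nat) (U : set 'rV[R]_n) (f : 'rV[R]_n -> R)
    : Prop :=
  (forall x, U x -> {for x, continuous f}) /\
  match k with
  | 0 => True
  | k'.+1 => forall i : 'I_n,
      (forall x, U x -> derivable f x (basis_vec R i)) /\
      Ck k' U (pderiv i f)
  end.

Definition vec2 (R : realType) (z : R * R) : 'rV[R]_2 :=
  \row_(i < 2) nth 0 [:: z.1; z.2] i.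

Definition vec3 (R : realType) (z : R * R * R) : 'rV[R]_3 :=
  \row_(i < 3) nth 0 [:: z.1.1; z.1.2; z.2] i.

Local Notation leb R := (@lebesgue_measure R).

Definition vol_int (R : realType) (D : set 'rV[R]_3) (f : 'rV[R]_3 -> R) : R :=
  \int[((leb R \x leb R) \x leb R)%E]_(z in @vec3 R @^-1` D) f (vec3 z).

Definition borel3 (R : realType) := g_sigma_algebraType (@open 'rV[R]_3).

Section domains.
Variable R : realType.
Implicit Types (Omega : set 'rV[R]_3) (x y v : 'rV[R]_3).

Definition bd Omega : set 'rV[R]_3 := closure Omega `\` interior Omega.

Definition simply_connected Omega : Prop :=
  [/\ Omega !=set0,
      (forall x y, Omega x -> Omega y -> exists c : R -> 'rV[R]_3,
        [/\ {within `[0, 1], continuous c}, c 0 = x, c 1 = y &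
            forall t : R, 0 <= t <= 1 -> Omega (c t)]) &
      (forall c : R -> 'rV[R]_3,
        {within `[0, 1], continuous c} -> c 0 = c 1 ->
        (forall t : R, 0 <= t <= 1 -> Omega (c t)) ->
        exists H : R * R -> 'rV[R]_3,
          [/\ {within `[0, 1]%classic `*` `[0, 1]%classic, continuous H},
              (forall (s t : R), 0 <= s <= 1 -> 0 <= t <= 1 -> Omega (H (s, t))),
              (forall t : R, 0 <= t <= 1 -> H (0, t) = c t /\ H (1, t) = c 0) &
              (forall s : R, 0 <= s <= 1 -> H (s, 0) = c 0 /\ H (s, 1) = c 0)])].

(* The rows of the orthogonal matrix Q form an orthonormal frame; the
   coordinates of x in this frame are the entries of x *m Q^T, the last of
   which is the height. *)
Definition frame_coord (Q : 'M[R]_3) x : 'rV[R]_(2 + 1) := x *m Q^T.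
Definition frame_base (Q : 'M[R]_3) x : 'rV[R]_2 := lsubmx (frame_coord Q x).
Definition frame_height (Q : 'M[R]_3) x : R := rsubmx (frame_coord Q x) 0 0.
Definition graph_point (Q : 'M[R]_3) (g : 'rV[R]_2 -> R) (z : 'rV[R]_2) :
    'rV[R]_3 :=
  (row_mx z (const_mx (g z) : 'rV[R]_1) : 'rV[R]_(2 + 1)) *m Q.

Definition graph_chart Omega x (r : R) (Q : 'M[R]_3) (g : 'rV[R]_2 -> R)
    : Prop :=
  [/\ 0 < r, Q *m Q^T = 1%:M &
      forall y, enorm (y - x) < r ->
        (Omega y <-> frame_height Q y < g (frame_base Q y))].

Definition Ck_boundary (k : nat) Omega : Prop :=
  forall x, bd Omega x -> exists r Q g, Ck k setT g /\ graph_chart Omega x r Q g.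

(* The area formula in every graph chart, which determines the measure. *)
Definition is_surface_measure Omega
    (S : {measure set (borel3 R) -> \bar R}) : Prop :=
  S (~` bd Omega) = 0%E /\
  forall x r Q g, Ck 1 setT g -> graph_chart Omega x r Q g ->
    forall A : set (borel3 R), measurable A ->
      A `<=` bd Omega `&` [set y | enorm (y - x) < r] ->
      S A = (\int[(leb R \x leb R)%E]_(z in [set z | A (graph_point Q g (vec2 z))])
               (Num.sqrt (1 + \sum_(i < 2) pderiv i g (vec2 z) ^+ 2))%:E)%E.

Definition surf_int Omega (S : {measure set (borel3 R) -> \bar R})
    (f : 'rV[R]_3 -> R) : R :=
  \int[S]_(y in (bd Omega : set (borel3 R))) f y.

Definition tangent Omega y v : Prop :=
  exists c : R -> 'rV[R]_3,
    [/\ c 0 = y, (\forall t \near (0 : R), bd Omega (c t)) &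
        is_derive (0 : R) (1 : R) c v].

Definition outward_unit_normal Omega y v : Prop :=
  [/\ enorm v = 1, (forall w, tangent Omega y w -> dot v w = 0) &
      \forall t \near (0 : R)^'+, Omega (y - t *: v) /\ ~ Omega (y + t *: v)].

Definition normal Omega y : 'rV[R]_3 :=
  xget 0 [set v | outward_unit_normal Omega y v].

Definition dist_bd Omega x : R := inf [set enorm (x - y) | y in bd Omega].

Definition nearest Omega x y : Prop :=
  bd Omega y /\ enorm (x - y) = dist_bd Omega x.

Definition proj_bd Omega x : 'rV[R]_3 := xget 0 [set y | nearest Omega x y].

Definition normal_ext Omega x : 'rV[R]_3 := normal Omega (proj_bd Omega x).

Definition tubular_radius Omega (delta : R) : Prop :=
  0 < delta /\
  forall x, dist_bd Omega x <= 2 * delta -> exists! y, nearest Omega x y.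

Definition cutoff (delta : R) (phi : R -> R) : Prop :=
  [/\ (forall s : R, 0 <= s -> 0 <= phi s <= 1),
      (forall (s t : R), 0 <= s -> s <= t -> phi t <= phi s),
      (forall k (s : R), 0 < s -> derivable (derive1n k phi) s 1),
      (forall s : R, 0 <= s <= delta -> phi s = 1) &
      (forall s, 2 * delta <= s -> phi s = 0)].

(* C^{0,alpha}(Omega); such functions extend continuously to the closure, and
   the values on the boundary are those of this extension. *)
Definition holder (V : normedModType R) (alpha : R) Omega (f : 'rV[R]_3 -> V)
    : Prop :=
  (exists C : R,
     (forall x, Omega x -> `|f x| <= C) /\
     (forall x y, Omega x -> Omega y ->
        `|f x - f y| <= C * (enorm (x - y) `^ alpha))) /\
  {within closure Omega, continuous f}.

Definition test_function Omega (psi : 'rV[R]_3 -> R) : Prop :=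
  let K := closure [set x | psi x != 0] in
  [/\ (forall k, Ck k setT psi), compact K & K `<=` Omega].

Definition divergence_free Omega (u : 'rV[R]_3 -> 'rV[R]_3) : Prop :=
  forall psi, test_function Omega psi ->
    vol_int Omega (fun x => \sum_(i < 3) u x 0 i * pderiv i psi x) = 0.

Definition tangential Omega (u : 'rV[R]_3 -> 'rV[R]_3) : Prop :=
  forall y, bd Omega y -> dot (u y) (normal Omega y) = 0.

Definition velocity_field (alpha : R) Omega (u : 'rV[R]_3 -> 'rV[R]_3) : Prop :=
  [/\ holder alpha Omega u, divergence_free Omega u & tangential Omega u].

(* The space D(bd Omega); only the values on the boundary matter. *)
Definition bd_test Omega (theta : 'rV[R]_3 -> R) : Prop :=
  forall y, bd Omega y -> exists (U : set 'rV[R]_3) (Theta : 'rV[R]_3 -> R),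
    [/\ open U, U y, Ck 4 U Theta &
        forall x, U x -> bd Omega x -> theta x = Theta x].

Definition normal_quotient Omega S (f theta : 'rV[R]_3 -> R) (s : R) : R :=
  surf_int Omega S
    (fun y => (f y - f (y - s *: normal Omega y)) / s * theta y).

Definition normal_derivative_in_D' Omega S (f : 'rV[R]_3 -> R) : Prop :=
  forall theta, bd_test Omega theta ->
    cvg (normal_quotient Omega S f theta s @[s --> 0^'+]).

Definition normal_derivative_eq0 Omega S (f : 'rV[R]_3 -> R) : Prop :=
  forall theta, bd_test Omega theta ->
    normal_quotient Omega S f theta s @[s --> 0^'+] --> (0 : R).

Definition normal_sq Omega (u : 'rV[R]_3 -> 'rV[R]_3) x : R :=
  dot (u x) (normal_ext Omega x) ^+ 2.

Definition cut_normal_sq Omega (phi : R -> R) (u : 'rV[R]_3 -> 'rV[R]_3) x : R :=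
  phi (dist_bd Omega x) * normal_sq Omega u x.

(* A norm of H^2(bd Omega): on the boundary, the gradient of the extension of
   theta which is constant along the normals is the tangential gradient, and
   its Hessian is the covariant Hessian plus curvature times gradient terms. *)
Definition H2norm Omega S (theta : 'rV[R]_3 -> R) : R :=
  let Theta x := theta (proj_bd Omega x) in
  Num.sqrt (surf_int Omega S (fun y =>
    Theta y ^+ 2 + \sum_(i < 3) pderiv i Theta y ^+ 2
    + \sum_(i < 3) \sum_(j < 3) pderiv j (pderiv i Theta) y ^+ 2)).

(* H^{-2}(bd Omega) is the dual of H^2(bd Omega), in which the test functions
   are dense. *)
Definition in_Hm2 Omega S (T : ('rV[R]_3 -> R) -> R) : Prop :=
  (forall (a : R) t1 t2, bd_test Omega t1 -> bd_test Omega t2 ->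
     T (fun x => a * t1 x + t2 x) = a * T t1 + T t2) /\
  exists C : R, forall theta, bd_test Omega theta ->
    `|T theta| <= C * H2norm Omega S theta.

(* G s is the derivative in s of P(y - s n(y)), seen as a curve in
   H^{-2}(bd Omega). *)
Definition normal_trace_condition Omega S (delta : R)
    (u : 'rV[R]_3 -> 'rV[R]_3) (P : 'rV[R]_3 -> R) : Prop :=
  exists G : R -> ('rV[R]_3 -> R) -> R,
    [/\ (forall s : R, 0 <= s < delta -> in_Hm2 Omega S (G s)),
        (forall s : R, 0 <= s < delta -> forall e : R, 0 < e ->
           exists eta : R, 0 < eta /\
             forall t : R, 0 <= t < delta -> `|t - s| < eta ->
             forall theta, bd_test Omega theta ->
               `|G t theta - G s theta| <= e * H2norm Omega S theta),
        (forall s : R, 0 < s < delta -> forall theta, bd_test Omega theta ->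
           is_derive s (1 : R)
             (fun t : R => surf_int Omega S
                (fun y => P (y - t *: normal Omega y) * theta y))
             (G s theta)) &
        (forall theta, bd_test Omega theta ->
           - G 0 theta = surf_int Omega S (fun y =>
             (\sum_(i < 3) \sum_(j < 3) u y 0 i * u y 0 j
                * pderiv i (fun x => normal_ext Omega x 0 j) y) * theta y))].

Definition pressure_potential (alpha : R) Omega S (delta : R) (phi : R -> R)
    (u : 'rV[R]_3 -> 'rV[R]_3) (P : 'rV[R]_3 -> R) : Prop :=
  [/\ holder alpha Omega P,
      (forall psi, test_function Omega psi ->
         - vol_int Omega (fun x => P x * laplacian psi x) =
         vol_int Omega (fun x => \sum_(i < 3) \sum_(j < 3)
                          u x 0 i * u x 0 j * pderiv i (pderiv j psi) x)
         - vol_int Omega (fun x => cut_normal_sq Omega phi u x * laplacian psi x)),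
      normal_trace_condition Omega S delta u P &
      vol_int Omega P = vol_int Omega (cut_normal_sq Omega phi u)].

Definition associated_pressure (alpha : R) Omega S (delta : R) (phi : R -> R)
    (u : 'rV[R]_3 -> 'rV[R]_3) (p : 'rV[R]_3 -> R) : Prop :=
  exists P, pressure_potential alpha Omega S delta phi u P /\
    p = (fun x => P x - cut_normal_sq Omega phi u x).

End domains.

(* Main.v *)
(** Near a boundary point x0 choose a C^{1,1} function h with h > 0 in Omega, h < 0
    outside and |grad h(x0)| = 1, a coordinate i with d_i h(x0) <> 0, another
    coordinate j, and a cutoff chi. The velocity is the rotated gradient
    u = d_j psi e_i - d_i psi e_j of
      psi(x) = chi(x) sum_k r_k^{1+a} b(h(x)/r_k) w_k(x_j/r_k),   r_k = 4^{-k},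
    where b is a bump supported in [1/2, 3/2] and w_k is either sin or cos. The
    bumps have disjoint supports, so u is a-Hoelder; it is divergence free and
    vanishes on the boundary. At depth r_k only the k-th wave is active and, up to
    O(r_k^{1+a}), the normal component is r_k^a chi b w_k'(x_j/r_k) times a
    nonvanishing factor. As sin^2 + cos^2 = 1, one of the two choices of w_k makes
    the integral of (u.n)^2 chi over the parallel surface at depth r_k at least
    c r_k^{2a}. With chi as the test function the difference quotient of (u.n)^2
    at s = r_k is thus at most -c r_k^{2a-1}, which is unbounded for a < 1/2 and
    stays away from 0 for a = 1/2. The pairing of P(y - s n(y)) with chi is
    continuous at s = 0 with a derivative that has a limit there, so by the mean
    value theorem the quotients of P converge, and those of p = P - (u.n)^2
    diverge together with those of (u.n)^2. *)
Require Import Defs.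
From mathcomp Require Import all_boot all_order all_algebra.
From mathcomp Require Import all_classical all_reals all_analysis.
From HB Require Import structures.
From mathcomp Require Import measurable_realfun.
From mathcomp Require Import ring lra.
Import Order.TTheory GRing.Theory Num.Theory.
Import numFieldNormedType.Exports.
Local Open Scope classical_set_scope.
Local Open Scope ring_scope.

(** * Calculus *)

Section line_calculus.
Context {R : realType}.

(** A gradient of size r^a varying on length r is the typical oscillation of an a-Hoelder function;
    this dictates the amplitude r^{1+a} of the stream function. The ratio 4 between scales separates
    the supports, since 3/2 * 1/4 < 1/2, so no series has to be summed. The normal component is d_j
    psi n_i - d_i psi n_j. The part of grad psi that carries b' is parallel to grad h and also has
    size r^a, but it drops out because n is parallel to grad h at the boundary. What survives is the
    derivative of the wave in x_j, times n_i; this is why d_i h must not vanish and why j differs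
    from i. The cancellation is exact at the foot y and is needed at y - r n(y), where it costs a
    Lipschitz error of relative size r. For one fixed phase, a lower bound of the surface integral
    would be an oscillatory integral estimate. Adding the integrals of two phases replaces it by a
    pointwise identity. One of the two is then large, but which one may change with k; the choice
    can be made for each k separately because at depth r_k no other scale is visible. Only first
    order information on the nearest point is used, so a C^{1,1} function h from a graph chart can
    replace the distance function. *)

Lemma is_derive_remainder_vec {V W : normedModType R} (f : V -> W) (x v : V) (l : W) :
  (forall e : R, 0 < e -> \forall t \near (0 : R),
     `|f (x + t *: v) - f x - t *: l| <= e * `|t|) ->
  is_derive x v f l.
Proof.
move=> H; suff H1 : h^-1 *: (f (h *: v + x) - f x) @[h --> 0^'] --> l.
  by apply: DeriveDef; [apply/cvg_ex; exists l|exact: cvg_lim].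
apply/cvgrPdist_le => e e0; near=> h.
have h0 : h != 0 by near: h; exact: nbhs_dnbhs_neq.
have -> : l - h^-1 *: (f (h *: v + x) - f x) =
    - (h^-1 *: (f (x + h *: v) - f x - h *: l)).
  by rewrite (addrC x) [in RHS]scalerBr scalerA mulVf// scale1r opprB.
rewrite normrN normrZ normfV ler_pdivrMl ?normr_gt0// [_ * e]mulrC.
by near: h; apply: nbhs_dnbhs; exact: H.
Unshelve. all: by end_near. Qed.

Lemma is_derive_remainder {V : normedModType R} (f : V -> R) (x v : V) (l : R) :
  (forall e : R, 0 < e -> \forall t \near (0 : R),
     `|f (x + t *: v) - f x - t * l| <= e * `|t|) ->
  is_derive x v f l.
Proof. exact: is_derive_remainder_vec. Qed.

Lemma is_derive_line {V : normedModType R} (f : V -> R) (x v : V) (t : R) (l : R) :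
  is_derive (x + t *: v) v f l ->
  is_derive t 1 (fun s : R => f (x + s *: v)) l.
Proof.
move=> H; have [D1 D2] := H.
have E : (fun h : R => h^-1 *: (f (x + (h *: (1 : R) + t) *: v) - f (x + t *: v))) =
   (fun h => h^-1 *: (f (h *: v + (x + t *: v)) - f (x + t *: v))).
  apply/funext => h; congr (_ *: (f _ - _)).
  by rewrite [_ *: 1]mulr1 scalerDl addrCA addrA addrC [_ + x]addrC addrC.
have D3 : derivable (fun s : R => f (x + s *: v)) t 1.
  by rewrite /derivable E.
apply: DeriveDef => //; rewrite -D2 /derive /= E //.
Qed.

Lemma is_derive_pderiv {V : normedModType R} (f : V -> R) (x v : V) (l : R) :
  is_derive (0 : R) 1 (fun s : R => f (x + s *: v)) l -> is_derive x v f l.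
Proof.
move=> [D1 D2].
have E : (fun h : R => h^-1 *: (f (x + (h *: (1 : R) + 0) *: v) - f (x + 0 *: v))) =
   (fun h => h^-1 *: (f (h *: v + x) - f x)).
  apply/funext => h; congr (_ *: (f _ - f _)).
    by rewrite [_ *: 1]mulr1 addr0 addrC.
  by rewrite scale0r addr0.
move: D1 D2; rewrite /derivable /derive /= E => D1 D2.
exact: DeriveDef.
Qed.

Lemma is_derive1_continuous (f : R -> R) (t l : R) :
  is_derive t 1 f l -> {for t, continuous f}.
Proof.
by move=> [D _]; apply/differentiable_continuous/derivable1_diffP.
Qed.

Lemma MVT_is_derive (f df : R -> R) (a b : R) :
  (forall t : R, t \in `[Num.min a b, Num.max a b]%R -> is_derive t 1 f (df t)) ->
  exists2 c, c \in `[Num.min a b, Num.max a b]%R & f b - f a = df c * (b - a).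
Proof.
have main (a' b' : R) : a' <= b' -> (forall t : R, t \in `[a', b']%R -> is_derive t 1 f (df t)) ->
    exists2 c, c \in `[a', b']%R & f b' - f a' = df c * (b' - a').
  move=> ab H.
  have H1 (t : R) : t \in `]a', b'[%R -> is_derive t 1 f (df t).
    by move=> tab; apply: H; exact: (subset_itv_oo_cc tab).
  have H2 : {within `[a', b'], continuous f}.
    by apply: derivable_within_continuous => t tab; have [] := H t tab.
  have [c cab E] := MVT_segment ab H1 H2.
  by exists c.
case: (leP a b) => ab H; first exact: main.
have [c cab E] := main _ _ (ltW ab) H.
by exists c => //; rewrite -opprB E -mulrN opprB.
Qed.

Lemma itv_minmax_dist (a b c : R) :
  c \in `[Num.min a b, Num.max a b]%R -> `|c - a| <= `|b - a|.
Proof.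
rewrite in_itv /=; case: (leP a b) => ab /andP[h1 h2].
  by rewrite !ger0_norm ?subr_ge0// lerD2r.
rewrite ler0_norm ?subr_le0// ler0_norm ?subr_le0// ?lerN2 ?lerD2r//.
exact: ltW.
Qed.

(** By the mean value theorem the remainder is [(df c - df s) * (t - s)] with [c] between [s] and
    [t]. The constant is [L], not [L / 2], which is all that is needed. *)
Lemma quadratic_remainder (f df : R -> R) (L : R) :
  (forall t : R, is_derive t 1 f (df t)) ->
  (forall s t : R, `|df s - df t| <= L * `|s - t|) ->
  forall s t : R, `|f t - f s - df s * (t - s)| <= L * `|t - s| ^+ 2.
Proof.
move=> D Lip s t.
have [c cst E] := @MVT_is_derive f df s t (fun x _ => D x).
have L0 : 0 <= L.
  have := le_trans (normr_ge0 _) (Lip 1 0); rewrite subr0 normr1 mulr1 //.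
rewrite E -mulrBl normrM expr2 mulrA ler_wpM2r//.
apply: (le_trans (Lip _ _)); rewrite ler_wpM2l//.
exact: itv_minmax_dist.
Qed.

End line_calculus.

Lemma coord_le_norm {R : realType} {n} (x : 'rV[R]_n) i : `|x 0 i| <= `|x|.
Proof.
rewrite [leRHS]/Num.norm /= mx_normrE; apply/bigmax_geP; right => /=.
by exists (0, i).
Qed.

Lemma rV_norm_le {R : realType} {n} (x : 'rV[R]_n) (e : R) : 0 <= e ->
  (forall i, `|x 0 i| <= e) -> `|x| <= e.
Proof.
move=> e0 H; rewrite [leLHS]/Num.norm /= mx_normrE; apply/bigmax_leP; split=> // -[i j] _ /=.
by rewrite ord1.
Qed.

Lemma continuous_norm_lt {R : realType} {V W : normedModType R} (f : V -> W) (x : V)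
    (e : R) : {for x, continuous f} -> 0 < e ->
  exists2 r : R, 0 < r & forall y, `|y - x| < r -> `|f x - f y| < e.
Proof.
move=> /cvgrPdist_lt H /H /nbhs_ballP[r /= r0 Hr]; exists r => // y yx.
by apply: Hr; rewrite -ball_normE /ball_ /= distrC.
Qed.

Lemma near_normP {R : realType} {V : normedModType R} (x : V) (P : V -> Prop) :
  (\forall y \near x, P y) <-> exists2 r : R, 0 < r & forall y, `|y - x| < r -> P y.
Proof.
split=> [/nbhs_ballP[r /= r0 Hr]|[r r0 Hr]].
  by exists r => // y yx; apply: Hr; rewrite -ball_normE /ball_ /= distrC.
by apply/nbhs_ballP; exists r => // y; rewrite -ball_normE /ball_ /= distrC; exact: Hr.
Qed.

Lemma continuous_le_near {R : realType} {V : normedModType R} (f : V -> R) (x : V) :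
  {for x, continuous f} -> \forall y \near x, `|f y| <= `|f x| + 1.
Proof.
move=> cf; have [r r0 H] := continuous_norm_lt _ _ _ cf (@ltr01 R).
apply/near_normP; exists r => // y /H h.
have -> : f y = f x - (f x - f y) by ring.
by rewrite (le_trans (ler_normB _ _))// lerD2l ltW.
Qed.

Lemma forall_I2 (P : 'I_2 -> Prop) : P 0 -> P 1 -> forall i, P i.
Proof.
by move=> P0 P1 [[|[|//]] hi]; [move: P0|move: P1]; congr P; apply/val_inj.
Qed.

Lemma forall_I3 (P : 'I_3 -> Prop) : P 0 -> P 1 -> P 2%:R -> forall i, P i.
Proof.
by move=> P0 P1 P2 [[|[|[|//]]] hi]; [move: P0|move: P1|move: P2]; congr P; apply/val_inj.
Qed.

(** * Hoelder functions *)

Section holder_functions.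
Context {R : realType}.
Implicit Types (V W : normedModType R) (a : R).

(** One constant bounds both the values and the Hoelder quotients, which makes the class stable
    under products. Distances are in the norm of [V]; on row vectors this is the sup norm, which is
    below [enorm], so the estimate required by [holder] follows. *)
Definition holder_on {V} (D : set V) a (f : V -> R) : Prop :=
  exists2 C : R, 0 <= C & (forall x, D x -> `|f x| <= C) /\
    (forall x y, D x -> D y -> `|f x - f y| <= C * `|x - y| `^ a).

Lemma powR_gt_id (t a : R) : 0 <= t <= 1 -> a <= 1 -> t <= t `^ a.
Proof.
move=> /andP[]; rewrite le_eqVlt => /predU1P[<-|t0] t1 a1.
  by rewrite powR_ge0.
by apply: ger1_powR; rewrite ?t0.
Qed.

Lemma powR_ge1 (t a : R) : 1 <= t -> 0 <= a -> 1 <= t `^ a.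
Proof. by move=> t1 a0; have := ler_powR t1 a0; rewrite powRr0. Qed.

Lemma holder_onS {V} (D E : set V) a f :
  D `<=` E -> holder_on E a f -> holder_on D a f.
Proof.
move=> DE [C C0 [H1 H2]]; exists C => //; split => [x /DE|x y /DE xE /DE yE].
  exact: H1.
exact: H2.
Qed.

Lemma eq_holder_on {V} (D : set V) a f g :
  (forall x, D x -> f x = g x) -> holder_on D a f -> holder_on D a g.
Proof.
move=> E [C C0 [H1 H2]]; exists C => //; split => [x Dx|x y Dx Dy].
  by rewrite -E// H1.
by rewrite -!E// H2.
Qed.

Lemma holder_on_cst {V} (D : set V) a (k : R) : holder_on D a (fun=> k).
Proof.
exists `|k|; first exact: normr_ge0.
by split=> // x y _ _; rewrite subrr normr0 mulr_ge0// powR_ge0.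
Qed.

Lemma holder_onD {V} (D : set V) a f g :
  holder_on D a f -> holder_on D a g -> holder_on D a (fun x => f x + g x).
Proof.
move=> [C C0 [H1 H2]] [C' C'0 [H1' H2']]; exists (C + C'); first exact: addr_ge0.
split=> [x Dx|x y Dx Dy].
  by rewrite (le_trans (ler_normD _ _))// lerD ?H1 ?H1'.
rewrite opprD addrACA (le_trans (ler_normD _ _))// [leRHS]mulrDl lerD ?H2 ?H2'//.
Qed.

Lemma holder_onM {V} (D : set V) a f g :
  holder_on D a f -> holder_on D a g -> holder_on D a (fun x => f x * g x).
Proof.
move=> [C C0 [H1 H2]] [C' C'0 [H1' H2']].
exists (C * C' + C * C'); first by rewrite addr_ge0 ?mulr_ge0.
split=> [x Dx|x y Dx Dy].
  rewrite normrM (le_trans (ler_pM _ _ (H1 _ Dx) (H1' _ Dx)))//.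
  by rewrite lerDl mulr_ge0.
have -> : f x * g x - f y * g y = f x * (g x - g y) + (f x - f y) * g y by ring.
rewrite (le_trans (ler_normD _ _))// [leRHS]mulrDl lerD// normrM.
  by rewrite -mulrA ler_pM ?H1 ?H2'.
by rewrite (mulrC C) -mulrA mulrC ler_pM ?H1' ?H2.
Qed.

Lemma holder_onN {V} (D : set V) a f :
  holder_on D a f -> holder_on D a (fun x => - f x).
Proof.
move=> [C C0 [H1 H2]]; exists C => //; split=> [x Dx|x y Dx Dy].
  by rewrite normrN H1.
by rewrite -opprD normrN H2.
Qed.

Lemma holder_onB {V} (D : set V) a f g :
  holder_on D a f -> holder_on D a g -> holder_on D a (fun x => f x - g x).
Proof. by move=> Hf Hg; apply: holder_onD => //; exact: holder_onN. Qed.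

Lemma holder_onX {V} (D : set V) a f n :
  holder_on D a f -> holder_on D a (fun x => f x ^+ n).
Proof.
move=> Hf; elim: n => [|n IH]; first exact: holder_on_cst.
rewrite (_ : (fun _ => _) = (fun x => f x * f x ^+ n)); first exact: holder_onM.
by apply/funext => x; rewrite exprS.
Qed.

Lemma holder_on_sum {V} (D : set V) a n (f : 'I_n -> V -> R) :
  (forall i, holder_on D a (f i)) -> holder_on D a (fun x => \sum_(i < n) f i x).
Proof.
elim: n f => [|n IH] f H.
  by apply: (eq_holder_on _ _ (fun=> 0)) => [x _|]; rewrite ?big_ord0//;
    exact: holder_on_cst.
apply: (eq_holder_on _ _ (fun x => \sum_(i < n) f (widen_ord (leqnSn n) i) x + f ord_max x)).
  by move=> x _; rewrite big_ord_recr.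
by apply: holder_onD => //; apply: IH => i; exact: H.
Qed.

(** At distance at most 1 one has [t <= t ^ a]; at larger distances the bound on the values
    suffices. *)
Lemma lipschitz_holder_on {V} (D : set V) a (K : R) f : 0 <= a <= 1 ->
  (exists M, forall x, D x -> `|f x| <= M) ->
  (forall x y, D x -> D y -> `|f x - f y| <= K * `|x - y|) ->
  holder_on D a f.
Proof.
move=> /andP[a0 a1] [M HM] HK.
pose N := `|M| + `|M| + `|K|.
exists N; first by rewrite !addr_ge0.
have MN : `|M| <= N by rewrite /N -addrA lerDl addr_ge0.
split=> [x Dx|x y Dx Dy].
  by rewrite (le_trans (HM _ Dx))// (le_trans (ler_norm _)).
have [d1|d1] := leP `|x - y| 1.
  rewrite (le_trans (HK _ _ Dx Dy))//.
  rewrite (@le_trans _ _ (`|K| * `|x - y|))// ?ler_wpM2r ?ler_norm//.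
  rewrite ler_pM ?lerDr ?addr_ge0// powR_gt_id// normr_ge0 d1//.
rewrite (@le_trans _ _ (N * 1))//; last first.
  by rewrite ler_wpM2l ?addr_ge0// powR_ge1// ltW.
rewrite mulr1 (le_trans (ler_normB _ _))// /N -[leLHS]addr0 lerD// lerD//.
- by rewrite (le_trans (HM _ Dx))// ler_norm.
- by rewrite (le_trans (HM _ Dy))// ler_norm.
Qed.

Lemma holder_on_comp {V W} (D : set V) (E : set W) a (K : R) f (g : V -> W) : 0 <= a ->
  holder_on E a f -> (forall x, D x -> E (g x)) ->
  (forall x y, D x -> D y -> `|g x - g y| <= K * `|x - y|) ->
  holder_on D a (fun x => f (g x)).
Proof.
move=> a0 [C C0 [H1 H2]] DE HK.
pose N := C + C * `|K| `^ a.
have N0 : 0 <= C * `|K| `^ a by rewrite mulr_ge0// powR_ge0.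
exists N; first by rewrite addr_ge0.
split=> [x Dx|x y Dx Dy]; first by rewrite (le_trans (H1 _ (DE _ Dx)))// lerDl.
rewrite (le_trans (H2 _ _ (DE _ Dx) (DE _ Dy)))//.
rewrite (@le_trans _ _ (C * (`|K| * `|x - y|) `^ a))//.
  rewrite ler_wpM2l// ge0_ler_powR// ?nnegrE ?mulr_ge0//.
  by rewrite (le_trans (HK _ _ Dx Dy))// ler_wpM2r// ler_norm.
by rewrite powRM// mulrA ler_wpM2r ?powR_ge0// lerDr.
Qed.

(** The gap between the radii [e] and [2 * e] does the work: a point where [f] may be nonzero and a
    point outside the larger ball are at distance at least [e], so boundedness of [f] gives the
    estimate there. *)
Lemma holder_on_extend {V} (x0 : V) (e a : R) f : 0 < e -> 0 <= a ->
  holder_on [set x | `|x - x0| < 2 * e] a f ->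
  (forall x, e <= `|x - x0| -> f x = 0) -> holder_on setT a f.
Proof.
move=> e0 a0 [C C0 [H1 H2]] Hz.
have ea : 0 < e `^ a by rewrite powR_gt0.
pose N := C + C / e `^ a.
have N0 : 0 <= C / e `^ a by rewrite divr_ge0// ltW.
have fC x : `|f x| <= C.
  have [h|h] := ltP `|x - x0| (2 * e); first exact: H1.
  by rewrite Hz ?normr0// (le_trans _ h)// ler_pMl// ler1n.
have far x y : `|x - x0| < e -> 2 * e <= `|y - x0| ->
    `|f x - f y| <= N * `|x - y| `^ a.
  move=> hx hy; rewrite [f y]Hz ?subr0; last by rewrite (le_trans _ hy)// ler_pMl// ler1n.
  have d : e <= `|x - y|.
    have : `|y - x0| <= `|x - y| + `|x - x0|.
      have -> : y - x0 = - (x - y) + (x - x0) by rewrite opprB addrA subrK.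
      by rewrite (le_trans (ler_normD _ _))// normrN.
    by lra.
  rewrite (le_trans (fC x))// (@le_trans _ _ (C / e `^ a * e `^ a))//.
    by rewrite divfK// gt_eqF.
  by rewrite ler_pM ?powR_ge0// ?lerDr// ge0_ler_powR// ?nnegrE// ltW.
exists N; first exact: addr_ge0.
split=> [x _|x y _ _]; first by rewrite (le_trans (fC _))// lerDl.
have [hx|hx] := ltP `|x - x0| (2 * e); have [hy|hy] := ltP `|y - x0| (2 * e).
- by rewrite (le_trans (H2 _ _ hx hy))// ler_wpM2r ?powR_ge0// lerDl.
- have [hx'|hx'] := ltP `|x - x0| e; first exact: far.
  rewrite !Hz ?subr0 ?normr0 ?mulr_ge0 ?powR_ge0 ?addr_ge0//.
  by rewrite (le_trans _ hy)// ler_pMl// ler1n.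
- have [hy'|hy'] := ltP `|y - x0| e.
    by rewrite distrC [`|x - y|]distrC; exact: far.
  rewrite !Hz ?subr0 ?normr0 ?mulr_ge0 ?powR_ge0 ?addr_ge0//.
  by rewrite (le_trans _ hx)// ler_pMl// ler1n.
- rewrite !Hz ?subr0 ?normr0 ?mulr_ge0 ?powR_ge0 ?addr_ge0//.
    by rewrite (le_trans _ hy)// ler_pMl// ler1n.
  by rewrite (le_trans _ hx)// ler_pMl// ler1n.
Qed.

Lemma powR_lt_near (C a e : R) : 0 <= C -> 0 < a -> 0 < e ->
  exists2 d : R, 0 < d & forall t, 0 <= t < d -> C * t `^ a < e.
Proof.
move=> C0 a0 e0; pose k := (e / (C + 1)).
have C1 : 0 < C + 1 by rewrite ltr_wpDl.
have k0 : 0 < k by rewrite divr_gt0.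
exists (k `^ a^-1); first by rewrite powR_gt0.
move=> t /andP[t0 tk].
have ta : t `^ a < k.
  have ka : (k `^ a^-1) `^ a = k by rewrite -powRrM mulVf ?gt_eqF// powRr1// ltW.
  by rewrite -[ltRHS]ka gt0_ltr_powR// nnegrE// powR_ge0.
rewrite (@le_lt_trans _ _ ((C + 1) * t `^ a))//.
  by rewrite ler_wpM2r ?powR_ge0// lerDl.
by rewrite mulrC -ltr_pdivlMr.
Qed.

Lemma holder_on_continuous {V} (f : V -> R) a : 0 < a ->
  holder_on setT a f -> continuous f.
Proof.
move=> a0 [C C0 [_ H]] x; apply/cvgrPdist_lt => e e0.
have [d d0 Hd] := powR_lt_near C a e C0 a0 e0.
near=> y; rewrite (le_lt_trans (H _ _ I I))// Hd// normr_ge0 /=.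
near: y; exact: cvgr_dist_lt.
Unshelve. all: by end_near. Qed.

End holder_functions.

(** * Lacunary oscillations *)

Section profile.
Context {R : realType}.

Lemma is_derive_comp1 {V : normedModType R} (f : V -> R) (g : R -> R) (x v : V)
    (df dg : R) :
  is_derive x v f df -> is_derive (f x) 1 g dg ->
  is_derive x v (fun y => g (f y)) (dg * df).
Proof.
move=> Hf Hg; apply: is_derive_pderiv.
have Hl : is_derive (0 : R) 1 (fun s : R => f (x + s *: v)) df.
  by apply: is_derive_line; rewrite scale0r addr0.
apply: (@is_derive1_comp R g (fun s : R => f (x + s *: v)) 0 dg df) => //.
by rewrite scale0r addr0.
Qed.

(** For [m > 0] this is a function of class C^{m-1} vanishing on the negative axis. Cutoffs built
    from it are piecewise polynomial, so all their constants are explicit. *)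
Definition pospow (m : nat) (t : R) : R := Num.max 0 t ^+ m.

Lemma pospow_ge0 m t : 0 <= pospow m t.
Proof. by rewrite exprn_ge0// le_max lexx. Qed.

Lemma max0_lip (s t : R) : `|Num.max 0 s - Num.max 0 t| <= `|s - t|.
Proof.
by case: (leP 0 s) => hs; case: (leP 0 t) => ht; rewrite ?subrr ?subr0 ?sub0r
  ?normrN ?normr0// ler_norml; have := ler_norm (s - t); have := ler_normr (s - t) ;
  case: (ger0P (s - t)) => h; rewrite ?ger0_norm//; lra.
Qed.

Lemma pospowS m (t : R) : pospow m.+2 t = t * pospow m.+1 t.
Proof.
rewrite /pospow [in LHS]exprS; case: (leP 0 t) => // _.
by rewrite !expr0n/= !mulr0.
Qed.

(** The exponent starts at 2 because the positive part itself has a corner at 0. For exponent 2 the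
    remainder is at most [s ^ 2] in each sign case; higher powers follow by the product rule. *)
Lemma is_derive_pospow m (t : R) :
  is_derive t 1 (pospow m.+2) (m.+2%:R * pospow m.+1 t).
Proof.
elim: m => [|m IH].
  apply: is_derive_remainder => e e0.
  have Hn : \forall s \near (0 : R), `|s| <= e by apply: nbhs0_le.
  apply: filterS Hn => s se.
  rewrite [s *: 1]mulr1.
  have H : `|pospow 2 (t + s) - pospow 2 t - s * (2 * pospow 1 t)| <= `|s| * `|s|.
    rewrite -normrM [in leRHS]ger0_norm ?sqr_ge0// /pospow !expr1.
    case: (leP 0 t) => ht; case: (leP 0 (t + s)) => hts;
      rewrite ler_norml; apply/andP; split; nra.
  by rewrite (le_trans H)// ler_wpM2r.
rewrite (_ : pospow m.+3 = id * pospow m.+2); last first.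
  by apply/funext => s; rewrite pospowS.
apply: is_derive_eq; rewrite /= pospowS.
rewrite -[_%:A]/(_ * 1) -[t *: _]/(t * _).
by rewrite -(natr1 m.+2); ring.
Qed.

(** A C^{1,1} bump centred at 1 and supported in [[1/2, 3/2]]. *)
Definition bump (t : R) : R := pospow 2 (1 - 4 * (t - 1) ^+ 2).
Definition dbump (t : R) : R := -16 * (t - 1) * pospow 1 (1 - 4 * (t - 1) ^+ 2).

Lemma is_derive_bump (t : R) : is_derive t 1 bump (dbump t).
Proof.
have D : is_derive t (1 : R) (fun s : R => 1 - 4 * (s - 1) ^+ 2) (- 8 * (t - 1)).
  rewrite (_ : (fun _ => _) = cst 1 - 4 *: (id - cst 1) ^+ 2); last first.
    by apply/funext => s; rewrite /= fctE.
  apply: is_derive_eq; rewrite /= !fctE subr0 sub0r expr1.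
  by rewrite -[_ *: 1]/(_ * 1) -[_ *: (_ * _)]/(_ * (_ * _)) /=; ring.
have -> : dbump t =
    2%:R * pospow 1 (1 - 4 * (t - 1) ^+ 2) * (- 8 * (t - 1)) by rewrite /dbump; ring.
exact: is_derive_comp1 _ _ _ _ _ _ D (is_derive_pospow 0 _).
Qed.

Lemma bump_out (t : R) : 2^-1 <= `|t - 1| -> bump t = 0 /\ dbump t = 0.
Proof.
move=> h; have h2 : 1 - 4 * (t - 1) ^+ 2 <= 0.
  by rewrite -real_normK ?num_real//; nra.
by rewrite /bump /dbump /pospow max_l// !expr0n/= mulr0.
Qed.

Lemma bump_bound t : 0 <= bump t <= 1.
Proof.
rewrite pospow_ge0 /bump /pospow /=; have h := sqr_ge0 (t - 1).
by rewrite exprn_ile1 ?le_max ?lexx// ge_max ler01/=; lra.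
Qed.

(** Here the bump is at least (3/4)^2. The margin 1/4 is the accuracy with which [h x / s] is known
    to be 1 at depth [s]. *)
Lemma bump_ge (t : R) : `|t - 1| <= 4^-1 -> 2^-1 <= bump t.
Proof.
move=> h; have h2 : 3 / 4 <= 1 - 4 * (t - 1) ^+ 2.
  by rewrite -real_normK ?num_real//; have := normr_ge0 (t - 1); nra.
by rewrite /bump /pospow max_r; nra.
Qed.

Lemma dbump_bound t : `|dbump t| <= 8.
Proof.
have [h|h] := leP 2^-1 `|t - 1|; first by rewrite (bump_out _ h).2 normr0.
move: h; rewrite /dbump ltr_norml => /andP[h1 h2].
have h3 : (t - 1) ^+ 2 <= 4^-1 by nra.
have h4 := sqr_ge0 (t - 1).
rewrite /pospow expr1 max_r; last by lra.
by rewrite normrM -[leRHS]mulr1 ler_pM// ler_norml; apply/andP; split; lra.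
Qed.

Lemma dbump_lip s t : `|dbump s - dbump t| <= 64 * `|s - t|.
Proof.
have wlog_in (x y : R) : `|x - 1| < 2^-1 -> 2^-1 <= `|y - 1| ->
    `|dbump x - dbump y| <= 64 * `|x - y|.
  move=> hx hy; rewrite (bump_out _ hy).2 subr0.
  have hd : 2^-1 - `|x - 1| <= `|x - y|.
    have : `|y - 1| <= `|x - y| + `|x - 1|.
      have -> : y - 1 = - (x - y) + (x - 1) by ring.
      by rewrite (le_trans (ler_normD _ _))// normrN.
    by lra.
  rewrite (le_trans _ (ler_wpM2l _ hd))//.
  rewrite /dbump normrM normrM normrN normr_nat.
  have E : (x - 1) ^+ 2 = `|x - 1| ^+ 2 by rewrite real_normK ?num_real.
  rewrite E; have := normr_ge0 (x - 1); move: hx; set q := `|x - 1| => hx q0.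
  rewrite /pospow expr1 max_r; last by nra.
  rewrite ger0_norm; last by nra.
  (* With [q] the distance to the centre, the claim is [16 * q * (1 - 4 * q^2) <= 32 * (1 - 2 * q)];
     dividing by [1 - 2 * q] leaves [q * (1 + 2 * q) <= 2]. *)
  have h1 : 0 <= (1 - 2 * q) * (1 - q * (1 + 2 * q)).
    by apply: mulr_ge0; nra.
  by nra.
have [hs|hs] := leP 2^-1 `|s - 1|; have [ht|ht] := leP 2^-1 `|t - 1|.
- by rewrite !(bump_out _ _).2// subrr normr0 mulr_ge0.
- by rewrite distrC [in leRHS]distrC wlog_in.
- exact: wlog_in.
move: hs ht; rewrite !ltr_norml => /andP[s1 s2] /andP[t1 t2].
have -> : dbump s - dbump t =
    -16 * (1 - 4 * ((s - 1) ^+ 2 + (s - 1) * (t - 1) + (t - 1) ^+ 2)) * (s - t).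
  by rewrite /dbump /pospow !expr1 !max_r; [ring|nra|nra].
rewrite normrM ler_wpM2r// ler_norml; apply/andP; split; nra.
Qed.

End profile.

(** * Waves at a single scale *)

Section oscillating_profile.
Context {R : realType}.

Lemma derive_bounded_lip (f df : R -> R) (M : R) :
  (forall t : R, is_derive t 1 f (df t)) -> (forall t, `|df t| <= M) ->
  forall s t, `|f s - f t| <= M * `|s - t|.
Proof.
move=> D B s t; have [c _ ->] := @MVT_is_derive R f df t s (fun x _ => D x).
by rewrite normrM ler_wpM2r.
Qed.

(** The flag selects one of two phases shifted by a quarter period, so that the squares of the two
    derivatives add up to 1. *)
Definition wave (ph : bool) : R -> R := if ph then sin else cos.
Definition dwave (ph : bool) (z : R) : R := if ph then cos z else - sin z.

Lemma is_derive_wave ph (z : R) : is_derive z 1 (wave ph) (dwave ph z).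
Proof. by case: ph; [exact: is_derive_sin|exact: is_derive_cos]. Qed.

Lemma wave_bound ph z : `|wave ph z| <= 1.
Proof. by case: ph; [exact: sin_max|exact: cos_max]. Qed.

Lemma dwave_bound ph z : `|dwave ph z| <= 1.
Proof. by case: ph; rewrite /dwave ?normrN; [exact: cos_max|exact: sin_max]. Qed.

Lemma dwaveE ph z : dwave ph z = if ph then wave false z else - wave true z.
Proof. by case: ph. Qed.

Lemma wave_lip ph s t : `|wave ph s - wave ph t| <= `|s - t|.
Proof.
rewrite -[leRHS]mul1r; apply: (derive_bounded_lip _ (dwave ph)) => [x|x].
  exact: is_derive_wave.
exact: dwave_bound.
Qed.

Lemma dwave_lip ph s t : `|dwave ph s - dwave ph t| <= `|s - t|.
Proof.
rewrite !dwaveE; case: ph; first exact: wave_lip.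
by rewrite -opprD normrN wave_lip.
Qed.

Lemma dwave_sq z : dwave true z ^+ 2 + dwave false z ^+ 2 = 1.
Proof. by rewrite /= sqrrN cos2Dsin2. Qed.

Lemma bump_lip (s t : R) : `|bump s - bump t| <= 8 * `|s - t|.
Proof.
apply: (derive_bounded_lip _ dbump) => [x|x]; first exact: is_derive_bump.
exact: dbump_bound.
Qed.

Lemma norm_bump (t : R) : `|bump t| <= 1.
Proof. by have /andP[h1 h2] := bump_bound t; rewrite ger0_norm. Qed.

Lemma prod_lip (x x' y y' A B D E : R) :
  `|x| <= A -> `|y'| <= B -> `|x - x'| <= D -> `|y - y'| <= E ->
  `|x * y - x' * y'| <= A * E + D * B.
Proof.
move=> hx hy hD hE.
have -> : x * y - x' * y' = x * (y - y') + (x - x') * y' by ring.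
by rewrite (le_trans (ler_normD _ _))// !normrM lerD// ler_pM.
Qed.

(** Second order Taylor estimate of the product: 73 = 64 + 1 + 8, from the Lipschitz constants of
    [dbump] and [dwave] and from the mixed term [dbump t * (t' - t)] times the increment of the
    wave. *)
Lemma wave_bump_remainder ph (t t' z z' d : R) : `|t' - t| <= d -> `|z' - z| <= d ->
  `|bump t' * wave ph z' - bump t * wave ph z - dbump t * wave ph z * (t' - t)
    - bump t * dwave ph z * (z' - z)| <= 73 * (d * d).
Proof.
move=> ht hz.
have d0 : 0 <= d := le_trans (normr_ge0 _) ht.
have sq (x : R) : `|x| <= d -> `|x| ^+ 2 <= d * d by move=> h; rewrite expr2 ler_pM.
have qb : `|bump t' - bump t - dbump t * (t' - t)| <= 64 * (d * d).
  rewrite (le_trans (quadratic_remainder _ _ _ is_derive_bump dbump_lip _ _))//.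
  by rewrite ler_wpM2l// sq.
have qw : `|wave ph z' - wave ph z - dwave ph z * (z' - z)| <= 1 * (d * d).
  have L1 s t0 : `|dwave ph s - dwave ph t0| <= 1 * `|s - t0|.
    by rewrite mul1r dwave_lip.
  rewrite (le_trans (quadratic_remainder _ _ _ (is_derive_wave ph) L1 _ _))//.
  by rewrite ler_wpM2l// sq.
have -> : bump t' * wave ph z' - bump t * wave ph z - dbump t * wave ph z * (t' - t)
    - bump t * dwave ph z * (z' - z) =
  (bump t' - bump t - dbump t * (t' - t)) * wave ph z' +
  bump t * (wave ph z' - wave ph z - dwave ph z * (z' - z)) +
  dbump t * ((t' - t) * (wave ph z' - wave ph z)) by ring.
have -> : 73 * (d * d) = 64 * (d * d) * 1 + 1 * (1 * (d * d)) + 8 * (d * d) by ring.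
rewrite (le_trans (ler_normD _ _))// lerD//.
  by rewrite (le_trans (ler_normD _ _))// lerD// normrM ler_pM ?wave_bound ?norm_bump.
rewrite normrM ler_pM ?dbump_bound// normrM ler_pM//.
by rewrite (le_trans (wave_lip _ _ _)).
Qed.

(** This is min(1, x) <= x^a. With [x = d / r] it turns bounds that degenerate as the scale [r]
    shrinks into Hoelder bounds that are uniform in [r]. *)
Lemma interp_powR (X A x a : R) : 0 <= A -> 0 <= a <= 1 -> 0 <= x ->
  X <= A -> X <= A * x -> X <= A * x `^ a.
Proof.
move=> A0 /andP[a0 a1] x0 h1 h2; have [x1|x1] := leP x 1.
  by rewrite (le_trans h2)// ler_wpM2l// powR_gt_id// x0.
by rewrite (le_trans h1)// -[leLHS]mulr1 ler_wpM2l// powR_ge1// ltW.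
Qed.

Section scaled.
Variables (a r : R) (ph : bool).
Hypotheses (a01 : 0 < a < 1) (r0 : 0 < r) (r1 : r <= 1).

Definition swave (t z : R) : R := r * r `^ a * (bump (t / r) * wave ph (z / r)).
Definition swave_t (t z : R) : R := r `^ a * (dbump (t / r) * wave ph (z / r)).
Definition swave_z (t z : R) : R := r `^ a * (bump (t / r) * dwave ph (z / r)).

Let a01' : 0 <= a <= 1. Proof. by case/andP: a01 => *; rewrite !ltW. Qed.
Let ra0 : 0 < r `^ a. Proof. exact: powR_gt0. Qed.
Let ra1 : r `^ a <= 1.
Proof.
have := @ge0_ler_powR R a; case/andP: a01' => h _ /(_ h r 1).
by rewrite !nnegrE (ltW r0) ler01 powR1; apply.
Qed.

Lemma rescale_powR (d : R) : 0 <= d -> r `^ a * (d / r) `^ a = d `^ a.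
Proof.
by move=> d0; rewrite -powRM ?(ltW r0) ?divr_ge0 ?(ltW r0)// mulrCA divff ?mulr1 ?gt_eqF.
Qed.

Lemma dist_scale (s t d : R) : `|s - t| <= d -> `|s / r - t / r| <= d / r.
Proof.
by move=> h; rewrite -mulrBl normrM normfV (gtr0_norm r0) ler_pM2r ?invr_gt0.
Qed.

(** The factor [r ^ a] in front and the ratio [d / r] inside combine to [d ^ a], whatever [r] is.
    The constant 72 = 64 + 8 is the Lipschitz constant of [dbump] times a wave, the worst of the
    three products. *)
Lemma swave_lip (t t' z z' d : R) : `|t - t'| <= d -> `|z - z'| <= d ->
  [/\ `|swave t z - swave t' z'| <= 72 * d `^ a,
      `|swave_t t z - swave_t t' z'| <= 72 * d `^ a &
      `|swave_z t z - swave_z t' z'| <= 72 * d `^ a].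
Proof.
move=> ht hz; have d0 : 0 <= d := le_trans (normr_ge0 _) ht.
have htr := dist_scale _ _ _ ht; have hzr := dist_scale _ _ _ hz.
have dr0 : 0 <= d / r by rewrite divr_ge0// ltW.
have bl : `|bump (t / r) - bump (t' / r)| <= 8 * (d / r).
  by rewrite (le_trans (bump_lip _ _))// ler_wpM2l.
have dbl : `|dbump (t / r) - dbump (t' / r)| <= 64 * (d / r).
  by rewrite (le_trans (dbump_lip _ _))// ler_wpM2l.
have wl : `|wave ph (z / r) - wave ph (z' / r)| <= d / r.
  by rewrite (le_trans (wave_lip _ _ _)).
have dwl : `|dwave ph (z / r) - dwave ph (z' / r)| <= d / r.
  by rewrite (le_trans (dwave_lip _ _ _)).
have key (k X Y : R) : 0 <= k <= r `^ a -> `|X| <= 8 -> `|Y| <= 8 ->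
    `|X - Y| <= 72 * (d / r) -> `|k * X - k * Y| <= 72 * d `^ a.
  move=> /andP[k0 kr] hX hY hXY; rewrite -mulrBr normrM (ger0_norm k0).
  rewrite (@le_trans _ _ (r `^ a * (72 * (d / r) `^ a)))//; last first.
    by rewrite mulrCA rescale_powR.
  rewrite ler_pM//; apply: interp_powR => //.
  by rewrite (le_trans (ler_normB _ _))//; lra.
have m8 (x y : R) : `|x| <= 8 -> `|y| <= 1 -> `|x * y| <= 8.
  by move=> hx hy; rewrite normrM -[leRHS]mulr1 ler_pM.
have b8 s : `|bump s| <= (8 : R) by rewrite (le_trans (norm_bump _))// ler1n.
split; apply: key; rewrite ?(m8 (bump _)) ?(m8 (dbump _)) ?b8 ?wave_bound ?dwave_bound
  ?dbump_bound// ?(ltW ra0) ?lexx//.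
- by rewrite mulr_ge0 ?(ltW r0) ?(ltW ra0)//= ler_piMl// ltW.
- have := prod_lip _ _ _ _ _ _ _ _ (norm_bump (t / r)) (wave_bound ph (z' / r)) bl wl.
  by move=> h; apply: (le_trans h); lra.
- have := prod_lip _ _ _ _ _ _ _ _ (dbump_bound (t / r)) (wave_bound ph (z' / r)) dbl wl.
  by move=> h; apply: (le_trans h); lra.
- have := prod_lip _ _ _ _ _ _ _ _ (norm_bump (t / r)) (dwave_bound ph (z' / r)) bl dwl.
  by move=> h; apply: (le_trans h); lra.
Qed.

Lemma swave_bound (t z : R) :
  [/\ `|swave t z| <= r * r `^ a, `|swave_t t z| <= 8 * r `^ a &
      `|swave_z t z| <= r `^ a].
Proof.
split; rewrite normrM ger0_norm ?(ltW ra0) ?mulr_ge0 ?(ltW r0) ?(ltW ra0)//.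
- by rewrite ler_piMr ?mulr_ge0 ?(ltW r0) ?(ltW ra0)// normrM -[leRHS]mulr1 ler_pM ?norm_bump ?wave_bound.
- by rewrite mulrC ler_wpM2r ?(ltW ra0)// normrM -[leRHS]mulr1 ler_pM ?dbump_bound ?wave_bound.
- by rewrite ler_piMr ?(ltW ra0)// normrM -[leRHS]mulr1 ler_pM ?norm_bump ?dwave_bound.
Qed.

Lemma swave_bound8 (t z : R) :
  [/\ `|swave t z| <= 8, `|swave_t t z| <= 8 & `|swave_z t z| <= 8].
Proof.
have [h1 h2 h3] := swave_bound t z; split.
- rewrite (le_trans h1)// (@le_trans _ _ (1 * 1))// ?mulr1 ?ler1n//.
  by rewrite -[leRHS]mulr1 ler_pM ?(ltW r0) ?(ltW ra0).
- by rewrite (le_trans h2)// ler_piMr.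
- by rewrite (le_trans h3)// (le_trans ra1)// ler1n.
Qed.

(** For [d <= r] the second order estimate is the better one, for [d >= r] the trivial first order
    bound of each term; [interp_powR] joins them into a remainder of order [1 + a], uniform in the
    scale. *)
Lemma swave_remainder (t t' z z' d : R) : `|t' - t| <= d -> `|z' - z| <= d ->
  `|swave t' z' - swave t z - swave_t t z * (t' - t) - swave_z t z * (z' - z)| <=
  73 * (d * d `^ a).
Proof.
move=> ht hz; have d0 : 0 <= d := le_trans (normr_ge0 _) ht.
have htr := dist_scale _ _ _ ht; have hzr := dist_scale _ _ _ hz.
have dr0 : 0 <= d / r by rewrite divr_ge0// ltW.
have rn0 : r != 0 by rewrite gt_eqF.
have E : swave t' z' - swave t z - swave_t t z * (t' - t) - swave_z t z * (z' - z) =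
  r * r `^ a * (bump (t' / r) * wave ph (z' / r) - bump (t / r) * wave ph (z / r)
   - dbump (t / r) * wave ph (z / r) * (t' / r - t / r)
   - bump (t / r) * dwave ph (z / r) * (z' / r - z / r)).
  by rewrite /swave /swave_t /swave_z; field.
have q := wave_bump_remainder ph _ _ _ _ _ htr hzr.
have l : `|bump (t' / r) * wave ph (z' / r) - bump (t / r) * wave ph (z / r)
   - dbump (t / r) * wave ph (z / r) * (t' / r - t / r)
   - bump (t / r) * dwave ph (z / r) * (z' / r - z / r)| <= 73 * (d / r).
  have l1 : `|bump (t' / r) * wave ph (z' / r) - bump (t / r) * wave ph (z / r)| <=
      1 * (d / r) + 8 * (d / r) * 1.
    apply: prod_lip; rewrite ?norm_bump ?wave_bound//.
      by rewrite (le_trans (bump_lip _ _))// ler_wpM2l.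
    by rewrite (le_trans (wave_lip _ _ _)).
  have l2 : `|dbump (t / r) * wave ph (z / r) * (t' / r - t / r)| <= 8 * 1 * (d / r).
    by rewrite normrM ler_pM// normrM ler_pM ?dbump_bound ?wave_bound.
  have l3 : `|bump (t / r) * dwave ph (z / r) * (z' / r - z / r)| <= 1 * 1 * (d / r).
    by rewrite normrM ler_pM// normrM ler_pM ?norm_bump ?dwave_bound.
  rewrite (le_trans (ler_normB _ _))// (le_trans (lerD (ler_normB _ _) (lexx _)))//.
  by rewrite (le_trans (lerD (lerD l1 l2) l3))//; lra.
rewrite E normrM ger0_norm ?mulr_ge0 ?(ltW r0) ?(ltW ra0)//.
rewrite (@le_trans _ _ (r * r `^ a * (73 * (d / r) * (d / r) `^ a)))//.
  rewrite ler_wpM2l ?mulr_ge0 ?(ltW r0) ?(ltW ra0)//.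
  apply: interp_powR => //; first by rewrite mulr_ge0.
  by rewrite -[leRHS]mulrA.
rewrite le_eqVlt; apply/orP; left; apply/eqP.
by rewrite -[in RHS](rescale_powR _ d0); field.
Qed.

Lemma swave_out (t z : R) : 2^-1 <= `|t / r - 1| ->
  [/\ swave t z = 0, swave_t t z = 0 & swave_z t z = 0].
Proof.
by move=> /bump_out[h1 h2]; rewrite /swave /swave_t /swave_z h1 h2 !mul0r !mulr0.
Qed.

End scaled.
End oscillating_profile.

(** * Superposition of all scales *)

Section lacunary_sum.
Context {R : realType}.

Definition scale (k : nat) : R := 4^-1 ^+ k.

Lemma scale_gt0 k : 0 < scale k.
Proof. by rewrite exprn_gt0. Qed.

Lemma scale_le1 k : scale k <= 1.
Proof. by rewrite exprn_ile1// ?invr_ge0 ?invf_le1// ?ler1n. Qed.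

Lemma scale_lt k l : (k < l)%N -> 4 * scale l <= scale k.
Proof.
move=> kl; rewrite /scale -(subnK kl) exprD exprS.
have h : 4^-1 ^+ (l - k.+1) <= 1 :> R by rewrite exprn_ile1// ?invr_ge0 ?invf_le1// ?ler1n.
have := scale_gt0 k; rewrite /scale => k0.
set A := _ ^+ (l - _) in h *; set B := _ ^+ k in k0 *.
have E : 4 * (A * (4^-1 * B)) = A * B by field.
by rewrite E ler_piMl// ltW.
Qed.

Lemma scale_cvg0 : scale k @[k --> \oo] --> (0 : R).
Proof. by apply: cvg_expr; rewrite ger0_norm ?invf_lt1 ?ltr1n. Qed.

Definition active (k : nat) (t : R) : Prop := `|t / scale k - 1| < 2^-1.

Lemma activeE k t : active k t -> scale k < 2 * t /\ 2 * t < 3 * scale k.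
Proof.
have r0 := scale_gt0 k.
rewrite /active ltr_norml => /andP[h1 h2].
have E : t = t / scale k * scale k by rewrite divfK// gt_eqF.
by rewrite E; split; nra.
Qed.

(** Scale [k] is active for [scale k < 2 * t < 3 * scale k], and consecutive scales have ratio 4 >
    3. *)
Lemma active_inj k l t : active k t -> active l t -> k = l.
Proof.
move=> /activeE[k1 k2] /activeE[l1 l2].
have k0 := scale_gt0 k; have l0 := scale_gt0 l.
by case: (ltngtP k l) => // /scale_lt h; exfalso; lra.
Qed.

(* The default 0 is harmless: at depths where no scale is active, the wave of
   scale 0 vanishes as well. *)
Definition level (t : R) : nat := xget 0%N [set k | active k t].

Lemma level_active k t : active k t -> level t = k.
Proof. by move=> kt; apply: xget_unique => // l lt; exact: active_inj lt kt. Qed.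

Variable a : R.
Hypothesis a01 : 0 < a < 1.
Variable om : nat -> bool.

(** This stands for the sum of [F] over all scales: at a given depth at most one term is nonzero,
    and [level] selects it. *)
Let at_level (F : R -> R -> bool -> R -> R -> R) (t z : R) : R :=
  F a (scale (level t)) (om (level t)) t z.
Definition lacunary : R -> R -> R := at_level swave.
Definition lacunary_t : R -> R -> R := at_level swave_t.
Definition lacunary_z : R -> R -> R := at_level swave_z.

Lemma lacunary_active k t z : active k t ->
  [/\ lacunary t z = swave a (scale k) (om k) t z,
      lacunary_t t z = swave_t a (scale k) (om k) t z &
      lacunary_z t z = swave_z a (scale k) (om k) t z].
Proof.
by move=> /level_active; rewrite /lacunary /lacunary_t /lacunary_z /at_level => ->.
Qed.

Lemma swave_other k t z : level t != k ->
  [/\ swave a (scale k) (om k) t z = 0, swave_t a (scale k) (om k) t z = 0 &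
      swave_z a (scale k) (om k) t z = 0].
Proof.
move=> lk; apply: swave_out; rewrite leNgt; apply/negP => /level_active h.
by rewrite h eqxx in lk.
Qed.

(** The bumps live at positive depth. Applied with [t = h x], this makes the velocity vanish on the
    boundary. *)
Lemma lacunary_le0 t z : t <= 0 ->
  [/\ lacunary t z = 0, lacunary_t t z = 0 & lacunary_z t z = 0].
Proof.
move=> t0; apply: swave_out; set r := scale _.
have : t / r <= 0 by rewrite pmulr_lle0// invr_gt0 scale_gt0.
by move=> h; rewrite ler0_norm; lra.
Qed.

Lemma lacunary_bound t z :
  [/\ `|lacunary t z| <= 8, `|lacunary_t t z| <= 8 & `|lacunary_z t z| <= 8].
Proof. by apply: swave_bound8 => //; [exact: scale_gt0|exact: scale_le1]. Qed.

(* For two points carried by different scales, each wave vanishes at the other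
   point, so the estimate for one wave is used twice. *)
Lemma lacunary_holder t t' z z' d : `|t - t'| <= d -> `|z - z'| <= d ->
  [/\ `|lacunary t z - lacunary t' z'| <= 144 * d `^ a,
      `|lacunary_t t z - lacunary_t t' z'| <= 144 * d `^ a &
      `|lacunary_z t z - lacunary_z t' z'| <= 144 * d `^ a].
Proof.
move=> ht hz; have da : 0 <= d `^ a by exact: powR_ge0.
have L k := swave_lip a (scale k) (om k) a01 (scale_gt0 k) (scale_le1 k) _ _ _ _ _ ht hz.
rewrite /lacunary /lacunary_t /lacunary_z /at_level.
have [E|lk] := eqVneq (level t) (level t').
  by rewrite -E; have [h1 h2 h3] := L (level t); split; lra.
have [a1 a2 a3] := swave_other _ _ z lk.
have [b1 b2 b3] : [/\ swave a (scale (level t)) (om (level t)) t' z' = 0,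
    swave_t a (scale (level t)) (om (level t)) t' z' = 0 &
    swave_z a (scale (level t)) (om (level t)) t' z' = 0].
  by apply: swave_other; rewrite eq_sym.
have [h1 h2 h3] := L (level t); have [k1 k2 k3] := L (level t').
move: h1 h2 h3 k1 k2 k3; rewrite a1 a2 a3 b1 b2 b3 !subr0 !sub0r !normrN.
move=> h1 h2 h3 k1 k2 k3.
have E : 144 * d `^ a = 72 * d `^ a + 72 * d `^ a by ring.
by rewrite E; split; rewrite (le_trans (ler_normB _ _))// lerD.
Qed.

(** When the scales differ, the wave of [t] vanishes at [t'], and the wave of [t'] vanishes with its
    derivatives at [t]. The remainder is the sum of the two single-wave remainders, hence 146 = 2 *
    73. The bound also holds at depth 0, where the scales accumulate. *)
Lemma lacunary_remainder t t' z z' d : `|t' - t| <= d -> `|z' - z| <= d ->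
  `|lacunary t' z' - lacunary t z - lacunary_t t z * (t' - t) -
    lacunary_z t z * (z' - z)| <= 146 * (d * d `^ a).
Proof.
move=> ht hz; have d0 : 0 <= d := le_trans (normr_ge0 _) ht.
have da : 0 <= d * d `^ a by rewrite mulr_ge0// powR_ge0.
have L k := swave_remainder a (scale k) (om k) a01 (scale_gt0 k) _ _ _ _ _ ht hz.
rewrite /lacunary /lacunary_t /lacunary_z /at_level.
have [E|lk] := eqVneq (level t) (level t').
  by rewrite -E; have := L (level t); lra.
have [a1 a2 a3] := swave_other _ _ z lk.
have [b1 b2 b3] : [/\ swave a (scale (level t)) (om (level t)) t' z' = 0,
    swave_t a (scale (level t)) (om (level t)) t' z' = 0 &
    swave_z a (scale (level t)) (om (level t)) t' z' = 0].
  by apply: swave_other; rewrite eq_sym.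
have h1 := L (level t); have k1 := L (level t').
move: h1 k1; rewrite a1 a2 a3 b1 !mul0r !subr0 sub0r => h1 k1.
have -> : 146 * (d * d `^ a) = 73 * (d * d `^ a) + 73 * (d * d `^ a) by ring.
have -> : forall A B C D : R, A - B - C - D = A + (- B - C - D) by move=> *; ring.
by rewrite (le_trans (ler_normD _ _))// lerD.
Qed.

End lacunary_sum.

(** * Rotated gradients are divergence free *)

Section product_borel.
Context {R : realType}.

(** A countable base of measurable sets makes all open sets measurable. It links the product
    topology, in which continuity is known, to the product sigma-algebra, in which the volume
    integrals live. *)
Definition measurable_basis {T : topologicalType} (M : set (set T)) : Prop :=
  exists B : nat -> set T, (forall n, M (B n)) /\
    (forall x A, nbhs x A -> exists n, B n x /\ B n `<=` A).

Lemma measurable_basis_R : @measurable_basis R (@measurable _ (measurableTypeR R)).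
Proof.
pose B (n : nat) : set R :=
  if @unpickle (rat * rat)%type n is Some cr then ball (ratr cr.1 : R) (ratr cr.2 : R) else set0.
exists B; split=> [n|x A].
  rewrite /B; case: unpickle => [cr|]; last exact: measurable0.
  by apply: open_measurable; exact: ball_open.
rewrite nbhsE /= => -[U [oU Ux] UA].
have [c [r /= [/set_mem xB BU]]] := open_subball_rat oU (mem_set Ux).
exists (pickle (c, r)); rewrite /B pickleK /=; split=> //.
exact: subset_trans BU UA.
Qed.

Lemma measurable_basis_prod {T1 T2 : topologicalType} (M1 : set (set T1))
    (M2 : set (set T2)) (M : set (set (T1 * T2))) :
  measurable_basis M1 -> measurable_basis M2 ->
  (forall A B, M1 A -> M2 B -> M (A `*` B)) -> M set0 -> measurable_basis M.
Proof.
move=> [B1 [mB1 HB1]] [B2 [mB2 HB2]] HM M0.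
pose B (n : nat) : set (T1 * T2) :=
  if @unpickle (nat * nat)%type n is Some ij then B1 ij.1 `*` B2 ij.2 else set0.
exists B; split=> [n|[x y] A [[A1 A2] /= [A1x A2y] A12]].
  by rewrite /B; case: unpickle => [[i j]|] //=; exact: HM.
have [i [Bi Ai]] := HB1 _ _ A1x; have [j [Bj Aj]] := HB2 _ _ A2y.
exists (pickle (i, j)); rewrite /B pickleK /=; split=> // -[u v] /= [ui vj].
by apply: A12; split; [exact: Ai|exact: Aj].
Qed.

Lemma open_measurable_basis {T : topologicalType} (M : set (set T)) (U : set T) :
  measurable_basis M -> M set0 ->
  (forall F : nat -> set T, (forall n, M (F n)) -> M (\bigcup_n F n)) ->
  open U -> M U.
Proof.
move=> [B [mB HB]] M0 MU oU.
have -> : U = \bigcup_n (if `[< B n `<=` U >] then B n else set0).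
  apply/seteqP; split=> [x Ux|x [n _]].
    have [n [Bnx BnU]] := HB x U (open_nbhs_nbhs (conj oU Ux)).
    by exists n => //; rewrite (asboolT BnU).
  by case: asboolP => // h /h.
by apply: MU => n; case: ifP.
Qed.

Lemma measurable_basis_R2 :
  @measurable_basis (R * R)%type (@measurable _ (measurableTypeR R * measurableTypeR R)%type).
Proof.
apply: (measurable_basis_prod _ _ _ measurable_basis_R measurable_basis_R).
  by move=> A B mA mB; exact: measurableX.
exact: measurable0.
Qed.

Lemma open_measurable_R2 (U : set (R * R)) : open U ->
  @measurable _ (measurableTypeR R * measurableTypeR R)%type U.
Proof.
apply: (open_measurable_basis _ _ measurable_basis_R2); first exact: measurable0.
by move=> F mF; exact: bigcupT_measurable.
Qed.

Lemma open_measurable_R3 (U : set (R * R * R)) : open U ->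
  @measurable _ (measurableTypeR R * measurableTypeR R * measurableTypeR R)%type U.
Proof.
apply: open_measurable_basis; last 2 first.
- exact: measurable0.
- by move=> F mF; exact: bigcupT_measurable.
apply: (measurable_basis_prod _ _ _ measurable_basis_R2 measurable_basis_R).
  by move=> A B mA mB; exact: measurableX.
exact: measurable0.
Qed.

Lemma continuous_measurable_R2 (D : set (R * R)) (f : R * R -> R) :
  @measurable _ (measurableTypeR R * measurableTypeR R)%type D -> continuous f ->
  @measurable_fun _ _ (measurableTypeR R * measurableTypeR R)%type _ D f.
Proof.
move=> mD /continuousP cf; apply: (measurability _ (RGenOpens.measurableE R)).
move=> _ [_ [a [b ->] <-]]; apply: measurableI => //.
by apply: open_measurable_R2; apply: cf; exact: interval_open.
Qed.

Lemma continuous_measurable_R3 (D : set (R * R * R)) (f : R * R * R -> R) :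
  @measurable _ (measurableTypeR R * measurableTypeR R * measurableTypeR R)%type D ->
  continuous f ->
  @measurable_fun _ _ (measurableTypeR R * measurableTypeR R * measurableTypeR R)%type _ D f.
Proof.
move=> mD /continuousP cf; apply: (measurability _ (RGenOpens.measurableE R)).
move=> _ [_ [a [b ->] <-]]; apply: measurableI => //.
by apply: open_measurable_R3; apply: cf; exact: interval_open.
Qed.

End product_borel.

(** * Integrals of compactly supported functions and derivatives *)

Section integral_of_derivative.
Context {R : realType}.
Local Notation mu := (@lebesgue_measure R).

Lemma integral_derivative_eq0 (F dF : R -> R) (M : R) :
  (forall t : R, is_derive t 1 F (dF t)) -> continuous dF ->
  (forall t, M <= `|t| -> F t = 0 /\ dF t = 0) ->
  (\int[mu]_t (dF t)%:E = 0)%E.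
Proof.
move=> D cdF Z; pose N := `|M| + 1.
have N0 : 0 < N by rewrite ltr_wpDl.
have MN : M <= N by rewrite (le_trans (ler_norm _))// lerDl.
have E : (fun t => (dF t)%:E) = ((fun t => (dF t)%:E) \_ `[- N, N]).
  apply/funext => t; rewrite patchE; case: ifPn => //.
  rewrite notin_setE /= in_itv /= => /negP tN.
  rewrite (Z t _).2// (le_trans MN)// leNgt; apply: contra tN.
  by rewrite -ler_norml => /ltW.
rewrite E -integral_mkcond (@continuous_FTC2 R dF F (- N) N).
- rewrite (Z N _).1 ?(Z (- N) _).1 ?subee//.
    by rewrite normrN ger0_norm// ltW.
  by rewrite ger0_norm// ltW.
- by lra.
- by apply: continuous_subspaceT.
- have cF t : {for t, continuous F} by exact: is_derive1_continuous (D t).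
  split=> [t _||]; first by have [] := D t.
    by apply: cvg_at_right_filter; exact: cF.
  by apply: cvg_at_left_filter; exact: cF.
- by move=> t _; rewrite derive1E; have [_] := D t.
Qed.

Lemma vec3E (z : R * R * R) :
  [/\ vec3 z 0 0 = z.1.1, vec3 z 0 1 = z.1.2 & vec3 z 0 2%:R = z.2].
Proof. by split; rewrite mxE. Qed.

Lemma continuous_vec3 : continuous (@vec3 R).
Proof.
move=> z; apply/cvgrPdist_le => e e0.
have : \forall w \near z, ball z e w by exact: nbhsx_ballx.
apply: filterS => w [[/= b1 b2] b3].
apply: rV_norm_le => [|i]; first exact: ltW.
rewrite !mxE; case: i => [[|[|[|//]]] hi] /=; exact: ltW.
Qed.

Lemma continuous_compact_support_bounded n (f : 'rV[R]_n -> R) (M : R) :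
  continuous f -> (forall x, M <= `|x| -> f x = 0) -> exists K, forall x, `|f x| <= K.
Proof.
move=> cf Z; pose A := [set x : 'rV[R]_n | `|x| <= `|M|].
have cA : compact A.
  apply: bounded_closed_compact.
    exists `|M|; split; first exact: num_real.
    by move=> y My x /= /le_trans; apply; exact: ltW.
  apply: (@closed_comp _ _ (fun x : 'rV[R]_n => `|x|) [set t : R | t <= `|M|]).
    by move=> x _; exact: norm_continuous.
  exact: closed_le.
have A0 : A !=set0 by exists 0; rewrite /A /= normr0.
have cfn : {within A, continuous (fun x => `|f x|)}.
  by apply: continuous_subspaceT => x; apply: continuous_comp; [exact: cf|exact: norm_continuous].
have [c _ cmax] := EVT_max_rV A0 cA cfn.
exists `|f c| => x; have [h|h] := leP `|x| `|M|; first by apply: cmax; rewrite inE.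
by rewrite Z ?normr0// (le_trans (ler_norm _))// ltW.
Qed.

Lemma integrable_compact_support (f : 'rV[R]_3 -> R) (M : R) :
  continuous f -> (forall x, M <= `|x| -> f x = 0) ->
  ((mu \x mu) \x mu)%E.-integrable setT (fun z => (f (vec3 z))%:E).
Proof.
move=> cf Z; pose N := `|M| + 1; pose I := `[- N, N]%classic : set (measurableTypeR R).
pose B := (I `*` I) `*` I.
have mI : measurable I by exact: measurable_itv.
have mB : measurable B by apply: measurableX => //; exact: measurableX.
have E : (fun z => (f (vec3 z))%:E) = ((EFin \o (fun z => f (vec3 z))) \_ B).
  apply/funext => z; rewrite patchE; case: ifPn => //; rewrite notin_setE => zB.
  rewrite Z// leNgt; apply/negP => zM; apply: zB.
  have H i : `|vec3 z 0 i| <= N.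
    rewrite (le_trans (coord_le_norm _ _))// (le_trans (ltW zM))//.
    by rewrite (le_trans (ler_norm _))// lerDl.
  have [e0 e1 e2] := vec3E z.
  by split; [split|]; rewrite /I /= in_itv /= -ler_norml; [rewrite -e0|rewrite -e1|rewrite -e2].
rewrite E -integrable_mkcond//; apply: measurable_bounded_integrable => //.
- have If : (mu I < +oo)%E.
    by rewrite /I lebesgue_measure_itv/=; case: ifP => // _; rewrite ltry.
  have I2f : ((mu \x mu)%E (I `*` I) < +oo)%E.
    by rewrite product_measure1E// lte_mul_pinfty// ge0_fin_numE.
  have : (((mu \x mu) \x mu)%E B < +oo)%E.
    rewrite product_measure1E//; last exact: measurableX.
    by rewrite lte_mul_pinfty// ge0_fin_numE.
  by [].
- apply: continuous_measurable_R3 => // z; apply: continuous_comp; last exact: cf.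
  exact: continuous_vec3.
- have [K HK] := continuous_compact_support_bounded _ _ _ cf Z.
  exists K; split; first exact: num_real.
  by move=> y Ky z _; exact: (le_trans (HK _) (ltW Ky)).
Qed.

End integral_of_derivative.

Lemma continuous_pair {T U V : topologicalType} (f : T -> U) (g : T -> V) (x : T) :
  {for x, continuous f} -> {for x, continuous g} ->
  {for x, continuous (fun y => (f y, g y))}.
Proof. by move=> cf cg; exact: (cvg_pair cf cg). Qed.

(* The canonical instances of the library only make products of
   subprobabilities sigma-finite, hence the explicit packing. *)
Section iterated_product.
Context d1 d2 d3 (T1 : measurableType d1) (T2 : measurableType d2)
  (T3 : measurableType d3) (R : realType).
Variables (m1 : {sigma_finite_measure set T1 -> \bar R})
  (m2 : {sigma_finite_measure set T2 -> \bar R})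
  (m3 : {sigma_finite_measure set T3 -> \bar R}).

Definition sigma_finite_product : {sigma_finite_measure set (T1 * T2)%type -> \bar R} :=
  HB.pack (product_measure1 m1 m2)
    (lebesgue_integral_fubini.measure_function_Measure_isSigmaFinite__to__measure_function_isSFinite m1 m2)
    (lebesgue_integral_fubini.measure_function_Measure_isSigmaFinite__to__measure_function_isSigmaFinite m1 m2).

Lemma integral_product3 (f : T1 * T2 * T3 -> \bar R) :
  ((m1 \x m2) \x m3)%E.-integrable setT f ->
  (\int[(m1 \x m2) \x m3]_p f p = \int[m3]_z \int[m1 \x m2]_w f (w, z) /\
   \int[(m1 \x m2) \x m3]_p f p = \int[m1 \x m2]_w \int[m3]_z f (w, z))%E.
Proof.
move=> imf; split.
  exact: esym (@integral21_prod_meas1 _ _ _ _ _ sigma_finite_product m3 _ imf).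
exact: esym (@integral12_prod_meas1 _ _ _ _ _ sigma_finite_product m3 _ imf).
Qed.

End iterated_product.

Section integral_of_partial_derivative.
Context {R : realType}.
Local Notation mu := (@lebesgue_measure R).

Lemma integrable_box2 (f : R * R -> R) (N K : R) :
  continuous f -> (forall z, `|f z| <= K) ->
  (forall z, N <= `|z| -> f z = 0) ->
  (mu \x mu)%E.-integrable setT (fun z => (f z)%:E).
Proof.
move=> cf HK Z; pose I := `[- `|N|, `|N|]%classic : set (measurableTypeR R).
have mI : measurable I by exact: measurable_itv.
have mB : measurable (I `*` I) by exact: measurableX.
have E : (fun z => (f z)%:E) = ((EFin \o f) \_ (I `*` I)).
  apply/funext => z; rewrite patchE; case: ifPn => //; rewrite notin_setE => zB.
  rewrite Z// leNgt; apply/negP => zM; apply: zB.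
  rewrite /I /=; split; rewrite in_itv /= -ler_norml;
    rewrite (le_trans _ (ler_norm _))// (le_trans _ (ltW zM))// prod_normE/= le_max lexx ?orbT//.
rewrite E -integrable_mkcond//; apply: measurable_bounded_integrable => //.
- have If : (mu I < +oo)%E.
    by rewrite /I lebesgue_measure_itv/=; case: ifP => // _; rewrite ltry.
  have : ((mu \x mu)%E (I `*` I) < +oo)%E.
    by rewrite product_measure1E// lte_mul_pinfty// ge0_fin_numE.
  by [].
- exact: continuous_measurable_R2.
- exists K; split; first exact: num_real.
  by move=> y Ky z _; exact: (le_trans (HK _) (ltW Ky)).
Qed.

Lemma vec3_line (z : R * R * R) :
  [/\ forall t, vec3 (t, z.1.2, z.2) = vec3 (0, z.1.2, z.2) + t *: basis_vec R 0,
      forall t, vec3 (z.1.1, t, z.2) = vec3 (z.1.1, 0, z.2) + t *: basis_vec R 1 &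
      forall t, vec3 (z.1.1, z.1.2, t) = vec3 (z.1.1, z.1.2, 0) + t *: basis_vec R 2%:R].
Proof.
split=> t; apply/rowP => -[[|[|[|//]]] hi]; rewrite !mxE /=;
  by rewrite ?mulr1 ?mulr0 ?addr0 ?add0r.
Qed.

(** Fubini, with the variable of direction [i] integrated first: on each line the integral is a
    difference of two values of [F] outside its support. For the first two directions this takes a
    second use of Fubini, inside a horizontal plane. *)
Lemma integral_pderiv_eq0 (F dF : 'rV[R]_3 -> R) (i : 'I_3) (M : R) :
  (forall x, is_derive x (basis_vec R i) F (dF x)) -> continuous dF ->
  (forall x, M <= `|x| -> F x = 0 /\ dF x = 0) ->
  (\int[(mu \x mu) \x mu]_z (dF (vec3 z))%:E = 0)%E.
Proof.
move=> D cdF Z.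
have imf := integrable_compact_support _ _ cdF (fun x h => (Z x h).2).
have [K HK] := continuous_compact_support_bounded _ _ _ cdF (fun x h => (Z x h).2).
have cv (g : R -> R * R * R) : continuous g -> continuous (fun t => dF (vec3 (g t))).
  move=> cg t; apply: continuous_comp; last exact: cdF.
  by apply: continuous_comp; [exact: cg|exact: continuous_vec3].
have line (g : R -> R * R * R) (x : 'rV[R]_3) : continuous g ->
    (forall t, vec3 (g t) = x + t *: basis_vec R i) ->
    (forall t, exists j, vec3 (g t) 0 j = t) ->
    (\int[mu]_t (dF (vec3 (g t)))%:E = 0)%E.
  move=> cg gE gj; apply: (integral_derivative_eq0 (fun t => F (vec3 (g t))) _ M).
  - move=> t; rewrite (_ : (fun t => _) = (fun t => F (x + t *: basis_vec R i))).
      by apply: is_derive_line; rewrite gE; exact: D.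
    by apply/funext => s; rewrite gE.
  - exact: cv.
  - move=> t Mt; apply: Z; rewrite (le_trans Mt)//.
    by have [j {1}<-] := gj t; exact: coord_le_norm.
have slice (z : R) : (mu \x mu)%E.-integrable setT (fun w : R * R => (dF (vec3 (w, z)))%:E).
  apply: (integrable_box2 _ (`|M|) K) => [|w|w wM].
  - move=> w; apply: continuous_comp; last exact: cdF.
    apply: continuous_comp; last exact: continuous_vec3.
    by apply: continuous_pair => //; exact: cvg_cst.
  - exact: HK.
  - have [e0 e1 e2] := vec3E (w, z).
    suff h : M <= `|vec3 (w, z)| by have [_ ->] := Z _ h.
    rewrite (le_trans (ler_norm _))// (le_trans wM)//.
    rewrite prod_normE ge_max /=; apply/andP; split.
      by rewrite -[w.1]e0; exact: coord_le_norm.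
    by rewrite -[w.2]e1; exact: coord_le_norm.
case: i D line => -[|[|[|//]]] hi D line.
- rewrite (integral_product3 _ _ _ _ _ _ _ _ _ _ _ imf).1; apply: integral0_eq => z _.
  refine (eq_trans (esym (integral21_prod_meas1 (slice z))) _); apply: integral0_eq => y _.
  apply: (line (fun t => (t, y, z)) (vec3 (0, y, z))) => [t|t|t].
  + by apply: continuous_pair; [apply: continuous_pair => //|]; exact: cvg_cst.
  + have [-> _ _] := vec3_line (t, y, z); congr (_ + _ *: basis_vec R _); exact/val_inj.
  + by exists 0; rewrite mxE.
- rewrite (integral_product3 _ _ _ _ _ _ _ _ _ _ _ imf).1; apply: integral0_eq => z _.
  refine (eq_trans (esym (integral12_prod_meas1 (slice z))) _); apply: integral0_eq => x _.
  apply: (line (fun t => (x, t, z)) (vec3 (x, 0, z))) => [t|t|t].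
  + by apply: continuous_pair; [apply: continuous_pair => //|]; exact: cvg_cst.
  + have [_ -> _] := vec3_line (x, t, z); congr (_ + _ *: basis_vec R _); exact/val_inj.
  + by exists 1; rewrite mxE.
- rewrite (integral_product3 _ _ _ _ _ _ _ _ _ _ _ imf).2; apply: integral0_eq => w _.
  apply: (line (fun t => (w, t)) (vec3 (w, 0))) => [t|t|t].
  + by apply: continuous_pair => //; exact: cvg_cst.
  + case: w => x y; have [_ _ ->] := vec3_line (x, y, t).
    by congr (_ + _ *: basis_vec R _); exact/val_inj.
  + by exists 2%:R; rewrite mxE.
Qed.

End integral_of_partial_derivative.

(** * Divergence-free fields from stream functions *)

Section divergence_free_fields.
Context {R : realType}.
Local Notation mu := (@lebesgue_measure R).

Lemma norm_basis_vec n (i : 'I_n) : `|basis_vec R i| <= 1.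
Proof.
apply: rV_norm_le => // j; rewrite mxE eqxx /=.
by case: eqP => _; rewrite ?normr1 ?normr0.
Qed.

(** The mean value theorem is applied twice, along [i] to the difference in direction [j] and then
    along [j]. *)
Lemma second_difference n (f : 'rV[R]_n -> R) (x : 'rV[R]_n) i j (h : R) :
  Ck 2 setT f -> 0 < h ->
  exists2 p, `|p - x| <= 2 * h &
    f (x + h *: basis_vec R i + h *: basis_vec R j) - f (x + h *: basis_vec R i)
      - f (x + h *: basis_vec R j) + f x =
    pderiv j (pderiv i f) p * h ^+ 2.
Proof.
move=> [_ Cf] h0; pose ei := basis_vec R i; pose ej := basis_vec R j.
have [Di [_ /(_ j)[Dji _]]] := Cf i.
have D1 (y : 'rV[R]_n) (t : R) :
    is_derive t 1 (fun s : R => f (y + s *: ei)) (pderiv i f (y + t *: ei)).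
  by apply: is_derive_line; apply: derivableP; exact: Di.
have D2 (y : 'rV[R]_n) (t : R) :
    is_derive t 1 (fun s : R => pderiv i f (y + s *: ej)) (pderiv j (pderiv i f) (y + t *: ej)).
  by apply: is_derive_line; apply: derivableP; exact: Dji.
pose g (s : R) := f (x + h *: ej + s *: ei) - f (x + s *: ei).
have Dg (t : R) : is_derive t 1 g (pderiv i f (x + h *: ej + t *: ei) - pderiv i f (x + t *: ei)).
  exact: is_deriveB.
have [c ch Ec] := @MVT_is_derive R _ _ 0 h (fun t _ => Dg t).
have [d dh Ed] := @MVT_is_derive R _ _ 0 h (fun t _ => D2 (x + c *: ei) t).
have small (t : R) : t \in `[Num.min 0 h, Num.max 0 h]%R -> `|t| <= h.
  by move=> /itv_minmax_dist; rewrite !subr0 (gtr0_norm h0).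
exists (x + c *: ei + d *: ej).
  rewrite -[x + _ + _]addrA [x + _]addrC addrK mulr2n mulrDl mul1r.
  rewrite (le_trans (ler_normD _ _))// lerD// normrZ -[leRHS]mulr1 ler_pM//;
    by [exact: small|exact: norm_basis_vec].
move: Ec Ed; rewrite /g !scale0r !addr0 !subr0 => Ec Ed.
have -> : forall a b e k : R, a - b - e + k = a - b - (e - k) by move=> *; ring.
rewrite -/ei -/ej [x + _ + _]addrAC opprB [_ + (f x - _)]addrC.
move: Ec; rewrite [x + h *: ej + c *: ei]addrAC Ed expr2 mulrA => <-.
by rewrite opprB addrCA addrA; ring.
Qed.

(** The second difference is symmetric in [i] and [j], so the two mixed derivatives agree at two
    points arbitrarily close to [x]; continuity concludes. *)
Lemma pderivC n (f : 'rV[R]_n -> R) i j x : Ck 2 setT f ->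
  pderiv i (pderiv j f) x = pderiv j (pderiv i f) x.
Proof.
move=> Cf; have [_ Cf1] := Cf.
have [_ [_ /(_ i)[_ [cij _]]]] := Cf1 j; have [_ [_ /(_ j)[_ [cji _]]]] := Cf1 i.
apply/eqP; rewrite -subr_eq0 -normr_le0; apply/ler_addgt0Pr => e e0; rewrite add0r.
have e2 : 0 < e / 2 by rewrite divr_gt0.
have [r1 r10 H1] := continuous_norm_lt _ _ _ (cij x I) e2.
have [r2 r20 H2] := continuous_norm_lt _ _ _ (cji x I) e2.
pose h := Num.min r1 r2 / 4.
have m0 : 0 < Num.min r1 r2 by rewrite lt_min r10.
have h0 : 0 < h by rewrite divr_gt0.
have hm : 2 * h < Num.min r1 r2 by rewrite /h; lra.
have [p px Ep] := second_difference _ _ x i j _ Cf h0.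
have [q qx Eq] := second_difference _ _ x j i _ Cf h0.
have E : pderiv j (pderiv i f) p = pderiv i (pderiv j f) q.
  apply: (@mulIf _ (h ^+ 2)); first by rewrite expf_neq0// gt_eqF.
  apply: (etrans (esym Ep)); apply: etrans Eq; rewrite (addrAC x).
  move: (f _) (f _) (f _) (f _) => a b c d; ring.
have h2 : `|pderiv j (pderiv i f) x - pderiv j (pderiv i f) p| < e / 2.
  by apply: H2; apply: le_lt_trans px _; apply: lt_le_trans hm _; rewrite ge_min lexx orbT.
have h1 : `|pderiv i (pderiv j f) x - pderiv i (pderiv j f) q| < e / 2.
  by apply: H1; apply: le_lt_trans qx _; apply: lt_le_trans hm _; rewrite ge_min lexx.
move: h1 h2; rewrite E; move: (pderiv i (pderiv j f) q).
move: (pderiv i (pderiv j f) x) (pderiv j (pderiv i f) x) => u v w h1 h2.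
clear -h1 h2.
have -> : u - v = (u - w) - (v - w) by ring.
by rewrite (le_trans (ler_normB _ _))// (splitr e) lerD// ltW.
Qed.

Lemma pderiv_open0 n (f : 'rV[R]_n -> R) (U : set 'rV[R]_n) i : open U ->
  (forall x, U x -> f x = 0) -> forall x, U x -> pderiv i f x = 0.
Proof.
move=> oU Z x Ux; suff [_ H] : is_derive x (basis_vec R i) f 0 by exact: H.
apply: is_derive_remainder => e e0.
have cl : {for (0 : R), continuous (fun t : R => x + t *: basis_vec R i)}.
  apply: cvgD; first exact: cvg_cst.
  by apply: cvgZr_tmp; exact: cvg_id.
have : \forall t \near (0 : R), U (x + t *: basis_vec R i).
  by apply: cl; rewrite scale0r addr0; exact: open_nbhs_nbhs.
by apply: filterS => t Ut; rewrite !Z// mulr0 !subr0 normr0 mulr_ge0// ltW.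
Qed.

(** [U] is the complement of the support. Since it contains everything outside [Omega] and all
    distant points, integrals over [Omega] against [phi] extend to the whole space. *)
Lemma test_function_support (Omega : set 'rV[R]_3) phi : test_function Omega phi ->
  exists U M, [/\ open U, (forall x, U x -> phi x = 0),
    (forall x, ~ Omega x -> U x) & (forall x, M <= `|x| -> U x)].
Proof.
move=> [_ cK KO]; set K := closure _ in cK KO.
have [M [_ HM]] := compact_bounded cK.
exists (~` K), (M + 1 + 1); split.
- by apply: closed_openC; exact: closed_closure.
- move=> x Kx; apply/eqP; apply: contrapT => /negP px; apply: Kx.
  exact: subset_closure.
- by move=> x Ox Kx; apply: Ox; exact: KO.
- move=> x hx Kx; have M1 : M < M + 1 by rewrite ltrDl.
  have /(_ _ Kx) /= := HM (M + 1) M1.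
  by rewrite leNgt (lt_le_trans _ hx)// ltrDl.
Qed.

Definition rotated_gradient (i j : 'I_3) (D : 'I_3 -> 'rV[R]_3 -> R) (x : 'rV[R]_3) :
    'rV[R]_3 :=
  D j x *: basis_vec R i - D i x *: basis_vec R j.

Lemma dot_rotated_gradient i j D x (v : 'I_3 -> R) :
  \sum_(l < 3) rotated_gradient i j D x 0 l * v l = D j x * v i - D i x * v j.
Proof.
have S k (c : R) : \sum_(l < 3) (c *: basis_vec R k) 0 l * v l = c * v k.
  rewrite (bigD1 k)//= big1 ?addr0 => [|l lk]; first by rewrite !mxE !eqxx mulr1.
  by rewrite !mxE (negbTE lk) mulr0 mul0r.
rewrite -!S -sumrB; apply: eq_bigr => l _.
by rewrite -mulrBl; congr (_ * _); rewrite !mxE.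
Qed.

(** As [psi] is only C^1, the second derivatives are put on the test function: D_j psi d_i phi - D_i
    psi d_j phi equals d_j(psi d_i phi) - d_i(psi d_j phi), the terms in psi cancelling by symmetry
    of the mixed derivatives of phi. Both terms integrate to 0. *)
Lemma divergence_free_rotated_gradient (Omega : set 'rV[R]_3) (i j : 'I_3)
    (psi : 'rV[R]_3 -> R) (D : 'I_3 -> 'rV[R]_3 -> R) :
  continuous psi -> (forall l, continuous (D l)) ->
  (forall l x, is_derive x (basis_vec R l) psi (D l x)) ->
  divergence_free Omega (rotated_gradient i j D).
Proof.
move=> cpsi cD DD phi tphi; have [Cphi _ _] := tphi.
have [U [M [oU U0 UO UM]]] := test_function_support _ _ tphi.
have Dphi k x : is_derive x (basis_vec R k) phi (pderiv k phi x).
  by apply: derivableP; have [_ /(_ k)[h _]] := Cphi 1%N; exact: h.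
have cphi k : continuous (pderiv k phi).
  by move=> x; have [_ /(_ k)[_ [h _]]] := Cphi 1%N; exact: h.
have D2phi k l x : is_derive x (basis_vec R l) (pderiv k phi) (pderiv l (pderiv k phi) x).
  by apply: derivableP; have [_ /(_ k)[_ [_ /(_ l)[h _]]]] := Cphi 2%N; exact: h.
have c2phi k l : continuous (pderiv l (pderiv k phi)).
  by move=> x; have [_ /(_ k)[_ [_ /(_ l)[_ [h _]]]]] := Cphi 2%N; exact: h.
have Z1 k x : U x -> pderiv k phi x = 0 by exact: pderiv_open0.
have Z2 k l x : U x -> pderiv l (pderiv k phi) x = 0.
  by apply: pderiv_open0 => // y; exact: Z1.
pose G k l x := psi x * pderiv l (pderiv k phi) x + pderiv k phi x * D l x.
have DG k l x : is_derive x (basis_vec R l) (psi * pderiv k phi) (G k l x).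
  by have [] := DD l x; have [] := D2phi k l x => *; exact: is_deriveM.
have cG k l : continuous (G k l).
  move=> x; have h1 := cpsi x; have h2 := c2phi k l x; have h3 := cphi k x.
  have h4 := cD l x; exact: (cvgD (cvgM h1 h2) (cvgM h3 h4)).
have ZG k l x : M <= `|x| -> (psi * pderiv k phi) x = 0 /\ G k l x = 0.
  move=> /UM Ux; rewrite /G /= !fctE Z1// Z2//; split; ring.
have I0 k l := integral_pderiv_eq0 _ _ l M (DG k l) (cG k l) (ZG k l).
have iG k l := integrable_compact_support _ _ (cG k l) (fun x h => (ZG k l x h).2).
rewrite /vol_int /Rintegral integral_mkcond.
have -> : ((fun z : R * R * R => (\sum_(k < 3) rotated_gradient i j D (vec3 z) 0 k *
    pderiv k phi (vec3 z))%:E) \_ (@vec3 R @^-1` Omega)) =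
   (fun z => (G i j (vec3 z) - G j i (vec3 z))%:E).
  apply/funext => z; rewrite patchE dot_rotated_gradient /G (pderivC _ _ i j)//.
  case: ifPn => [_|].
    by congr (_%:E); rewrite opprD addrACA subrr add0r [_ * D i _]mulrC [_ * D j _]mulrC.
  by rewrite notin_setE => /UO Uz; rewrite !Z1// !Z2// !mulr0 !mul0r !addr0 subrr.
have := @RintegralB _ _ _ ((mu \x mu) \x mu)%E setT _ _ measurableT (iG i j) (iG j i).
by rewrite /Rintegral !I0 subr0 => ->.
Qed.

End divergence_free_fields.

(** * Charts and defining functions *)

Section planar_C2.
Context {R : realType}.
Implicit Types (g : 'rV[R]_2 -> R) (z : 'rV[R]_2).

(** The path from [z] to [z'] consists of two segments parallel to the axes; [p] lies on the first,
    [q] on the second. *)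
Lemma MVT_plane g z z' : (forall i y, derivable g y (basis_vec R i)) ->
  exists p q, [/\ `|p - z| <= `|z' - z|, `|q - z| <= `|z' - z| &
    g z' - g z = pderiv 0 g p * (z' - z) 0 0 + pderiv 1 g q * (z' - z) 0 1].
Proof.
move=> Dg; pose e0 := basis_vec R (0 : 'I_2); pose e1 := basis_vec R (1 : 'I_2).
pose a := (z' - z) 0 0; pose b := (z' - z) 0 1.
have L (i : 'I_2) (y : 'rV[R]_2) (t : R) : is_derive t 1
    (fun s : R => g (y + s *: basis_vec R i)) (pderiv i g (y + t *: basis_vec R i)).
  by apply: is_derive_line; apply: derivableP; exact: Dg.
have [c cI Ec] := @MVT_is_derive R _ _ 0 a (fun t _ => L 0 z t).
have [d dI Ed] := @MVT_is_derive R _ _ 0 b (fun t _ => L 1 (z + a *: e0) t).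
have ca : `|c| <= `|a| by move: cI => /itv_minmax_dist; rewrite !subr0.
have db : `|d| <= `|b| by move: dI => /itv_minmax_dist; rewrite !subr0.
have Ez : z + a *: e0 + b *: e1 = z'.
  apply/rowP; apply: forall_I2; rewrite /a /b !mxE /=; ring.
exists (z + c *: e0), (z + a *: e0 + d *: e1); split.
- rewrite addrAC subrr add0r normrZ (le_trans _ (coord_le_norm _ 0))//.
  by rewrite -/a -[leRHS]mulr1 ler_pM// norm_basis_vec.
- have h0 : `|a| <= `|z' - z| by exact: coord_le_norm.
  have h1 : `|b| <= `|z' - z| by exact: coord_le_norm.
  apply: rV_norm_le => //; apply: forall_I2; rewrite !mxE /=.
    by have -> : forall t : R, z 0 0 + a * 1 + d * 0 - z 0 0 = a by move=> *; ring.
  have -> : z 0 1 + a * 0 + d * 1 - z 0 1 = d by ring.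
  exact: le_trans db h1.
- move: Ec Ed; rewrite !scale0r !addr0 !subr0 Ez => Ec Ed.
  rewrite -/a -/b -Ec -Ed.
  by move: (g z') (g z) (g _) => u v w; ring.
Qed.

Lemma ler_sum_term n (F : 'I_n -> R) (i : 'I_n) :
  (forall k, 0 <= F k) -> F i <= \sum_k F k.
Proof. by move=> F0; rewrite (bigD1 i)//= lerDl sumr_ge0. Qed.

Lemma C2_local_bounds g z0 : Ck 2 setT g ->
  exists2 r : R, 0 < r & exists2 C : R, 0 <= C & forall z z',
    `|z - z0| < r -> `|z' - z0| < r ->
    [/\ forall j, `|pderiv j g z| <= C,
      forall j, `|pderiv j g z' - pderiv j g z| <= C * `|z' - z| &
      `|g z' - g z - (pderiv 0 g z * (z' - z) 0 0 + pderiv 1 g z * (z' - z) 0 1)|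
        <= C * `|z' - z| ^+ 2].
Proof.
move=> [_ Cg].
have Dg i y : derivable g y (basis_vec R i) by have [h _] := Cg i; exact: h.
have cg i : continuous (pderiv i g) by move=> y; have [_ [h _]] := Cg i; exact: h.
have D2g i k y : derivable (pderiv i g) y (basis_vec R k).
  by have [_ [_ /(_ k)[h _]]] := Cg i; exact: h.
have c2g i k : continuous (pderiv k (pderiv i g)).
  by move=> y; have [_ [_ /(_ k)[_ [h _]]]] := Cg i; exact: h.
pose M1 := \sum_i (`|pderiv i g z0| + 1).
pose M2 := \sum_i \sum_k (`|pderiv k (pderiv i g) z0| + 1).
have M10 : 0 <= M1 by apply: sumr_ge0 => i _; rewrite addr_ge0.
have M20 : 0 <= M2.
  by apply: sumr_ge0 => i _; apply: sumr_ge0 => k _; rewrite addr_ge0.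
have N1 : \forall y \near z0, forall i, `|pderiv i g y| <= `|pderiv i g z0| + 1.
  apply: (@filter_forall _ _ (fun i y => `|pderiv i g y| <= `|pderiv i g z0| + 1) (nbhs z0) _) => i.
  exact: continuous_le_near (cg i z0).
have N2 : \forall y \near z0, forall i k,
    `|pderiv k (pderiv i g) y| <= `|pderiv k (pderiv i g) z0| + 1.
  apply: (@filter_forall _ _ (fun i y => forall k, `|pderiv k (pderiv i g) y| <=
    `|pderiv k (pderiv i g) z0| + 1) (nbhs z0) _) => i.
  apply: (@filter_forall _ _ (fun k y => `|pderiv k (pderiv i g) y| <=
    `|pderiv k (pderiv i g) z0| + 1) (nbhs z0) _) => k.
  exact: continuous_le_near (c2g i k z0).
have : \forall y \near z0, (forall i, `|pderiv i g y| <= M1) /\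
    (forall i k, `|pderiv k (pderiv i g) y| <= M2).
  apply: filterS (filterI N1 N2) => y [h1 h2]; split=> [i|i k].
    apply: le_trans (h1 i) _.
    by apply: (ler_sum_term _ (fun i => `|pderiv i g z0| + 1)) => k; rewrite addr_ge0.
  apply: le_trans (h2 i k) _.
  apply: le_trans (ler_sum_term _ (fun k => `|pderiv k (pderiv i g) z0| + 1) k _) _.
    by move=> l; rewrite addr_ge0.
  apply: (ler_sum_term _ (fun i => \sum_k (`|pderiv k (pderiv i g) z0| + 1))) => l.
  by apply: sumr_ge0 => m _; rewrite addr_ge0.
move=> /near_normP[r r0 Hr].
(* Each intermediate point of [MVT_plane] costs a factor 3 in the radius, and the remainder estimate
   needs two generations of them: once for [g], once for its derivatives. *)
exists (r / 9); first by rewrite divr_gt0.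
exists (M1 + 4 * M2); first by rewrite addr_ge0// mulr_ge0.
have near3 s z z' p : `|z - z0| < s / 3 -> `|z' - z0| < s / 3 ->
    `|p - z| <= `|z' - z| -> `|p - z0| < s.
  move=> hz hz' hp.
  have h1 : `|z' - z| <= `|z' - z0| + `|z - z0|.
    by rewrite -[z' - z](subrKA z0) (le_trans (ler_normD _ _))// [`|z0 - z|]distrC.
  have h2 : `|p - z0| <= `|p - z| + `|z - z0|.
    by rewrite -[p - z0](subrKA z) ler_normD.
  by lra.
have Lip z z' j : `|z - z0| < r / 3 -> `|z' - z0| < r / 3 ->
    `|pderiv j g z' - pderiv j g z| <= 2 * M2 * `|z' - z|.
  move=> hz hz'; have [p [q [hp hq ->]]] := MVT_plane _ z z' (D2g j).
  have [_ B1] := Hr _ (near3 _ _ _ _ hz hz' hp).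
  have [_ B2] := Hr _ (near3 _ _ _ _ hz hz' hq).
  rewrite (le_trans (ler_normD _ _))// mulr_natl mulr2n mulrDl.
  by rewrite lerD// normrM ler_pM// coord_le_norm.
have r9 : r / 9 = (r / 3) / 3 by field.
have d3 : r / 9 < r / 3 by lra.
move=> z z' hz hz'; have zr : `|z - z0| < r by rewrite (lt_trans hz)//; lra.
have d0 := normr_ge0 (z' - z).
have hz3 := lt_trans hz d3; have hz3' := lt_trans hz' d3.
split=> [j|j|].
- by have [h _] := Hr _ zr; rewrite (le_trans (h j))// lerDl mulr_ge0.
- rewrite (le_trans (Lip _ _ j hz3 hz3'))// ler_wpM2r//; lra.
- have [p [q [hp hq ->]]] := MVT_plane _ z z' Dg.
  rewrite r9 in hz hz'.
  have hp3 := near3 _ _ _ _ hz hz' hp; have hq3 := near3 _ _ _ _ hz hz' hq.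
  have Lp : `|pderiv 0 g p - pderiv 0 g z| <= 2 * M2 * `|z' - z|.
    by rewrite (le_trans (Lip _ _ _ hz3 hp3))// ler_wpM2l// mulr_ge0.
  have Lq : `|pderiv 1 g q - pderiv 1 g z| <= 2 * M2 * `|z' - z|.
    by rewrite (le_trans (Lip _ _ _ hz3 hq3))// ler_wpM2l// mulr_ge0.
  have h0 : `|(z' - z) 0 0| <= `|z' - z| by exact: coord_le_norm.
  have h1 : `|(z' - z) 0 1| <= `|z' - z| by exact: coord_le_norm.
  rewrite opprD addrACA -!mulrBl (le_trans (ler_normD _ _))//.
  apply: (@le_trans _ _ (2 * M2 * `|z' - z| * `|z' - z| + 2 * M2 * `|z' - z| * `|z' - z|)).
    rewrite !normrM; exact: (lerD (ler_pM (normr_ge0 _) (normr_ge0 _) Lp h0)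
      (ler_pM (normr_ge0 _) (normr_ge0 _) Lq h1)).
  clear -M10 d0; nra.
Qed.

End planar_C2.

(** * Euclidean geometry and orthonormal frames *)

Section euclidean.
Context {R : realType} {n : nat}.
Implicit Types x y v : 'rV[R]_n.

Lemma dotC x y : dot x y = dot y x.
Proof. by apply: eq_bigr => i _; rewrite mulrC. Qed.

Lemma dotDl x y v : dot (x + y) v = dot x v + dot y v.
Proof. by rewrite /dot -big_split; apply: eq_bigr => i _; rewrite !mxE mulrDl. Qed.

Lemma dotZl (a : R) x v : dot (a *: x) v = a * dot x v.
Proof. by rewrite /dot mulr_sumr; apply: eq_bigr => i _; rewrite !mxE mulrA. Qed.

Lemma dotNl x v : dot (- x) v = - dot x v.
Proof. by rewrite -scaleN1r dotZl mulN1r. Qed.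

Lemma dotBl x y v : dot (x - y) v = dot x v - dot y v.
Proof. by rewrite dotDl dotNl. Qed.

Lemma dotDr x y v : dot v (x + y) = dot v x + dot v y.
Proof. by rewrite !(dotC v) dotDl. Qed.

Lemma dotZr (a : R) x v : dot v (a *: x) = a * dot v x.
Proof. by rewrite !(dotC v) dotZl. Qed.

Lemma dotNr x v : dot v (- x) = - dot v x.
Proof. by rewrite !(dotC v) dotNl. Qed.

Lemma dotBr x y v : dot v (x - y) = dot v x - dot v y.
Proof. by rewrite !(dotC v) dotBl. Qed.

Lemma dot0r v : dot v 0 = 0.
Proof. by rewrite -(scale0r 0) dotZr mul0r. Qed.

Lemma dotxx_ge0 x : 0 <= dot x x.
Proof. by apply: sumr_ge0 => i _; rewrite -expr2 sqr_ge0. Qed.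

Lemma norm_dot_le x y : `|dot x y| <= n%:R * (`|x| * `|y|).
Proof.
rewrite (le_trans (ler_norm_sum _ _ _))//.
rewrite (@le_trans _ _ (\sum_(i < n) `|x| * `|y|))//.
  by apply: ler_sum => i _; rewrite normrM ler_pM// coord_le_norm.
by rewrite sumr_const card_ord mulr_natl.
Qed.

Lemma sqr_norm_le_dot x : `|x| ^+ 2 <= dot x x.
Proof.
have H i : `|x 0 i| ^+ 2 <= dot x x.
  rewrite real_normK ?num_real// /dot (bigD1 i)//= -expr2 lerDl.
  by apply: sumr_ge0 => j _; rewrite -expr2 sqr_ge0.
have s0 := dotxx_ge0 x.
rewrite -(@sqr_sqrtr _ (dot x x))// lerXn2r ?nnegrE ?sqrtr_ge0//.
apply: rV_norm_le => [|i]; first exact: sqrtr_ge0.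
rewrite -(@ler_pXn2r _ 2)// ?nnegrE ?sqrtr_ge0//.
by rewrite sqr_sqrtr.
Qed.

Lemma sqr_enorm x : enorm x ^+ 2 = dot x x.
Proof. by rewrite sqr_sqrtr// dotxx_ge0. Qed.

Lemma enorm_ge0 x : 0 <= enorm x.
Proof. exact: sqrtr_ge0. Qed.

Lemma norm_le_enorm x : `|x| <= enorm x.
Proof.
by rewrite -(@ler_pXn2r _ 2)// ?nnegrE ?enorm_ge0// sqr_enorm sqr_norm_le_dot.
Qed.

Lemma enormN x : enorm (- x) = enorm x.
Proof. by rewrite /enorm dotNl dotNr opprK. Qed.

Lemma enormZ (a : R) x : enorm (a *: x) = `|a| * enorm x.
Proof. by rewrite /enorm dotZl dotZr mulrA -expr2 sqrtrM ?sqr_ge0// sqrtr_sqr. Qed.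

End euclidean.

Lemma enorm_le_norm {R : realType} (x : 'rV[R]_3) : enorm x <= 2 * `|x|.
Proof.
rewrite -(@ler_pXn2r _ 2)// ?nnegrE ?enorm_ge0 ?mulr_ge0// sqr_enorm.
have := norm_dot_le x x; have := normr_ge0 x; have := ler_norm (dot x x).
by nra.
Qed.

Lemma dot_basis_vec {R : realType} n (x : 'rV[R]_n) i : dot x (basis_vec R i) = x 0 i.
Proof.
rewrite /dot (bigD1 i)//= big1 ?addr0 => [|l lk]; first by rewrite !mxE !eqxx mulr1.
by rewrite !mxE (negbTE lk) mulr0.
Qed.

Lemma sum_ord3 {R : realType} (F : 'I_3 -> R) : \sum_i F i = F 0 + F 1 + F 2%:R.
Proof.
by rewrite !big_ord_recl big_ord0 addr0 addrA; congr (_ + F _ + F _); exact/val_inj.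
Qed.

Lemma rV_subE {R : realType} n (x y : 'rV[R]_n) i : (x - y) 0 i = x 0 i - y 0 i.
Proof. by rewrite !mxE. Qed.

Section frames.
Context {R : realType} (Q : 'M[R]_3) (QQ : Q *m Q^T = 1%:M).
Implicit Types x : 'rV[R]_3.

Lemma dot_row x k : dot x (row k Q) = (x *m Q^T) 0 k.
Proof. by rewrite /dot mxE; apply: eq_bigr => i _; rewrite !mxE. Qed.

Lemma row_orthonormal k l : dot (row k Q) (row l Q) = (k == l)%:R.
Proof. by rewrite dot_row -row_mul QQ !mxE. Qed.

Lemma frame_decomposition x :
  x = dot x (row 0 Q) *: row 0 Q + dot x (row 1 Q) *: row 1 Q +
      dot x (row 2%:R Q) *: row 2%:R Q.
Proof.
have QQ' : Q^T *m Q = 1%:M by apply: mulmx1C.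
have {1}-> : x = (x *m Q^T) *m Q by rewrite -mulmxA QQ' mulmx1.
rewrite !dot_row; move: (x *m Q^T) => c.
by apply/rowP => i; rewrite mxE sum_ord3 !mxE.
Qed.

Lemma frame_baseE x :
  frame_base Q x 0 0 = dot x (row 0 Q) /\ frame_base Q x 0 1 = dot x (row 1 Q).
Proof.
by rewrite !dot_row !mxE; split; apply: eq_bigr => i _; rewrite !mxE; congr (_ * Q _ _);
  apply/val_inj.
Qed.

Lemma frame_heightE x : frame_height Q x = dot x (row 2%:R Q).
Proof.
by rewrite /frame_height !dot_row !mxE; apply: eq_bigr => i _; rewrite !mxE;
  congr (_ * Q _ _); apply/val_inj.
Qed.

Lemma graph_pointE g (z : 'rV[R]_2) :
  graph_point Q g z = z 0 0 *: row 0 Q + z 0 1 *: row 1 Q + g z *: row 2%:R Q.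
Proof.
apply/rowP => i; rewrite /graph_point mxE sum_ord3 !mxE.
congr (_ * _ + _ * _ + _ * _).
- by case: splitP => j //= E; congr (z 0 _); apply/val_inj.
- by case: splitP => j //= E; congr (z 0 _); apply/val_inj.
- by case: splitP => j /= E; [move: (ltn_ord j); rewrite -E | rewrite mxE].
Qed.

Lemma dot_graph_point g (z : 'rV[R]_2) :
  [/\ dot (graph_point Q g z) (row 0 Q) = z 0 0,
      dot (graph_point Q g z) (row 1 Q) = z 0 1 &
      dot (graph_point Q g z) (row 2%:R Q) = g z].
Proof.
by rewrite graph_pointE !dotDl !dotZl !row_orthonormal /=; split; ring.
Qed.

Lemma graph_point_base g x : frame_height Q x = g (frame_base Q x) ->
  graph_point Q g (frame_base Q x) = x.
Proof.
move=> E; rewrite graph_pointE -E frame_heightE.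
by have [-> ->] := frame_baseE x; rewrite -frame_decomposition.
Qed.

Lemma frame_base_graph_point g z : frame_base Q (graph_point Q g z) = z.
Proof.
have [h0 h1] := frame_baseE (graph_point Q g z).
have [e0 e1 _] := dot_graph_point g z.
by apply/rowP; apply: forall_I2; rewrite ?h0 ?h1 ?e0 ?e1.
Qed.

Lemma frame_height_graph_point g z : frame_height Q (graph_point Q g z) = g z.
Proof. by rewrite frame_heightE; have [_ _ ->] := dot_graph_point g z. Qed.

Lemma norm_row k : `|row k Q| <= 1.
Proof.
rewrite (le_trans (norm_le_enorm _))// /enorm row_orthonormal eqxx sqrtr1 //.
Qed.

Lemma norm_dot_row x k : `|dot x (row k Q)| <= 3 * `|x|.
Proof.
rewrite (le_trans (norm_dot_le _ _))// ler_wpM2l// -[leRHS]mulr1 ler_wpM2l//.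
exact: norm_row.
Qed.

Lemma norm_frame_baseB x y :
  `|frame_base Q x - frame_base Q y| <= 3 * `|x - y|.
Proof.
apply: rV_norm_le; first by rewrite mulr_ge0.
have [h0 h1] := frame_baseE x; have [k0 k1] := frame_baseE y.
by apply: forall_I2; rewrite rV_subE ?h0 ?k0 ?h1 ?k1 -dotBl norm_dot_row.
Qed.

End frames.

Lemma Ck_pred {R : realType} n k (U : set 'rV[R]_n) f : Ck k.+1 U f -> Ck k U f.
Proof.
elim: k f => [|k IH] f [cf H]; first by split.
by split=> // i; have [h1 h2] := H i; split=> //; exact: IH.
Qed.

Lemma Ck_le {R : realType} n k l (U : set 'rV[R]_n) f : (k <= l)%N -> Ck l U f -> Ck k U f.
Proof.
move=> /subnK <-; elim: (l - k)%N => [//|m IH]; rewrite addSn => /Ck_pred; exact: IH.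
Qed.

Lemma dot_sq_diff {R : realType} n (a b : 'rV[R]_n) :
  dot a a - dot b b = dot (a - b) a + dot b (a - b).
Proof. by rewrite dotBl dotBr (dotC b a); ring. Qed.

(** * Defining functions from graph charts *)

Section defining_functions.
Context {R : realType}.
Implicit Types (Omega : set 'rV[R]_3) (x y v w : 'rV[R]_3).

(* On a sup-norm ball around x0, h is a C^{1,1} function with gradient H which
   is positive exactly on Omega, normalised so that H x0 is a unit vector. *)
Definition defining_function Omega x0 (rho C : R) (h : 'rV[R]_3 -> R)
    (H : 'rV[R]_3 -> 'rV[R]_3) : Prop :=
  [/\ 0 < rho <= 1, 1 <= C,
    (forall x, `|x - x0| < rho -> (Omega x <-> 0 < h x) /\ (bd Omega x <-> h x = 0)),
    (forall x y, `|x - x0| < rho -> `|y - x0| < rho ->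
       [/\ `|H x| <= C, `|H y - H x| <= C * `|y - x| &
           `|h y - h x - dot (H x) (y - x)| <= C * `|y - x| ^+ 2]) &
    (forall x, `|x - x0| < rho -> `|enorm (H x) - 1| <= 8^-1 /\
       (bd Omega x -> forall v, (forall w, tangent Omega x w -> dot v w = 0) ->
          exists mu, v = mu *: H x))].

Let chart_ineq1 (a b k : R) : 0 <= k -> a <= k -> b <= k -> a + b + 1 <= 9 * k + 1.
Proof. by lra. Qed.

Let chart_ineq2 (u w a b k : R) : 0 <= k -> 0 <= b -> a <= 3 * b -> u <= k * a ->
  w <= k * a -> u + w <= (9 * k + 1) * b.
Proof.
move=> k0 b0 ab ua wa; have : k * a <= k * (3 * b) by rewrite ler_wpM2l.
have : 0 <= k * b by rewrite mulr_ge0.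
by lra.
Qed.

Let chart_ineq3 (u w a b c t : R) : u <= 3 * a -> w <= 3 * b -> a <= c * t * c ->
  b <= c * (c * t) -> 48 * c ^+ 2 * t <= 1 -> u + w <= 8^-1.
Proof. by lra. Qed.

Let chart_ineq4 (e : R) : 0 <= e -> - 8^-1 <= e ^+ 2 - 1 -> e ^+ 2 - 1 <= 8^-1 ->
  - 8^-1 <= e - 1 <= 8^-1.
Proof. by move=> e0 D1 D2; apply/andP; split; nra. Qed.

Section chart.
Variables (Omega : set 'rV[R]_3) (x0 : 'rV[R]_3) (r : R) (Q : 'M[R]_3).
Variable g : 'rV[R]_2 -> R.
Hypotheses (oO : open Omega) (bx0 : bd Omega x0) (Cg : Ck 2 setT g)
  (chart : graph_chart Omega x0 r Q g).

Let QQ : Q *m Q^T = 1%:M. Proof. by case: chart. Qed.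
Let q k : 'rV[R]_3 := row k Q.
Let d (j : 'I_2) x : R := pderiv j g (frame_base Q x).
(** The length at [x0] of the gradient of the height of the graph above a point. After division by
    it, [h] grows at a rate close to 1 along the inner normals near [x0]. *)
Let N0 : R := Num.sqrt (1 + d 0 x0 ^+ 2 + d 1 x0 ^+ 2).
Let h x : R := N0^-1 * (g (frame_base Q x) - frame_height Q x).
Let H x : 'rV[R]_3 := N0^-1 *: (d 0 x *: q 0 + d 1 x *: q 1 - q 2%:R).

Let S1 : 1 <= 1 + d 0 x0 ^+ 2 + d 1 x0 ^+ 2.
Proof. by have := sqr_ge0 (d 0 x0); have := sqr_ge0 (d 1 x0); lra. Qed.

Let N01 : 1 <= N0.
Proof. by rewrite -sqrtr1 ler_wsqrtr. Qed.

Let N0gt0 : 0 < N0. Proof. exact: lt_le_trans N01. Qed.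

Let N0i : 0 < N0^-1 <= 1.
Proof. by rewrite invr_gt0 N0gt0 invf_le1. Qed.

Let gradient_dot x v :
  dot (H x) v = N0^-1 * (d 0 x * dot v (q 0) + d 1 x * dot v (q 1) - dot v (q 2%:R)).
Proof. by rewrite dotZl dotBl dotDl !dotZl ![dot _ v]dotC. Qed.

Let gradient_sq x : dot (H x) (H x) = N0^-1 ^+ 2 * (1 + d 0 x ^+ 2 + d 1 x ^+ 2).
Proof.
rewrite gradient_dot /H !dotZl !dotBl !dotDl !dotZl !row_orthonormal//=; ring.
Qed.

Let h_remainder x y : h y - h x - dot (H x) (y - x) =
  N0^-1 * (g (frame_base Q y) - g (frame_base Q x) -
    (d 0 x * (frame_base Q y - frame_base Q x) 0 0 +
     d 1 x * (frame_base Q y - frame_base Q x) 0 1)).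
Proof.
rewrite gradient_dot !rV_subE /h !frame_heightE.
have [-> ->] := frame_baseE Q x; have [-> ->] := frame_baseE Q y.
rewrite !dotBl -/(q 0) -/(q 1) -/(q 2%:R).
by move: (g _) (g _) => a b; ring.
Qed.

Let Omega_h x : enorm (x - x0) < r -> (Omega x <-> 0 < h x).
Proof.
move=> xr; have [_ _ /(_ _ xr) ->] := chart.
by rewrite /h pmulr_rgt0 ?invr_gt0// subr_gt0.
Qed.

Let h_vertical x (t : R) : h (x - t *: q 2%:R) = h x + N0^-1 * t.
Proof.
rewrite /h !frame_heightE dotBl dotZl -/(q 2%:R) row_orthonormal//= mulr1.
have -> : frame_base Q (x - t *: q 2%:R) = frame_base Q x.
  have [h0 h1] := frame_baseE Q (x - t *: q 2%:R); have [k0 k1] := frame_baseE Q x.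
  by apply/rowP; apply: forall_I2; rewrite ?h0 ?h1 ?k0 ?k1 dotBl dotZl row_orthonormal//=
    mulr0 subr0.
by move: (g _) => a; ring.
Qed.

(** The tangent vector is the velocity of the coordinate curve of direction [j] on the graph. The
    last two premises describe that direction, with [k] the frame vector matching [j], so that one
    proof serves both coordinate curves. *)
Let chart_tangent (rho : R) x (j : 'I_2) (k : 'I_3) :
  (forall y, `|y - x0| < rho -> (bd Omega y <-> h y = 0)) ->
  `|x - x0| < rho -> bd Omega x ->
  (forall z (t : R), graph_point Q g (z + t *: basis_vec R j) - graph_point Q g z =
     t *: q k + (g (z + t *: basis_vec R j) - g z) *: q 2%:R) ->
  (forall v : 'rV[R]_2, v = v 0 j *: basis_vec R j ->
     pderiv 0 g (frame_base Q x) * v 0 0 + pderiv 1 g (frame_base Q x) * v 0 1 =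
     d j x * v 0 j) ->
  tangent Omega x (q k + d j x *: q 2%:R).
Proof.
move=> bdh hx bx Egp Ed; set z := frame_base Q x in Ed.
pose e := basis_vec R j.
have gx : graph_point Q g z = x.
  apply: graph_point_base => //; have /(bdh _ hx) := bx.
  by move/eqP; rewrite /h mulf_eq0 invr_eq0 gt_eqF//= subr_eq0 => /eqP.
have Dc : is_derive (0 : R) (1 : R) (fun t : R => graph_point Q g (z + t *: e))
    (q k + d j x *: q 2%:R).
  apply: is_derive_remainder_vec => eps eps0.
  have [r1 r10 [C1 C10 HC]] := C2_local_bounds _ z Cg.
  have near0 : \forall t \near (0 : R), `|t| < r1 /\ `|t| * (C1 + 1) < eps.
    apply: (near_normP _ _).2; exists (Num.min r1 (eps / (C1 + 1))).
      by rewrite lt_min r10 divr_gt0// ltr_wpDl.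
    move=> t; rewrite subr0 lt_min => /andP[t1 t2]; split=> //.
    by rewrite -ltr_pdivlMr// ltr_wpDl.
  apply: filterS near0 => t [t1 t2].
  rewrite add0r [t *: 1]mulr1 scale0r addr0 Egp.
  have te : `|t *: e| <= `|t| by rewrite normrZ -[leRHS]mulr1 ler_wpM2l// norm_basis_vec.
  have zz : `|z - z| < r1 by rewrite subrr normr0.
  have zt : z + t *: e - z = t *: e by rewrite addrAC subrr add0r.
  have zt1 : `|z + t *: e - z| < r1 by rewrite zt (le_lt_trans te).
  have [_ _ B3] := HC _ _ zz zt1.
  have tj : (t *: e) 0 j = t by rewrite !mxE !eqxx mulr1.
  rewrite zt Ed ?tj// in B3.
  have -> : t *: q k + (g (z + t *: e) - g z) *: q 2%:R - t *: (q k + d j x *: q 2%:R) =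
      (g (z + t *: e) - g z - d j x * t) *: q 2%:R.
    rewrite [t *: (_ + _)]scalerDr scalerA [t * d j x]mulrC opprD addrACA subrr add0r.
    by rewrite -scaleNr -scalerDl.
  rewrite normrZ (le_trans (ler_pM _ _ B3 (norm_row _ QQ _)))// mulr1.
  have tt : `|t *: e| ^+ 2 <= `|t| * `|t| by rewrite expr2 ler_pM.
  rewrite (le_trans (ler_wpM2l C10 tt))// mulrA ler_wpM2r//.
  by rewrite (le_trans _ (ltW t2))// mulrC ler_wpM2l// lerDl.
exists (fun t => graph_point Q g (z + t *: e)); split=> //.
  by rewrite scale0r addr0.
have cc : {for (0 : R), continuous (fun t : R => graph_point Q g (z + t *: e))}.
  by apply/differentiable_continuous/derivable1_diffP; case: Dc.
have nx : 0 < rho - `|x - x0| by rewrite subr_gt0.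
have [s s0 Hs] := continuous_norm_lt _ _ _ cc nx.
apply: (near_normP _ _).2; exists s => // t /Hs; rewrite scale0r addr0 gx => ht.
have hc : `|graph_point Q g (z + t *: e) - x0| < rho.
  rewrite -[_ - x0](subrKA x) (le_lt_trans (ler_normD _ _))// -ltrBrDr distrC//.
apply/(bdh _ hc); rewrite /h frame_base_graph_point// frame_height_graph_point//.
by rewrite subrr mulr0.
Qed.

(** Orthogonality to the two coordinate tangents expresses the components of [v] along [q 0] and
    [q 1] by the one along [q 2%:R], which leaves a multiple of the gradient. *)
Let chart_normal (rho : R) x v :
  (forall y, `|y - x0| < rho -> (bd Omega y <-> h y = 0)) ->
  `|x - x0| < rho -> bd Omega x -> (forall w, tangent Omega x w -> dot v w = 0) ->
  exists mu, v = mu *: H x.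
Proof.
move=> bdh hx bx vt.
have T0 : dot v (q 0 + d 0 x *: q 2%:R) = 0.
  apply/vt/(chart_tangent _ _ _ _ bdh hx bx) => [z t|w Ew].
    rewrite !graph_pointE !mxE /= mulr1 mulr0 addr0 -/(q 0) -/(q 1) -/(q 2%:R).
    by move: (g _) (g _) => a b; apply/rowP => i; rewrite !mxE; ring.
  have w1 : w 0 1 = 0 by rewrite {1}Ew !mxE /= mulr0.
  by rewrite w1 mulr0 addr0.
have T1 : dot v (q 1 + d 1 x *: q 2%:R) = 0.
  apply/vt/(chart_tangent _ _ _ _ bdh hx bx) => [z t|w Ew].
    rewrite !graph_pointE !mxE /= mulr1 mulr0 addr0 -/(q 0) -/(q 1) -/(q 2%:R).
    by move: (g _) (g _) => a b; apply/rowP => i; rewrite !mxE; ring.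
  have w0 : w 0 0 = 0 by rewrite {1}Ew !mxE /= mulr0.
  by rewrite w0 mulr0 add0r.
move: T0; rewrite dotDr dotZr => T0; move: T1; rewrite dotDr dotZr => T1.
exists (- (N0 * dot v (q 2%:R))); 
rewrite {1}(frame_decomposition _ QQ v) -/(q 0) -/(q 1) -/(q 2%:R).
rewrite /H scalerA mulNr mulrAC divff ?gt_eqF// mul1r scaleNr.
have -> : dot v (q 0) = - (d 0 x * dot v (q 2%:R)) by apply/eqP; rewrite -addr_eq0 T0.
have -> : dot v (q 1) = - (d 1 x * dot v (q 2%:R)) by apply/eqP; rewrite -addr_eq0 T1.
move: (d 0 x) (d 1 x) (dot v _) => a b c.
by apply/rowP => i; rewrite !mxE; ring.
Qed.

Lemma chart_defining_function : exists rho C,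
  [/\ defining_function Omega x0 rho C h H, 2 * rho <= r &
    forall z, `|z - frame_base Q x0| < 3 * rho -> forall j, `|pderiv j g z| <= C].
Proof.
have [r1 r10 [C1 C10 HC]] := C2_local_bounds _ (frame_base Q x0) Cg.
have r0 : 0 < r by case: chart.
(* The base coordinates are 3-Lipschitz in the sup norm, and 9 = 3^2 is what the quadratic remainder
   of [g] picks up. *)
pose C := 9 * C1 + 1; have C1C : 1 <= C by rewrite /C lerDr mulr_ge0.
(* [r1 / 3] keeps base points where [g] is controlled, [r / 2] keeps points inside the Euclidean
   ball of the chart. The last bound forces the squared length of the gradient to within 6 C^2 rho
   <= 1/8 of 1. *)
pose rho := Num.min (Num.min 1 (r1 / 3)) (Num.min (r / 2) (48 * C ^+ 2)^-1).
have C0 : 0 < C by exact: lt_le_trans C1C.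
have rho0 : 0 < rho by rewrite !lt_min ltr01 !divr_gt0//= invr_gt0 mulr_gt0// exprn_gt0.
have [rho1 rho2 rho3 rho4] : [/\ rho <= 1, rho <= r1 / 3, rho <= r / 2 &
    rho <= (48 * C ^+ 2)^-1].
  by split; rewrite !ge_min lexx ?orbT.
have base_near x : `|x - x0| < rho -> `|frame_base Q x - frame_base Q x0| < r1.
  move=> hx; rewrite (le_lt_trans (norm_frame_baseB _ QQ _ _))//; lra.
have inr x : `|x - x0| < rho -> enorm (x - x0) < r.
  by move=> hx; rewrite (le_lt_trans (enorm_le_norm _))//; lra.
have iN (a : R) : 0 <= a -> N0^-1 * a <= a.
  by move=> a0; case/andP: N0i => _ i1; rewrite ler_piMl.
have Hs (a b c : R) : `|N0^-1 *: (a *: q 0 + b *: q 1 - c *: q 2%:R)| <= `|a| + `|b| + `|c|.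
  rewrite normrZ ger0_norm; last by case/andP: N0i => /ltW.
  rewrite (le_trans (iN _ _))// (le_trans (ler_normB _ _))// lerD//.
    by rewrite (le_trans (ler_normD _ _))// lerD// normrZ -[leRHS]mulr1 ler_wpM2l// norm_row.
  by rewrite normrZ -[leRHS]mulr1 ler_wpM2l// norm_row.
have K x y : `|x - x0| < rho -> `|y - x0| < rho ->
    [/\ `|H x| <= C, `|H y - H x| <= C * `|y - x| &
        `|h y - h x - dot (H x) (y - x)| <= C * `|y - x| ^+ 2].
  move=> hx hy; have [B1 B2 B3] := HC _ _ (base_near _ hx) (base_near _ hy).
  have nb := norm_frame_baseB _ QQ y x; have dyx := normr_ge0 (y - x).
  split.
  - have := Hs (d 0 x) (d 1 x) 1; rewrite scale1r normr1 -/(H x) => /le_trans; apply.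
    have := B1 0; have := B1 1; rewrite -/(d 0 x) -/(d 1 x) /C.
    by move=> b1 b0; exact: chart_ineq1.
  - have -> : H y - H x = N0^-1 *: ((d 0 y - d 0 x) *: q 0 + (d 1 y - d 1 x) *: q 1 - 0 *: q 2%:R).
      by rewrite scale0r subr0 /H -scalerBr opprB addrA subrK !scalerBl opprD addrACA.
    rewrite (le_trans (Hs _ _ _))// normr0 addr0.
    have := B2 0; have := B2 1; rewrite -/(d 0 x) -/(d 1 x) -/(d 0 y) -/(d 1 y) /C.
    by move=> b1 b0; exact: chart_ineq2 C10 dyx nb b0 b1.
  - rewrite h_remainder normrM ger0_norm; last by case/andP: N0i => /ltW.
    rewrite (le_trans (iN _ _))// (le_trans B3)//.
    rewrite (@le_trans _ _ (C1 * (3 * `|y - x|) ^+ 2))//.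
      by rewrite ler_wpM2l// lerXn2r// nnegrE// mulr_ge0.
    rewrite exprMn mulrA ler_wpM2r ?sqr_ge0//; rewrite /C; lra.
have hC x y : `|x - x0| < rho -> `|y - x0| < rho -> `|h y - h x| <= 5 * C * `|y - x|.
  move=> hx hy; have [B1 _ B3] := K _ _ hx hy.
  have := norm_dot_le (H x) (y - x) => B4.
  have d2 : `|y - x| <= 2.
    rewrite -[y - x](subrKA x0) (le_trans (ler_normD _ _))// [`|x0 - x|]distrC; lra.
  have -> : h y - h x = (h y - h x - dot (H x) (y - x)) + dot (H x) (y - x) by ring.
  have p1 : C * `|y - x| ^+ 2 <= C * (2 * `|y - x|).
    by rewrite ler_wpM2l ?(ltW C0)// expr2 ler_wpM2r.
  have p2 : `|H x| * `|y - x| <= C * `|y - x| by rewrite ler_wpM2r.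
  by rewrite (le_trans (ler_normD _ _))//; lra.
have cont x : `|x - x0| < rho -> forall e : R, 0 < e ->
    exists2 t : R, 0 < t & forall y, `|y - x| < t -> `|y - x0| < rho /\ `|h y - h x| < e.
  move=> hx e e0; exists (Num.min (rho - `|x - x0|) (e / (5 * C))).
    by rewrite lt_min subr_gt0 hx divr_gt0// mulr_gt0.
  move=> y; rewrite lt_min => /andP[y1 y2].
  have hy : `|y - x0| < rho.
    by rewrite -[y - x0](subrKA x) (le_lt_trans (ler_normD _ _))//; lra.
  split=> //; rewrite (le_lt_trans (hC _ _ hx hy))// mulrC -ltr_pdivlMr// mulr_gt0//.
(* Where [h > 0] the point is interior, where [h < 0] a whole neighbourhood misses [Omega], and
   where [h = 0] a small step down the height axis enters [Omega]. *)
have bdh x : `|x - x0| < rho -> (bd Omega x <-> h x = 0).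
  move=> hx; split=> [[clx nix]|hx0].
    have [//|h0] := eqVneq (h x) 0.
    have hx_gt0 : 0 < `|h x| by rewrite normr_gt0.
    have [t t0 Ht] := cont _ hx _ hx_gt0.
    have [h1|h1] := ltP 0 (h x).
      exfalso; apply: nix; have Ox : Omega x by apply/(Omega_h _ (inr _ hx)).
      by apply: open_nbhs_nbhs; split.
    have : nbhs x [set y | `|y - x| < t] by apply: (near_normP x _).2; exists t.
    move=> /clx[y [Oy /= /Ht[hy hyx]]].
    have : 0 < h y by apply/(Omega_h _ (inr _ hy)).
    by move: hyx; rewrite (ler0_norm h1) ltr_norml => /andP[_]; lra.
  split.
    move=> B nB; have [t t0 HB] := (near_normP x B).1 nB; pose s := Num.min t (rho - `|x - x0|) / 2.
    have m0 : 0 < Num.min t (rho - `|x - x0|) by rewrite lt_min t0 subr_gt0.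
    have s0 : 0 < s by rewrite divr_gt0.
    have sm : s < Num.min t (rho - `|x - x0|) by rewrite /s; lra.
    have ns : `|x - s *: q 2%:R - x| <= s.
      rewrite addrAC subrr add0r normrN normrZ gtr0_norm// -[leRHS]mulr1 ler_wpM2l ?norm_row//.
      exact: ltW.
    move: sm; rewrite lt_min => /andP[sm1 sm2].
    exists (x - s *: q 2%:R); split; last by apply: HB; exact: le_lt_trans ns sm1.
    have hy : `|x - s *: q 2%:R - x0| < rho.
      by rewrite -[_ - x0](subrKA x) (le_lt_trans (ler_normD _ _))//; lra.
    apply/(Omega_h _ (inr _ hy)); rewrite h_vertical hx0 add0r mulr_gt0//.
    by case/andP: N0i.
  by move=> /interior_subset /(Omega_h _ (inr _ hx)); rewrite hx0 ltxx.
have HH x : `|x - x0| < rho -> `|enorm (H x) - 1| <= 8^-1.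
  move=> hx; have hx0 : `|x0 - x0| < rho by rewrite subrr normr0.
  have [B0 _ _] := K _ _ hx0 hx; have [B1 _ _] := K _ _ hx hx0.
  have [_ B2 _] := K _ _ hx0 hx.
  have E0 : dot (H x0) (H x0) = 1.
    rewrite gradient_sq -[X in _ * X](@sqr_sqrtr _ (1 + _ + _)); last by rewrite (le_trans _ S1).
    by rewrite -exprMn -/N0 mulVf ?gt_eqF// expr1n.
  have ED : dot (H x) (H x) - 1 = dot (H x - H x0) (H x) + dot (H x0) (H x - H x0).
    by rewrite -E0; exact: dot_sq_diff.
  have n1 := norm_dot_le (H x - H x0) (H x); have n2 := norm_dot_le (H x0) (H x - H x0).
  have D8 : `|dot (H x) (H x) - 1| <= 8^-1.
    rewrite ED (le_trans (ler_normD _ _))//.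
    have p1 : `|H x - H x0| * `|H x| <= C * `|x - x0| * C.
      exact: (ler_pM (normr_ge0 (H x - H x0)) (normr_ge0 (H x)) B2 B1).
    have p2 : `|H x0| * `|H x - H x0| <= C * (C * `|x - x0|).
      exact: (ler_pM (normr_ge0 (H x0)) (normr_ge0 (H x - H x0)) B0 B2).
    have p3 : 48 * C ^+ 2 * `|x - x0| <= 1.
      rewrite mulrC -ler_pdivlMr ?mul1r; last by rewrite mulr_gt0// exprn_gt0.
      exact: le_trans (ltW hx) rho4.
    exact: (chart_ineq3 _ _ _ _ _ _ n1 n2 p1 p2 p3).
  have e0 := enorm_ge0 (H x); move: D8; rewrite -sqr_enorm !ler_norml => /andP[D1 D2].
  exact: chart_ineq4.
exists rho, C; split.
- split=> // [|x hx|x hx].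
  + by rewrite rho0.
  + by split; [exact: Omega_h (inr _ hx)|exact: bdh].
  + split; first exact: HH.
    by move=> bx v; exact: chart_normal bdh hx bx.
- by lra.
- move=> z hz j; have hz' : `|z - frame_base Q x0| < r1 by lra.
  by have [h1 _ _] := HC _ _ hz' hz'; rewrite (le_trans (h1 j))// /C; lra.
Qed.

End chart.
End defining_functions.

(** * Surface measure of boundary caps *)

Section surface_area.
Context {R : realType}.
Local Notation mu := (@lebesgue_measure R).
Implicit Types (Omega : set 'rV[R]_3).

Lemma closed_bd Omega : closed (bd Omega).
Proof.
rewrite /bd setDE; apply: closedI; first exact: closed_closure.
by apply: open_closedC; exact: open_interior.
Qed.

Lemma closed_borel3 (D : set 'rV[R]_3) : closed D -> measurable (D : set (borel3 R)).
Proof.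
move=> cD; rewrite -(setCK D); apply: (@measurableC _ (borel3 R)).
by apply: sub_sigma_algebra; exact: closed_openC.
Qed.

Lemma closed_cball {V : normedModType R} (x0 : V) (e : R) : closed [set x | `|x - x0| <= e].
Proof.
apply: (@closed_comp _ _ (fun x : V => `|x - x0|) [set t : R | t <= e]).
  move=> x _; apply: (@continuous_comp _ _ _ (fun y : V => y - x0) (fun y => `|y|) x).
    by apply: cvgB; [exact: cvg_id|exact: cvg_cst].
  exact: norm_continuous.
exact: closed_le.
Qed.

Definition square (a b e : R) : set (R * R) :=
  `[a - e, a + e]%classic `*` `[b - e, b + e]%classic.

Lemma measurable_square a b e :
  @measurable _ (measurableTypeR R * measurableTypeR R)%type (square a b e).
Proof. by apply: measurableX; exact: measurable_itv. Qed.

Lemma area_square a b e : 0 < e ->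
  (mu \x mu)%E (square a b e) = (2 * e * (2 * e))%:E.
Proof.
move=> e0.
have L c : mu `[c - e, c + e]%classic = (2 * e)%:E.
  rewrite lebesgue_measure_itv/= lte_fin; have -> : c - e < c + e by lra.
  by rewrite -EFinB; congr (_%:E); ring.
rewrite /square product_measure1E; [|exact: measurable_itv|exact: measurable_itv].
by rewrite EFinM; exact: (congr2 mule (L a) (L b)).
Qed.

Lemma vec2E (z : R * R) : vec2 z 0 0 = z.1 /\ vec2 z 0 1 = z.2.
Proof. by rewrite !mxE. Qed.

Lemma continuous_vec2 : continuous (@vec2 R).
Proof.
move=> z; apply/cvgrPdist_lt => e e0.
have : \forall w \near z, ball z e w by exact: nbhsx_ballx.
apply: filterS => w [/= b1 b2].
apply: (@le_lt_trans _ _ (Num.max `|z.1 - w.1| `|z.2 - w.2|)).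
  have [h0 h1] := vec2E z; have [k0 k1] := vec2E w.
  apply: rV_norm_le => [|]; first by rewrite le_max normr_ge0.
  by apply: forall_I2; rewrite rV_subE ?h0 ?h1 ?k0 ?k1 le_max lexx ?orbT.
by rewrite gt_max; apply/andP; split.
Qed.

Section chart.
Variables (Omega : set 'rV[R]_3) (x0 : 'rV[R]_3) (r rho C : R) (Q : 'M[R]_3).
Variables (g : 'rV[R]_2 -> R) (S : {measure set (borel3 R) -> \bar R}).
Hypotheses (bx0 : bd Omega x0) (Cg : Ck 1 setT g)
  (chart : graph_chart Omega x0 r Q g) (S_surface : is_surface_measure Omega S).
Hypotheses (rho0 : 0 < rho) (rhor : 2 * rho <= r)
  (bd_graph : forall x, `|x - x0| < rho ->
     (bd Omega x <-> g (frame_base Q x) = frame_height Q x))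
  (gC : forall z, `|z - frame_base Q x0| < 3 * rho -> forall j, `|pderiv j g z| <= C).

Let QQ : Q *m Q^T = 1%:M. Proof. by case: chart. Qed.
Let J (z : R * R) : R := Num.sqrt (1 + \sum_(i < 2) pderiv i g (vec2 z) ^+ 2).
Let gp (z : R * R) : 'rV[R]_3 := graph_point Q g (vec2 z).

Let cJ : continuous J.
Proof.
move=> z; apply: (@continuous_comp _ _ _
  (fun z => 1 + \sum_(i < 2) pderiv i g (vec2 z) ^+ 2) Num.sqrt z); last exact: sqrt_continuous.
have cp i : {for z, continuous (fun z : R * R => pderiv i g (vec2 z))}.
  apply: continuous_comp; first exact: continuous_vec2.
  by have [_ /(_ i)[_ [h _]]] := Cg; exact: h.
rewrite (_ : (fun _ => _) = (fun z : R * R => 1 +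
   (pderiv 0 g (vec2 z) * pderiv 0 g (vec2 z) + pderiv 1 g (vec2 z) * pderiv 1 g (vec2 z)))).
  apply: cvgD; first exact: cvg_cst.
  by apply: cvgD; apply: cvgM; exact: cp.
apply/funext => w; rewrite !big_ord_recl big_ord0 addr0 !expr2.
by congr (1 + (pderiv _ g _ * pderiv _ g _ + pderiv _ g _ * pderiv _ g _)); exact/val_inj.
Qed.

Let J1 z : 1 <= J z.
Proof.
rewrite -[leLHS]sqrtr1 ler_wsqrtr// lerDl.
by apply: sumr_ge0 => i _; exact: sqr_ge0.
Qed.

Let cgp : continuous gp.
Proof.
move=> z; rewrite /continuous_at /gp.
rewrite (_ : (fun z => graph_point Q g (vec2 z)) = (fun z : R * R =>
  z.1 *: row 0 Q + z.2 *: row 1 Q + g (vec2 z) *: row 2%:R Q)); last first.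
  by apply/funext => w; rewrite graph_pointE; have [-> ->] := vec2E w.
rewrite graph_pointE; have [-> ->] := vec2E z.
apply: cvgD; first apply: cvgD; apply: cvgZr_tmp.
- exact: cvg_fst.
- exact: cvg_snd.
- apply: (@continuous_comp _ _ _ (@vec2 R) g z); first exact: continuous_vec2.
  by have [h _] := Cg; exact: h.
Qed.

(** In the area formula the parameter set contains a small square, where the density is at least 1,
    and lies in a square of half-side [3 * e], where the density is bounded. Finiteness makes
    bounded functions integrable on caps; positivity keeps the lower bounds of the integrals
    nonzero. *)
Lemma surface_measure_cball (e : R) : 0 < e < rho ->
  (0 < S (bd Omega `&` [set y : 'rV[R]_3 | (`|y - x0| <= e)%R]) < +oo)%E.
Proof.
move=> /andP[e0 er]; set D := bd Omega `&` _.
have cD : closed D by apply: closedI; [exact: closed_bd|exact: closed_cball].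
have mD := closed_borel3 _ cD.
have [_ /(_ x0 r Q g Cg chart D mD)] := S_surface.
have Dr : D `<=` bd Omega `&` [set y | enorm (y - x0) < r].
  move=> y [by_ ye]; split=> //; apply: le_lt_trans (enorm_le_norm _) _.
  by apply: lt_le_trans rhor; rewrite ltr_pM2l//; exact: le_lt_trans ye er.
move=> /(_ Dr) ->.
set Z := [set z | D (gp z)]; change (0 < \int[(mu \x mu)%E]_(z in Z) (J z)%:E < +oo)%E.
have mZ : @measurable _ (measurableTypeR R * measurableTypeR R)%type Z.
  rewrite -(setCK Z); apply: measurableC; apply: open_measurable_R2.
  apply: closed_openC; apply: (@closed_comp _ _ gp D) => // z _; exact: cgp.
have mJ A : @measurable _ (measurableTypeR R * measurableTypeR R)%type A ->
    @measurable_fun _ _ (measurableTypeR R * measurableTypeR R)%type _ A (fun z => (J z)%:E).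
  by move=> mA; apply/measurable_EFinP; exact: continuous_measurable_R2.
have [z0 vz0] : exists z0 : R * R, vec2 z0 = frame_base Q x0.
  exists (frame_base Q x0 0 0, frame_base Q x0 0 1).
  have [h0 h1] := vec2E (frame_base Q x0 0 0, frame_base Q x0 0 1).
  by apply/rowP; apply: forall_I2.
have gz0 : gp z0 = x0.
  rewrite /gp vz0 graph_point_base//; symmetry.
  by apply/(bd_graph _ _).1 => //; rewrite subrr normr0.
apply/andP; split.
  have [s s0 Hs] := continuous_norm_lt _ _ _ (cgp z0) e0.
  pose B := square z0.1 z0.2 (s / 2).
  have BZ : B `<=` Z.
    move=> z [/=]; rewrite !in_itv /= => /andP[a1 a2] /andP[b1 b2].
    have zs : `|z - z0| < s.
      rewrite prod_normE gt_max; apply/andP; split => /=; rewrite ltr_norml; apply/andP; split;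
        rewrite /=; lra.
    have := Hs _ zs; rewrite gz0 distrC => hz.
    have hz' : `|gp z - x0| < rho by exact: lt_trans hz er.
    split; last exact: ltW.
    by apply/(bd_graph _ hz'); rewrite /gp frame_base_graph_point// frame_height_graph_point.
  have mB := measurable_square z0.1 z0.2 (s / 2).
  apply: (@lt_le_trans _ _ (\int[(mu \x mu)%E]_(z in B) 1)%E).
    have s2 : 0 < s / 2 by rewrite divr_gt0.
    have -> : (\int[(mu \x mu)%E]_(z in B) 1 = (2 * (s / 2) * (2 * (s / 2)))%:E)%E.
      by rewrite integral_cst// mul1e; exact: area_square.
    by rewrite lte_fin mulr_gt0// mulr_gt0.
  apply: (@le_trans _ _ (\int[(mu \x mu)%E]_(z in B) (J z)%:E)%E).
    apply: ge0_le_integral => //; first exact: mJ.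
    by move=> z _; rewrite lee_fin.
  apply: ge0_subset_integral => //; first exact: mJ.
  by move=> z _; rewrite lee_fin (le_trans _ (J1 z)).
pose B := square z0.1 z0.2 (3 * e).
have mB := measurable_square z0.1 z0.2 (3 * e).
pose K := Num.sqrt (1 + (C ^+ 2 + C ^+ 2)).
have ZB : Z `<=` B.
  move=> z [_ /= ze].
  have : `|vec2 z - vec2 z0| <= 3 * e.
    rewrite vz0 -(frame_base_graph_point _ QQ g (vec2 z)).
    by rewrite (le_trans (norm_frame_baseB _ QQ _ _))// ler_wpM2l.
  move=> zz; have := le_trans (coord_le_norm _ 0) zz; have := le_trans (coord_le_norm _ 1) zz.
  have [h0 h1] := vec2E z; have [k0 k1] := vec2E z0.
  rewrite !rV_subE h0 h1 k0 k1 !ler_norml => /andP[a1 a2] /andP[b1 b2].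
  by rewrite /B /square; split; rewrite /= in_itv /=; apply/andP; split; lra.
have ZJ z : Z z -> J z <= K.
  move=> [_ /= ze]; rewrite ler_wsqrtr// lerD2l.
  have hz : `|vec2 z - frame_base Q x0| < 3 * rho.
    rewrite -(frame_base_graph_point _ QQ g (vec2 z)).
    by rewrite (le_lt_trans (norm_frame_baseB _ QQ _ _))// ltr_pM2l// (le_lt_trans ze).
  have sq i : pderiv i g (vec2 z) ^+ 2 <= C ^+ 2.
    have h := gC _ hz i; have C0 : 0 <= C := le_trans (normr_ge0 _) h.
    by rewrite -[leLHS]real_normK ?num_real// lerXn2r.
  by rewrite !big_ord_recl big_ord0 addr0 lerD.
apply: (@le_lt_trans _ _ (\int[(mu \x mu)%E]_(z in Z) K%:E)%E).
  apply: ge0_le_integral => //; first by move=> z _; rewrite lee_fin (le_trans _ (J1 z)).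
  exact: mJ.
apply: (@le_lt_trans _ _ (\int[(mu \x mu)%E]_(z in B) K%:E)%E).
  by apply: ge0_subset_integral => // z _; rewrite lee_fin sqrtr_ge0.
have e3 : 0 < 3 * e by rewrite mulr_gt0.
have -> : (\int[(mu \x mu)%E]_(z in B) K%:E = K%:E * (2 * (3 * e) * (2 * (3 * e)))%:E)%E.
  by rewrite integral_cst//; congr (_ * _)%E; exact: area_square.
by rewrite -EFinM ltry.
Qed.

End chart.
End surface_area.

(** * Normals and the nearest point projection *)

Section boundary_points.
Context {R : realType}.
Implicit Types (Omega : set 'rV[R]_3) (x y v w : 'rV[R]_3).

(** The last point, along a coordinate line through [x], that is a limit of points of [Omega] on
    this line. *)
Lemma bd_nonempty Omega x : open Omega -> bounded_set Omega -> Omega x ->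
  exists y, bd Omega y.
Proof.
move=> oO [M [_ HM]] Ox; pose e := basis_vec R (0 : 'I_3).
pose A := [set t : R | Omega (x + t *: e)].
have A0 : A 0 by rewrite /A /= scale0r addr0.
have hA : has_sup A.
  split; first by exists 0.
  exists (M + 1 + `|x|) => t /HM; have M1 : M < M + 1 by rewrite ltrDl.
  move=> /(_ _ M1) H; have := le_trans (coord_le_norm _ 0) H.
  rewrite !mxE /= mulr1 => H1; have H2 := coord_le_norm x 0.
  by move: H1 H2; rewrite !ler_norml => /andP[_ a2] /andP[b1 _]; lra.
exists (x + sup A *: e); split.
  move=> B nB; have [r r0 Hr] := (near_normP _ B).1 nB.
  have [t At tA] := sup_adherent r0 hA.
  exists (x + t *: e); split=> //; apply: Hr.
  rewrite opprD addrACA subrr add0r -scalerBl.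
  have ts := ub_le_sup hA.2 At.
  rewrite normrZ (le_lt_trans (ler_wpM2l _ (norm_basis_vec _ _)))// mulr1.
  by rewrite ler0_norm ?subr_le0//; lra.
move=> /interior_subset Os.
have [r r0 Hr] := (near_normP _ Omega).1 (open_nbhs_nbhs (conj oO Os)).
have : A (sup A + r / 2).
  apply: Hr; rewrite opprD addrACA subrr add0r -scalerBl addrAC subrr add0r.
  rewrite normrZ (le_lt_trans (ler_wpM2l _ (norm_basis_vec _ _)))// mulr1.
  by rewrite gtr0_norm; lra.
by move=> /(ub_le_sup hA.2); lra.
Qed.

Lemma is_derive_remainderP {V : normedModType R} (c : R -> V) (w : V) :
  is_derive (0 : R) (1 : R) c w -> forall e : R, 0 < e ->
  exists2 r : R, 0 < r & forall t, `|t| < r -> `|c t - c 0 - t *: w| <= e * `|t|.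
Proof.
move=> [D <-] e e0; move: D => /cvgrPdist_le /(_ _ e0).
rewrite near_withinE => H; have [r r0 Hr] := (near_normP _ _).1 H.
exists r => // t tr; have [->|t0] := eqVneq t 0.
  by rewrite scale0r subr0 subrr !normr0 mulr0.
have /Hr /(_ t0) : `|t - 0| < r by rewrite subr0.
have -> : t *: (1 : R) = t by rewrite [LHS]mulr1.
have -> : (c \o shift 0) t = c t by rewrite /= addr0.
move=> H1.
have -> : c t - c 0 - t *: 'D_1 c 0 = - (t *: ('D_1 c 0 - t^-1 *: (c t - c 0))).
  by rewrite scalerBr scalerA divff// scale1r opprB.
by rewrite normrN normrZ mulrC ler_wpM2r//; exact: H1.
Qed.

(** Since [c t - c 0] is [t *: w] up to o(t), the premise reads [t * dot a w <= o(t)]. A one-sided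
    bound is enough because [t] takes both signs. It yields the orthogonality both of gradients and
    of nearest-point segments to the tangent vectors. *)
Lemma tangent_dot_eq0 (a : 'rV[R]_3) (c : R -> 'rV[R]_3) w (K : R) :
  is_derive (0 : R) (1 : R) c w ->
  (\forall t \near (0 : R), dot a (c t - c 0) <= K * `|c t - c 0| ^+ 2) ->
  dot a w = 0.
Proof.
move=> Dc /near_normP[r1 r10 HK].
apply/eqP; rewrite -normr_le0; apply/ler_addgt0Pr => e e0; rewrite add0r.
pose L := `|w| + 1; pose k := Num.max 0 K * L ^+ 2.
have k0 : 0 <= k by rewrite mulr_ge0 ?sqr_ge0// le_max lexx.
have a1 : 0 < 2 * (3 * `|a| + 1) by rewrite mulr_gt0// ltr_wpDl// mulr_ge0.
(* The tolerance [e] is shared equally: [e1] limits the error of the linear approximation, and the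
   choice of [t] below limits the quadratic term. *)
pose e1 := Num.min 1 (e / (2 * (3 * `|a| + 1))).
have e10 : 0 < e1 by rewrite lt_min ltr01 divr_gt0.
have e1a : 3 * (`|a| * e1) <= e / 2.
  have : e1 * (2 * (3 * `|a| + 1)) <= e by rewrite -ler_pdivlMr// ge_min lexx orbT.
  by have := normr_ge0 a; nra.
have e11 : e1 <= 1 by rewrite ge_min lexx.
have [r2 r20 Hr2] := is_derive_remainderP _ _ Dc _ e10.
pose t := Num.min (Num.min r1 r2) (e / (k + 1)) / 2.
have k1 : 0 < k + 1 by rewrite ltr_wpDl.
have m0 : 0 < Num.min (Num.min r1 r2) (e / (k + 1)) by rewrite !lt_min r10 r20 divr_gt0.
have t0 : 0 < t by rewrite divr_gt0.
have tm : t < Num.min (Num.min r1 r2) (e / (k + 1)) by rewrite /t; lra.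
move: (tm); rewrite !lt_min => /andP[/andP[t1 t2] _].
have t3 : k * t <= e / 2.
  have : t * 2 <= e / (k + 1) by rewrite /t divfK// ge_min lexx orbT.
  by rewrite ler_pdivlMr// => h; nra.
have main s : `|s| = t -> s * dot a w <= t * e.
  move=> st; have s1 : `|s - 0| < r1 by rewrite subr0 st.
  have s2 : `|s| < r2 by rewrite st.
  have B1 := HK _ s1; have B2 := Hr2 _ s2; set u := c s - c 0 in B1 B2.
  have nu : `|u| <= L * t.
    have -> : u = (u - s *: w) + s *: w by rewrite subrK.
    rewrite (le_trans (ler_normD _ _))// normrZ st.
    by move: B2; rewrite st /L; nra.
  have Ku : dot a u <= k * t ^+ 2.
    rewrite (le_trans B1)// (@le_trans _ _ (Num.max 0 K * `|u| ^+ 2))//.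
      by rewrite ler_wpM2r ?sqr_ge0// le_max lexx orbT.
    rewrite /k -mulrA -exprMn ler_wpM2l ?le_max ?lexx// lerXn2r ?nnegrE//.
    by rewrite mulr_ge0 ?(ltW t0)// addr_ge0.
  have Ed : s * dot a w = dot a u - dot a (u - s *: w) by rewrite [dot a (u - _)]dotBr dotZr; ring.
  have B3 := norm_dot_le a (u - s *: w); rewrite st in B2.
  have B4 : `|a| * `|u - s *: w| <= `|a| * (e1 * t) by rewrite ler_wpM2l.
  have B5 : `|dot a (u - s *: w)| <= 3 * (`|a| * e1) * t.
    by rewrite (le_trans B3)//; lra.
  have B6 : - dot a (u - s *: w) <= `|dot a (u - s *: w)| by rewrite -normrN ler_norm.
  rewrite Ed; move: Ku B5 B6 e1a t3; rewrite expr2.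
  move: (dot a u) (dot a (u - s *: w)) `|dot a (u - s *: w)| (3 * (`|a| * e1)) => A B D E'.
  move=> Ku B5 B6 e1a' t3'; nra.
have h1 := main t (gtr0_norm t0); have h2 := main (- t) (etrans (normrN _) (gtr0_norm t0)).
rewrite ler_norml; apply/andP; split; nra.
Qed.

End boundary_points.

(** * The normal field near a boundary point *)

Section boundary_collar.
Context {R : realType}.
Implicit Types (x y v w : 'rV[R]_3).
Variables (Omega : set 'rV[R]_3) (x0 : 'rV[R]_3) (rho C : R).
Variables (h : 'rV[R]_3 -> R) (H : 'rV[R]_3 -> 'rV[R]_3).
Hypothesis DF : defining_function Omega x0 rho C h H.

Let rho0 : 0 < rho. Proof. by case: DF => /andP[]. Qed.
Let C1 : 1 <= C. Proof. by case: DF. Qed.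
Let C0 : 0 < C. Proof. exact: lt_le_trans C1. Qed.

Lemma gradient_enorm x : `|x - x0| < rho -> 7 / 8 <= enorm (H x) <= 9 / 8.
Proof.
move=> hx; have [_ _ _ _ /(_ _ hx)[h1 _]] := DF.
by move: h1; rewrite ler_norml => /andP[h1 h2]; apply/andP; split; lra.
Qed.

(** The minus sign makes it point outward, as [h] increases into [Omega]. *)
Definition unit_normal y : 'rV[R]_3 := - ((enorm (H y))^-1 *: H y).

Let egt0 y : `|y - x0| < rho -> 0 < enorm (H y).
Proof. by move=> /gradient_enorm/andP[h1 _]; lra. Qed.

Lemma enorm_unit_normal y : `|y - x0| < rho -> enorm (unit_normal y) = 1.
Proof.
move=> hy; rewrite enormN enormZ ger0_norm ?invr_ge0 ?enorm_ge0//.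
by rewrite mulVf// gt_eqF// egt0.
Qed.

Lemma norm_unit_normal y : `|y - x0| < rho -> `|unit_normal y| <= 1.
Proof. by move=> /enorm_unit_normal <-; exact: norm_le_enorm. Qed.

Lemma gradient_unit_normal y : `|y - x0| < rho -> H y = - enorm (H y) *: unit_normal y.
Proof.
move=> hy; rewrite /unit_normal scalerN scaleNr opprK scalerA divff ?scale1r//.
by rewrite gt_eqF// egt0.
Qed.

(** The first order term of [h] along the normal is exactly [t * enorm (H y)]. Both signs of [t] are
    used for telling the two sides apart, and [t = scale k] for finding the active wave. *)
Lemma normal_displacement y (t : R) : bd Omega y -> `|y - x0| < rho ->
  `|y - t *: unit_normal y - x0| < rho ->
  `|h (y - t *: unit_normal y) - t * enorm (H y)| <= C * t ^+ 2.
Proof.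
move=> by_ hy hty; have [_ _ Hb Hc _] := DF.
have hy0 : h y = 0 by apply/(Hb _ hy).2.
have [_ _] := Hc _ _ hy hty.
have -> : y - t *: unit_normal y - y = - (t *: unit_normal y) by rewrite addrAC subrr add0r.
have -> : dot (H y) (- (t *: unit_normal y)) = t * enorm (H y).
  rewrite {1}(gradient_unit_normal _ hy) dotNr dotZl dotZr -sqr_enorm enorm_unit_normal//.
  by rewrite expr1n; ring.
rewrite hy0 subr0 => /le_trans; apply.
rewrite ler_wpM2l ?(ltW C0)// normrN normrZ -[in leRHS]real_normK ?num_real//.
by rewrite lerXn2r ?nnegrE// ler_piMr// norm_unit_normal.
Qed.

(** For small [t] the linear term of [normal_displacement] beats [C * t ^+ 2], so the two sides are
    the right ones. Conversely a unit vector orthogonal to all tangents is a multiple of [H y],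
    hence one of two opposite vectors, and the side condition excludes the inward one. *)
Lemma outward_unit_normalP y : bd Omega y -> `|y - x0| < rho ->
  normal Omega y = unit_normal y.
Proof.
move=> by_ hy; have [_ _ Hb Hc Hd] := DF.
have hy0 : h y = 0 by apply/(Hb _ hy).2.
have mem (s : R) : \forall t \near (0 : R)^'+,
    `|t| < 7 / 8 / (2 * C) /\ `|y - t *: unit_normal y - x0| < rho /\
    `|y - (- t) *: unit_normal y - x0| < rho.
  have m0 : 0 < Num.min (7 / 8 / (2 * C)) (rho - `|y - x0|).
    by rewrite lt_min subr_gt0 hy divr_gt0 ?mulr_gt0 ?divr_gt0.
  near=> t; have t0 : 0 < t by [].
  have tm : t < Num.min (7 / 8 / (2 * C)) (rho - `|y - x0|).
    by near: t; exact: nbhs_right_lt.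
  move: tm; rewrite lt_min => /andP[t1 t2]; rewrite gtr0_norm//; split=> //.
  have B (s' : R) : `|s'| = t -> `|y - s' *: unit_normal y - x0| < rho.
    move=> st; rewrite addrAC (le_lt_trans (ler_normB _ _))// normrZ st -ltrBrDl.
    by rewrite (le_lt_trans _ t2)// ler_piMr ?(ltW t0)// norm_unit_normal.
  by split; apply: B; rewrite ?normrN gtr0_norm.
have out : outward_unit_normal Omega y (unit_normal y).
  split; first exact: enorm_unit_normal.
    move=> w [c [c0 cb Dc]].
    suff Hw : dot (H y) w = 0 by rewrite dotNl dotZl Hw mulr0 oppr0.
    apply: (tangent_dot_eq0 _ c _ C Dc); rewrite c0.
    have cc : {for (0 : R), continuous c}.
      by apply/differentiable_continuous/derivable1_diffP; case: Dc.
    have nx : 0 < rho - `|y - x0| by rewrite subr_gt0.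
    have [s s0 Hs] := continuous_norm_lt _ _ _ cc nx.
    have nc : \forall t \near (0 : R), `|c t - x0| < rho.
      apply: (near_normP _ _).2; exists s => // t /Hs; rewrite c0 => ht.
      by rewrite -[_ - x0](subrKA y) (le_lt_trans (ler_normD _ _))// -ltrBrDr distrC.
    apply: filterS2 cb nc => t cbt ct.
    have hct : h (c t) = 0 by apply/(Hb _ ct).2.
    have [_ _] := Hc _ _ hy ct; rewrite hct hy0 subr0 sub0r normrN.
    by apply: le_trans; exact: ler_norm.
  have M := mem 0; near=> t; have t0 : 0 < t by [].
  have [t1 [t2 t3]] : `|t| < 7 / 8 / (2 * C) /\ `|y - t *: unit_normal y - x0| < rho /\
    `|y - (- t) *: unit_normal y - x0| < rho by near: t.
  have B1 := normal_displacement _ _ by_ hy t2; have B2 := normal_displacement _ _ by_ hy t3.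
  have /andP[g1 _] := gradient_enorm _ hy.
  rewrite gtr0_norm// ltr_pdivlMr ?mulr_gt0// in t1.
  have Ct : C * t ^+ 2 < t * (7 / 8).
    have : t * (t * (2 * C)) < t * (7 / 8) by rewrite ltr_pM2l.
    have : 0 < C * t ^+ 2 by rewrite mulr_gt0// exprn_gt0.
    by rewrite expr2; lra.
  have tg : t * (7 / 8) <= t * enorm (H y) by rewrite ler_wpM2l// ltW.
  split.
    apply/(Hb _ t2).1; move: B1; rewrite ler_norml => /andP[b1 _]; lra.
  have -> : y + t *: unit_normal y = y - (- t) *: unit_normal y by rewrite scaleNr opprK.
  move=> /(Hb _ t3).1; move: B2; rewrite sqrrN ler_norml => /andP[_ b2]; lra.
apply: xget_unique => // v [v1 vt vn].
have [_ /(_ by_ v vt)[mu vE]] := Hd _ hy.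
have vE' : v = (- (mu * enorm (H y))) *: unit_normal y.
  by rewrite vE {1}(gradient_unit_normal _ hy) scalerA mulrN.
have k1 : `|- (mu * enorm (H y))| = 1.
  by move: v1; rewrite {1}vE' enormZ enorm_unit_normal// mulr1.
move: vE' k1; set k := - _ => vE' k1.
have [k0|k0] := leP 0 k.
  have k1' : k = 1 by rewrite -k1 ger0_norm.
  by rewrite vE' k1' scale1r.
exfalso; have vN : v = - unit_normal y.
  have km : k = -1 by rewrite -[k]opprK -(ltr0_norm k0) k1.
  by rewrite vE' km scaleN1r.
have [_ _ on] := out.
have [t [[_ a] [b _]]] := filter_ex (filterI on vn).
by apply: a; move: b; rewrite vN scalerN opprK.
Unshelve. all: by end_near. Qed.

Lemma unit_normal_lip y y' : `|y - x0| < rho -> `|y' - x0| < rho ->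
  `|unit_normal y - unit_normal y'| <= 20 * C ^+ 3 * `|y - y'|.
Proof.
move=> hy hy'; have [_ _ _ Hc _] := DF.
have [B1 _ _] := Hc _ _ hy hy'; have [B1' B2 _] := Hc _ _ hy' hy.
have /andP[g1 _] := gradient_enorm _ hy; have /andP[g1' _] := gradient_enorm _ hy'.
have dn : `|enorm (H y) - enorm (H y')| <= 6 * C ^+ 2 * `|y - y'|.
  have E : (enorm (H y) - enorm (H y')) * (enorm (H y) + enorm (H y')) =
      dot (H y - H y') (H y) + dot (H y') (H y - H y').
    by rewrite -dot_sq_diff -!sqr_enorm; ring.
  have : `|enorm (H y) - enorm (H y')| * 1 <=
      `|(enorm (H y) - enorm (H y')) * (enorm (H y) + enorm (H y'))|.
    rewrite normrM ler_wpM2l// ger0_norm; lra.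
  rewrite mulr1 E => /le_trans; apply; rewrite (le_trans (ler_normD _ _))//.
  have p1 : `|H y - H y'| * `|H y| <= C * `|y - y'| * C by rewrite ler_pM.
  have p2 : `|H y'| * `|H y - H y'| <= C * (C * `|y - y'|) by rewrite ler_pM.
  have := norm_dot_le (H y - H y') (H y); have := norm_dot_le (H y') (H y - H y').
  move: p1 p2; rewrite expr2; move: `|dot _ _| `|dot _ _| (`|_| * `|H y|) (`|H y'| * _).
  by move=> a b c d; lra.
have e0 := egt0 _ hy; have e0' := egt0 _ hy'.
have E : unit_normal y - unit_normal y' =
    - ((enorm (H y))^-1 *: ((H y - H y') -
       ((enorm (H y) - enorm (H y')) * (enorm (H y'))^-1) *: H y')).
  rewrite /unit_normal; move: (H y) (H y') e0 e0' => u v.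
  move: (enorm u) (enorm v) => e e' e0 e0'.
  by apply/rowP => i; rewrite !mxE; field; rewrite !gt_eqF.
have i2 (e : R) : 7 / 8 <= e -> 0 <= e^-1 <= 8 / 7.
  move=> e78; rewrite invr_ge0; apply/andP; split; first lra.
  by rewrite -[8 / 7]invrK lef_pV2 ?posrE ?invf_div//; lra.
have /andP[j0 j1] := i2 _ g1; have /andP[j0' j1'] := i2 _ g1'.
have C2 : C <= C ^+ 3 by rewrite exprS ler_peMr ?(ltW C0)// exprn_ege1.
have q1 : `|(enorm (H y) - enorm (H y')) * (enorm (H y'))^-1 *: H y'| <=
    6 * C ^+ 2 * `|y - y'| * (8 / 7) * C.
  by rewrite normrZ normrM [`|_^-1|]ger0_norm// ler_pM// ?mulr_ge0// ler_pM.
rewrite E normrN normrZ ger0_norm//.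
apply: (@le_trans _ _ (8 / 7 * (C * `|y - y'| + 6 * C ^+ 2 * `|y - y'| * (8 / 7) * C))).
  by rewrite ler_pM// (le_trans (ler_normB _ _))// lerD.
have dd : 0 <= `|y - y'| by [].
have : C * `|y - y'| <= C ^+ 3 * `|y - y'| by rewrite ler_wpM2r.
have -> : 6 * C ^+ 2 * `|y - y'| * (8 / 7) * C = 6 * (8 / 7) * (C ^+ 3 * `|y - y'|) by ring.
have : 0 <= C ^+ 3 * `|y - y'| by rewrite mulr_ge0// exprn_ge0// ltW.
by rewrite -[20 * _ * _]mulrA; move: (C ^+ 3 * _) (C * _) => a b; lra.
Qed.

(** Chords of the boundary are tangent up to second order: [h] vanishes at both ends, so its Taylor
    estimate bounds the gradient along the chord. *)
Lemma unit_normal_chord y y' : bd Omega y -> bd Omega y' ->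
  `|y - x0| < rho -> `|y' - x0| < rho ->
  `|dot (unit_normal y) (y' - y)| <= 2 * C * `|y' - y| ^+ 2.
Proof.
move=> by_ by' hy hy'; have [_ _ Hb Hc _] := DF.
have h0 : h y = 0 by apply/(Hb _ hy).2.
have h0' : h y' = 0 by apply/(Hb _ hy').2.
have [_ _] := Hc _ _ hy hy'; rewrite h0 h0' subr0 sub0r normrN => B.
have /andP[g1 _] := gradient_enorm _ hy.
rewrite dotNl dotZl normrN normrM ger0_norm ?invr_ge0 ?enorm_ge0//.
rewrite mulrC ler_pdivrMr ?egt0// (le_trans B)//.
have : 0 <= C * `|y' - y| ^+ 2 by rewrite mulr_ge0 ?sqr_ge0// ltW.
by move: g1; rewrite -mulrA; move: (C * _) (enorm _) => a b; nra.
Qed.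

(** Pair the difference [X] with [y - y']. By [unit_normal_chord] the normal displacements
    contribute only second order terms, which the smallness of [l] and [l'] absorbs into half of the
    square of [y - y']. The estimate makes the foot of a normal a Lipschitz function of the point,
    and in particular unique. *)
Lemma normal_foot_lip y y' (l l' : R) : bd Omega y -> bd Omega y' ->
  `|y - x0| < rho -> `|y' - x0| < rho -> 4 * C * (`|l| + `|l'|) <= 1 ->
  `|y - y'| <= 6 * `|(y + l *: unit_normal y) - (y' + l' *: unit_normal y')|.
Proof.
move=> by_ by' hy hy' ll; set X := _ - (y' + _).
have c1 := unit_normal_chord _ _ by_ by' hy hy'.
have c2 := unit_normal_chord _ _ by' by_ hy' hy.
have E : dot X (y - y') = dot (y - y') (y - y') - l * dot (unit_normal y) (y' - y)
    - l' * dot (unit_normal y') (y - y').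
  have -> : X = (y - y') + (l *: unit_normal y - l' *: unit_normal y').
    by rewrite /X opprD addrACA.
  have -> : y' - y = - (y - y') by rewrite opprB.
  by rewrite dotDl [dot (l *: _ - _) _]dotBl !dotZl dotNr; ring.
have B1 := norm_dot_le X (y - y'); have B2 := sqr_norm_le_dot (y - y').
set D := `|y - y'| in B1 B2 *.
have D0 : 0 <= D by exact: normr_ge0.
have c1' : `|l * dot (unit_normal y) (y' - y)| <= `|l| * (2 * C * D ^+ 2).
  by rewrite normrM ler_wpM2l// /D distrC.
have c2' : `|l' * dot (unit_normal y') (y - y')| <= `|l'| * (2 * C * D ^+ 2).
  by rewrite normrM ler_wpM2l.
have c3 : (`|l| + `|l'|) * (2 * C * D ^+ 2) <= 2^-1 * D ^+ 2.
  have -> : (`|l| + `|l'|) * (2 * C * D ^+ 2) = 4 * C * (`|l| + `|l'|) * (2^-1 * D ^+ 2) by field.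
  by rewrite -[leRHS]mul1r ler_wpM2r// mulr_ge0// sqr_ge0.
have main : 2^-1 * D ^+ 2 <= 3 * (`|X| * D).
  have F : dot X (y - y') <= 3 * (`|X| * D) by rewrite (le_trans (ler_norm _)).
  move: F c1' c2'; rewrite E !ler_norml => F /andP[_ a1] /andP[_ a2].
  by move: F B2 a1 a2 c3; rewrite mulrDl; lra.
have [D00|Dn0] := eqVneq D 0; first by rewrite D00 mulr_ge0.
have Dp : 0 < D by rewrite lt_def Dn0.
rewrite -(ler_pM2r Dp) -expr2; move: main; rewrite expr2; lra.
Qed.

End boundary_collar.

(** * The nearest point projection near the chosen boundary point *)

Section projection.
Context {R : realType}.
Implicit Types (x y v w : 'rV[R]_3).
Variables (Omega : set 'rV[R]_3) (x0 : 'rV[R]_3) (rho C : R).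
Variables (h : 'rV[R]_3 -> R) (H : 'rV[R]_3 -> 'rV[R]_3).
Hypothesis DF : defining_function Omega x0 rho C h H.
Variables (delta eps : R).
Hypotheses (bx0 : bd Omega x0) (tub : tubular_radius Omega delta).
Hypotheses (eps0 : 0 < eps) (epsrho : 4 * eps <= rho) (epsdelta : 2 * eps <= delta)
  (epsC : 16 * C * eps <= 1).
Local Notation nu := (unit_normal H).

Lemma dist_bd_le x y : bd Omega y -> dist_bd Omega x <= enorm (x - y).
Proof.
move=> by_; apply: ge_inf; last by exists y.
by exists 0 => _ [z _ <-]; exact: enorm_ge0.
Qed.

Lemma dist_bd_near x : `|x - x0| < eps -> dist_bd Omega x <= 2 * eps.
Proof.
move=> hx; rewrite (le_trans (dist_bd_le _ _ bx0))// (le_trans (enorm_le_norm _))//.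
by rewrite ler_wpM2l// ltW.
Qed.

(** Minimality of the distance makes [x - proj_bd Omega x] orthogonal to all tangent vectors at the
    foot, hence a multiple of the gradient there. *)
Lemma proj_bd_foot x : `|x - x0| < eps ->
  [/\ bd Omega (proj_bd Omega x), `|proj_bd Omega x - x0| < rho &
      exists2 l, `|l| <= 2 * eps & x = proj_bd Omega x + l *: nu (proj_bd Omega x)].
Proof.
move=> hx; have dx := dist_bd_near _ hx.
have d2 : dist_bd Omega x <= 2 * delta.
  by rewrite (le_trans dx)// ler_wpM2l//; have := eps0; have := epsdelta; lra.
have [_ /(_ x d2) [p0 [np0 _]]] := tub.
have : nearest Omega x (proj_bd Omega x) by apply: (xgetPex 0); exists p0.
set p := proj_bd Omega x => -[bp ep].
have xp : enorm (x - p) <= 2 * eps by rewrite ep.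
have hp : `|p - x0| < rho.
  have := norm_le_enorm (x - p); rewrite distrC => xp'.
  by rewrite -[p - x0](subrKA x) (le_lt_trans (ler_normD _ _))//; have := epsrho; have := eps0; lra.
split=> //; have [_ _ _ _ /(_ _ hp)[_ /(_ bp (x - p)) Hd]] := DF.
have [w [c [c0 cb Dc]]|mu xpE] := Hd.
  (* Expanding the squared distance to [c t] bounds twice the scalar product by the squared
     Euclidean length of [c t - p], which is at most 3 times the squared sup norm. *)
  apply: (tangent_dot_eq0 _ c _ (3 / 2) Dc); rewrite c0.
  apply: filterS cb => t ct.
  have : enorm (x - p) <= enorm (x - c t) by rewrite ep; exact: dist_bd_le.
  rewrite -(@ler_pXn2r _ 2)// ?nnegrE ?enorm_ge0// !sqr_enorm.
  have -> : x - c t = (x - p) - (c t - p) by rewrite opprB addrA subrK.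
  move: (x - p) (c t - p) => a u; rewrite dotBr !dotBl (dotC u a) => Hle.
  have := norm_dot_le u u; rewrite ger0_norm ?dotxx_ge0// expr2.
  by move: Hle; move: (dot a a) (dot a u) (dot u u) => ? ? ?; lra.
exists (- (mu * enorm (H p))).
  have := xp; rewrite xpE {1}(gradient_unit_normal _ _ _ _ _ _ DF _ hp) scalerA mulrN enormZ.
  by rewrite (enorm_unit_normal _ _ _ _ _ _ DF _ hp) mulr1.
rewrite -mulrN -scalerA -(gradient_unit_normal _ _ _ _ _ _ DF _ hp) -xpE.
by rewrite addrC subrK.
Qed.

Lemma normal_ext_near x : `|x - x0| < eps ->
  normal_ext Omega x = nu (proj_bd Omega x) /\ `|normal_ext Omega x| <= 1.
Proof.
move=> /proj_bd_foot[bp hp _].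
by rewrite /normal_ext (outward_unit_normalP _ _ _ _ _ _ DF _ bp hp); split=> //;
  exact: norm_unit_normal DF _ hp.
Qed.

(** The foot depends on the point with Lipschitz constant 6, and [nu] on the foot with constant
    [20 * C ^+ 3]. *)
Lemma normal_ext_lip x x' : `|x - x0| < eps -> `|x' - x0| < eps ->
  `|normal_ext Omega x - normal_ext Omega x'| <= 120 * C ^+ 3 * `|x - x'|.
Proof.
move=> hx hx'; have [-> _] := normal_ext_near _ hx; have [-> _] := normal_ext_near _ hx'.
have [bp hp [l ll xE]] := proj_bd_foot _ hx; have [bp' hp' [l' ll' xE']] := proj_bd_foot _ hx'.
rewrite (le_trans (unit_normal_lip _ _ _ _ _ _ DF _ _ hp hp'))//.
have C0 : 0 < C by have [_ C1 _ _ _] := DF; exact: lt_le_trans C1.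
have L : 4 * C * (`|l| + `|l'|) <= 1 by have := epsC; nra.
have := normal_foot_lip _ _ _ _ _ _ DF _ _ _ _ bp bp' hp hp' L.
rewrite -xE -xE' => B.
have -> : 120 * C ^+ 3 * `|x - x'| = 20 * C ^+ 3 * (6 * `|x - x'|) by ring.
by rewrite ler_wpM2l// mulr_ge0// exprn_ge0// ltW.
Qed.

Lemma offset_near y s : `|y - x0| < eps / 2 -> 0 <= s < eps / 2 ->
  `|y - s *: nu y - x0| < eps.
Proof.
move=> hy /andP[s0 s1]; rewrite addrAC (le_lt_trans (ler_normB _ _))//.
have hy' : `|y - x0| < rho by have := epsrho; have := eps0; lra.
have : `|s *: nu y| <= s.
  by rewrite normrZ ger0_norm// ler_piMr// (norm_unit_normal _ _ _ _ _ _ DF).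
by lra.
Qed.

(** The point lies on the normal at [y] and on the normal at its nearest boundary point;
    [normal_foot_lip] with difference 0 identifies the two feet. *)
Lemma normal_ext_offset y s : bd Omega y -> `|y - x0| < eps / 2 -> 0 <= s < eps / 2 ->
  normal_ext Omega (y - s *: nu y) = nu y.
Proof.
move=> by_ hy hs; have hx := offset_near _ _ hy hs.
have [bp hp [l ll xE]] := proj_bd_foot _ hx.
have [-> _] := normal_ext_near _ hx.
have hy' : `|y - x0| < rho by have := epsrho; have := eps0; lra.
have C0 : 0 < C by have [_ C1 _ _ _] := DF; exact: lt_le_trans C1.
have L : 4 * C * (`|l| + `|- s|) <= 1.
  by move: hs => /andP[s0 s1]; rewrite normrN (ger0_norm s0); have := epsC; nra.
have := normal_foot_lip _ _ _ _ _ _ DF _ _ _ _ bp by_ hp hy' L.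
rewrite -xE scaleNr subrr normr0 mulr0 normr_le0 subr_eq0 => /eqP E.
by rewrite E.
Qed.

End projection.

(** * The velocity field *)

Lemma lipschitz1_continuous {R : realType} {V W : normedModType R} (f : V -> W) :
  (forall x y, `|f x - f y| <= `|x - y|) -> continuous f.
Proof.
move=> Lf x; apply/cvgrPdist_lt => e e0; near=> y.
by rewrite (le_lt_trans (Lf _ _))//; near: y; exact: cvgr_dist_lt.
Unshelve. all: by end_near. Qed.

Section smooth_cutoff.
Context {R : realType} {n : nat}.
Implicit Types (f g q : 'rV[R]_n -> R) (x y : 'rV[R]_n).

Lemma CkS k f (df : 'I_n -> 'rV[R]_n -> R) : continuous f ->
  (forall i x, is_derive x (basis_vec R i) f (df i x)) ->
  (forall i, Ck k setT (df i)) -> Ck k.+1 setT f.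
Proof.
move=> cf D C; split=> [x _|i]; first exact: cf.
have -> : pderiv i f = df i by apply/funext => x; have [_ h] := D i x; exact: h.
by split=> // x _; have [] := D i x.
Qed.

Lemma Ck_continuous k f : Ck k setT f -> continuous f.
Proof. by case: k => [|k] [h _] x; exact: h. Qed.

Lemma Ck_is_derive k f i x : Ck k.+1 setT f -> is_derive x (basis_vec R i) f (pderiv i f x).
Proof. by move=> [_ /(_ i)[h _]]; apply: derivableP; exact: h. Qed.

Lemma Ck_cst k (c : R) : Ck k setT (fun _ : 'rV[R]_n => c).
Proof.
elim: k c => [|k IH] c; first by split=> // x _; exact: cst_continuous.
have H1 : continuous (fun _ : 'rV[R]_n => c) by move=> x; exact: cst_continuous.
have H2 (i : 'I_n) (x : 'rV[R]_n) : is_derive x (basis_vec R i) (fun _ : 'rV[R]_n => c) 0.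
  exact: is_derive_cst.
exact: (CkS _ _ (fun _ _ => 0) H1 H2 (fun _ => IH 0)).
Qed.

Lemma Ck_add k f g : Ck k setT f -> Ck k setT g -> Ck k setT (fun x => f x + g x).
Proof.
elim: k f g => [|k IH] f g Cf Cg.
  by split=> // x _; exact: (cvgD (Ck_continuous _ _ Cf x) (Ck_continuous _ _ Cg x)).
apply: (CkS _ _ (fun i x => pderiv i f x + pderiv i g x)) => [x|i x|i].
- exact: (cvgD (Ck_continuous _ _ Cf x) (Ck_continuous _ _ Cg x)).
- exact: (is_deriveD (Ck_is_derive _ _ i x Cf) (Ck_is_derive _ _ i x Cg)).
- by apply: IH; [have [_ /(_ i)[]] := Cf|have [_ /(_ i)[]] := Cg].
Qed.

Lemma Ck_mul k f g : Ck k setT f -> Ck k setT g -> Ck k setT (fun x => f x * g x).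
Proof.
elim: k f g => [|k IH] f g Cf Cg.
  by split=> // x _; exact: (cvgM (Ck_continuous _ _ Cf x) (Ck_continuous _ _ Cg x)).
apply: (CkS _ _ (fun i x => f x * pderiv i g x + g x * pderiv i f x)) => [x|i x|i].
- exact: (cvgM (Ck_continuous _ _ Cf x) (Ck_continuous _ _ Cg x)).
- exact: (is_deriveM (Ck_is_derive _ _ i x Cf) (Ck_is_derive _ _ i x Cg)).
- apply: Ck_add; apply: IH; do ?exact: Ck_pred.
    by have [_ /(_ i)[]] := Cg.
  by have [_ /(_ i)[]] := Cf.
Qed.

Lemma continuous_pospow m : continuous (@pospow R m).
Proof.
have c1 : continuous (fun t : R => Num.max 0 t).
  move=> t; apply/cvgrPdist_lt => e e0; near=> s.
  by rewrite (le_lt_trans (max0_lip _ _))//; near: s; exact: cvgr_dist_lt.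
elim: m => [|m IH] t; first exact: cvg_cst.
rewrite (_ : pospow m.+1 = (fun t => Num.max 0 t * pospow m t)).
  by apply: cvgM; [exact: c1|exact: IH].
by apply/funext => s; rewrite /pospow exprS.
Unshelve. all: by end_near. Qed.

Lemma Ck_pospow k m q : (k < m)%N -> Ck k setT q -> Ck k setT (fun x => pospow m (q x)).
Proof.
have cq m' f : continuous f -> continuous (fun x => @pospow R m' (f x)).
  by move=> cf x; apply: (@continuous_comp _ _ _ f (pospow m') x); [exact: cf|exact: continuous_pospow].
elim: k m q => [|k IH] m q km Cq.
  by split=> // x _; apply: cq; exact: Ck_continuous Cq.
case: m km => [//|[//|m]] km.
apply: (CkS _ _ (fun i x => m.+2%:R * pospow m.+1 (q x) * pderiv i q x)) => [|i x|i].
- by apply: cq; exact: Ck_continuous Cq.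
- apply: (is_derive_comp1 _ _ _ _ _ _ (Ck_is_derive _ _ _ _ Cq)).
  exact: is_derive_pospow.
- apply: Ck_mul; last by have [_ /(_ i)[]] := Cq.
  apply: Ck_mul; first exact: Ck_cst.
  by apply: IH => //; exact: Ck_pred.
Qed.

(** The Euclidean square keeps this a polynomial. It is nonpositive outside the sup-norm ball of
    radius [e], since the Euclidean norm is the larger one. *)
Definition paraboloid (x0 : 'rV[R]_n) (e : R) x : R := e ^+ 2 - dot (x - x0) (x - x0).

Lemma is_derive_paraboloid x0 e i x :
  is_derive x (basis_vec R i) (paraboloid x0 e) (- 2 * (x - x0) 0 i).
Proof.
apply: is_derive_remainder => k k0.
have near0 : \forall t \near (0 : R), `|t| <= k by apply: nbhs0_le.
apply: filterS near0 => t tk.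
have -> : paraboloid x0 e (x + t *: basis_vec R i) - paraboloid x0 e x -
    t * (- 2 * (x - x0) 0 i) = - (t * t).
  rewrite /paraboloid.
  have -> : x + t *: basis_vec R i - x0 = (x - x0) + t *: basis_vec R i by rewrite addrAC.
  move: (x - x0) => v.
  rewrite dotDl !dotDr !dotZl !dotZr (dotC (basis_vec R i) v) !dot_basis_vec.
  have -> : basis_vec R i 0 i = 1 by rewrite mxE !eqxx.
  by move: (dot v v) (v 0 i) => a b; ring.
by rewrite normrN normrM ler_wpM2r.
Qed.

Lemma Ck_coord_diff k x0 i : Ck k setT (fun x => (x - x0) 0 i).
Proof.
have D j x : is_derive x (basis_vec R j) (fun x => (x - x0) 0 i) ((i == j)%:R).
  apply: is_derive_remainder => k' k'0; apply: filterE => t.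
  rewrite !rV_subE; have -> : (x + t *: basis_vec R j) 0 i = x 0 i + t * (i == j)%:R.
    by rewrite !mxE eqxx.
  have -> : forall a b c : R, a + c - b - (a - b) - c = 0 by move=> *; ring.
  by rewrite normr0 mulr_ge0// ltW.
have c : continuous (fun x => (x - x0) 0 i).
  apply: (lipschitz1_continuous (fun x : 'rV[R]_n => (x - x0) 0 i)) => x y.
  by rewrite -rV_subE opprB addrA subrK coord_le_norm.
case: k => [|k]; first by split=> // x _; exact: c.
by apply: (CkS _ _ (fun j _ => (i == j)%:R) c D) => j; exact: Ck_cst.
Qed.

Lemma Ck_sum k m (F : 'I_m -> 'rV[R]_n -> R) : (forall i, Ck k setT (F i)) ->
  Ck k setT (fun x => \sum_(i < m) F i x).
Proof.
elim: m F => [|m IH] F CF.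
  rewrite (_ : (fun _ => _) = (fun=> 0)); first exact: Ck_cst.
  by apply/funext => x; rewrite big_ord0.
rewrite (_ : (fun _ => _) =
    (fun x => \sum_(i < m) F (widen_ord (leqnSn m) i) x + F ord_max x)).
  by apply: Ck_add => //; exact: (IH (fun i => F (widen_ord (leqnSn m) i))).
by apply/funext => x; rewrite big_ord_recr.
Qed.

Lemma Ck_paraboloid k x0 e : Ck k setT (paraboloid x0 e).
Proof.
have Cc i := Ck_coord_diff k x0 i.
rewrite (_ : paraboloid x0 e = (fun x => e ^+ 2 +
    -1 * \sum_(i < n) ((x - x0) 0 i * (x - x0) 0 i))); last first.
  by apply/funext => x; rewrite mulN1r.
apply: (Ck_add _ _ _ (Ck_cst _ _) (Ck_mul _ _ _ (Ck_cst _ _) _)).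
exact: (Ck_sum _ _ (fun i x => (x - x0) 0 i * (x - x0) 0 i) (fun i => Ck_mul _ _ _ (Cc i) (Cc i))).
Qed.

(* The exponent 5 makes the cutoff C^4, the regularity of test functions on the
   boundary. *)
Definition cutoff_at (x0 : 'rV[R]_n) (e : R) x : R := pospow 5 (paraboloid x0 e x).
Definition dcutoff_at (x0 : 'rV[R]_n) (e : R) (i : 'I_n) x : R :=
  5 * pospow 4 (paraboloid x0 e x) * (- 2 * (x - x0) 0 i).

Lemma Ck_cutoff_at x0 e : Ck 4 setT (cutoff_at x0 e).
Proof. by apply: Ck_pospow => //; exact: Ck_paraboloid. Qed.

Lemma is_derive_cutoff_at x0 e i x :
  is_derive x (basis_vec R i) (cutoff_at x0 e) (dcutoff_at x0 e i x).
Proof.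
exact: (is_derive_comp1 _ _ _ _ _ _ (is_derive_paraboloid x0 e i x) (is_derive_pospow 3 _)).
Qed.

Lemma cutoff_at_out x0 e x : 0 <= e -> e <= `|x - x0| ->
  cutoff_at x0 e x = 0 /\ (forall i, dcutoff_at x0 e i x = 0).
Proof.
move=> e0 ex; have h : paraboloid x0 e x <= 0.
  rewrite /paraboloid subr_le0 (le_trans _ (sqr_norm_le_dot _))//.
  by rewrite lerXn2r ?nnegrE.
split=> [|i]; rewrite /cutoff_at /dcutoff_at /pospow max_l// expr0n//=.
by rewrite mulr0 mul0r.
Qed.

Lemma cutoff_at_ge0 x0 e x : 0 <= cutoff_at x0 e x.
Proof. exact: pospow_ge0. Qed.

Lemma cutoff_at_holder x0 e (a r : R) : 0 <= a <= 1 ->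
  holder_on [set x | `|x - x0| < r] a (cutoff_at x0 e) /\
  (forall i, holder_on [set x | `|x - x0| < r] a (dcutoff_at x0 e i)).
Proof.
move=> a01; set B := [set x | _].
have Hc i : holder_on B a (fun x => (x - x0) 0 i).
  apply: (lipschitz_holder_on _ _ 1) => //.
    by exists r => x /ltW; apply: le_trans; exact: coord_le_norm.
  by move=> x y _ _; rewrite mul1r -rV_subE opprB addrA subrK coord_le_norm.
have Hp : holder_on B a (paraboloid x0 e).
  apply: holder_onB; first exact: holder_on_cst.
  by apply: holder_on_sum => i; exact: holder_onM.
have Hm : holder_on B a (fun x => Num.max 0 (paraboloid x0 e x)).
  have [K K0 [H1 H2]] := Hp; exists K => //; split=> [x Bx|x y Bx By].
    have := max0_lip (paraboloid x0 e x) 0; rewrite maxxx !subr0 => /le_trans; apply.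
    exact: H1.
  by rewrite (le_trans (max0_lip _ _))// H2.
split=> [|i]; first exact: holder_onX.
apply: holder_onM; first by apply: holder_onM; [exact: holder_on_cst|exact: holder_onX].
by apply: holder_onM; [exact: holder_on_cst|exact: Hc].
Qed.

End smooth_cutoff.

(** * The stream function and its gradient *)

Section stream_function.
Context {R : realType}.
Variables (Omega : set 'rV[R]_3) (x0 : 'rV[R]_3) (rho C : R).
Variables (h : 'rV[R]_3 -> R) (H : 'rV[R]_3 -> 'rV[R]_3).
Hypothesis DF : defining_function Omega x0 rho C h H.
Variables (e a : R) (om : nat -> bool) (j : 'I_3).
Hypotheses (e0 : 0 < e) (erho : 2 * e <= rho) (a01 : 0 < a < 1).
Implicit Types x y : 'rV[R]_3.

Definition stream_function x : R :=
  lacunary a om (h x) (x 0 j) * cutoff_at x0 e x.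

Definition stream_gradient (l : 'I_3) x : R :=
  cutoff_at x0 e x * (lacunary_t a om (h x) (x 0 j) * H x 0 l +
    lacunary_z a om (h x) (x 0 j) * (j == l)%:R) +
  lacunary a om (h x) (x 0 j) * dcutoff_at x0 e l x.

Let C1 : 1 <= C. Proof. by case: DF. Qed.
Let C0 : 0 < C. Proof. exact: lt_le_trans C1. Qed.
Let B := [set x | `|x - x0| < 2 * e].
Let Brho x : B x -> `|x - x0| < rho.
Proof. by move=> /lt_le_trans; apply. Qed.
Let a01' : 0 <= a <= 1. Proof. by case/andP: a01 => *; rewrite !ltW. Qed.

Lemma defining_lip x y : `|x - x0| < rho -> `|y - x0| < rho ->
  `|h y - h x| <= 5 * C * `|y - x|.
Proof.
move=> hx hy; have [/andP[_ rho1] _ _ /(_ x y hx hy)[b1 _ b3] _] := DF.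
have b4 := norm_dot_le (H x) (y - x).
have d2 : `|y - x| <= 2.
  by rewrite -[y - x](subrKA x0) (le_trans (ler_normD _ _))// [`|x0 - x|]distrC; lra.
have -> : h y - h x = (h y - h x - dot (H x) (y - x)) + dot (H x) (y - x) by ring.
have p1 : C * `|y - x| ^+ 2 <= C * (2 * `|y - x|).
  by rewrite ler_wpM2l ?(ltW C0)// expr2 ler_wpM2r.
have p2 : `|H x| * `|y - x| <= C * `|y - x| by rewrite ler_wpM2r.
by rewrite (le_trans (ler_normD _ _))//; move: b3 b4 p1 p2; lra.
Qed.

Let K := 5 * C.
Let K1 : 1 <= K. Proof. by rewrite /K; have := C1; lra. Qed.

Let coord_lip x y : `|y 0 j - x 0 j| <= K * `|y - x|.
Proof.
by rewrite -rV_subE (le_trans (coord_le_norm _ _))// ler_peMl.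
Qed.

Let lacunary_comp_holder (F : R -> R -> R) : (forall t z, `|F t z| <= 8) ->
  (forall t t' z z' d, `|t - t'| <= d -> `|z - z'| <= d ->
     `|F t z - F t' z'| <= 144 * d `^ a) ->
  holder_on B a (fun x => F (h x) (x 0 j)).
Proof.
move=> F8 FH; have k0 : 0 <= 144 * K `^ a by rewrite mulr_ge0// powR_ge0.
exists (8 + 144 * K `^ a); first by rewrite addr_ge0.
split=> [x _|x y Bx By]; first by rewrite (le_trans (F8 _ _))// lerDl.
rewrite (le_trans (FH _ _ _ _ _ (defining_lip _ _ (Brho _ By) (Brho _ Bx)) (coord_lip _ _)))//.
rewrite powRM ?normr_ge0//; last by rewrite (le_trans _ K1).
by rewrite mulrA ler_wpM2r ?powR_ge0// lerDr.
Qed.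

Let H_holder l : holder_on B a (fun x => H x 0 l).
Proof.
have [_ _ _ Hc _] := DF.
apply: (lipschitz_holder_on _ _ C) => //.
  exists C => x Bx; rewrite (le_trans (coord_le_norm _ _))//.
  by have [] := Hc _ _ (Brho _ Bx) (Brho _ Bx).
move=> x y Bx By; rewrite -rV_subE (le_trans (coord_le_norm _ _))//.
by have [_ b _] := Hc _ _ (Brho _ By) (Brho _ Bx).
Qed.

Lemma stream_zero x : e <= `|x - x0| ->
  stream_function x = 0 /\ (forall l, stream_gradient l x = 0).
Proof.
move=> ex; have [c0 d0] := cutoff_at_out _ _ _ (ltW e0) ex.
by rewrite /stream_function c0 mulr0; split=> // l; rewrite /stream_gradient c0 d0 mul0r mulr0 addr0.
Qed.

Lemma stream_function_holder : holder_on setT a stream_function.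
Proof.
apply: (holder_on_extend x0 e) => //; first by case/andP: a01'.
  have [Hc _] := cutoff_at_holder x0 e a (2 * e) a01'.
  apply: holder_onM => //; apply: lacunary_comp_holder => [t z|t t' z z' d d1 d2].
    by have [] := lacunary_bound a a01 om t z.
  by have [] := lacunary_holder a a01 om _ _ _ _ _ d1 d2.
by move=> x /stream_zero[].
Qed.

Lemma stream_gradient_holder l : holder_on setT a (stream_gradient l).
Proof.
apply: (holder_on_extend x0 e) => //; first by case/andP: a01'.
  have [Hc Hd] := cutoff_at_holder x0 e a (2 * e) a01'.
  have L : holder_on B a (fun x => lacunary a om (h x) (x 0 j)).
    apply: lacunary_comp_holder => [t z|t t' z z' d d1 d2].
      by have [] := lacunary_bound a a01 om t z.
    by have [] := lacunary_holder a a01 om _ _ _ _ _ d1 d2.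
  have Lt : holder_on B a (fun x => lacunary_t a om (h x) (x 0 j)).
    apply: lacunary_comp_holder => [t z|t t' z z' d d1 d2].
      by have [] := lacunary_bound a a01 om t z.
    by have [] := lacunary_holder a a01 om _ _ _ _ _ d1 d2.
  have Lz : holder_on B a (fun x => lacunary_z a om (h x) (x 0 j)).
    apply: lacunary_comp_holder => [t z|t t' z z' d d1 d2].
      by have [] := lacunary_bound a a01 om t z.
    by have [] := lacunary_holder a a01 om _ _ _ _ _ d1 d2.
  apply: holder_onD; last exact: holder_onM.
  apply: holder_onM => //; apply: holder_onD; apply: holder_onM => //.
  exact: holder_on_cst.
by move=> x /stream_zero[_].
Qed.

(** Chain rule by remainders: that of [lacunary] has order [1 + a], and that of [h] is quadratic and
    multiplied by a factor at most 8. Each gets half of the tolerance. This covers boundary points,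
    where infinitely many scales accumulate. *)
Let is_derive_lacunary l x : `|x - x0| < rho ->
  is_derive x (basis_vec R l) (fun x => lacunary a om (h x) (x 0 j))
    (lacunary_t a om (h x) (x 0 j) * H x 0 l +
     lacunary_z a om (h x) (x 0 j) * (j == l)%:R).
Proof.
move=> hx; apply: is_derive_remainder => k k0.
have Ka : 0 <= 146 * K * K `^ a.
  by rewrite mulr_ge0 ?powR_ge0// mulr_ge0// (le_trans _ K1).
have k2 : 0 < k / 2 by rewrite divr_gt0.
have a_gt0 : 0 < a by case/andP: a01.
have [d d0 Hd] := powR_lt_near _ a _ Ka a_gt0 k2.
have near0 : \forall t \near (0 : R), [/\ `|t| < d, `|t| * (16 * C) <= k & `|t| < rho - `|x - x0|].
  apply: (near_normP _ _).2.
  exists (Num.min d (Num.min (k / (16 * C)) (rho - `|x - x0|))).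
    by rewrite !lt_min d0 subr_gt0 hx divr_gt0// mulr_gt0.
  move=> t; rewrite subr0 !lt_min => /and3P[t1 t2 t3]; split=> //.
  by rewrite -ler_pdivlMr ?mulr_gt0// ltW.
apply: filterS near0 => t [t1 t2 t3]; pose x' := x + t *: basis_vec R l.
have dx : x' - x = t *: basis_vec R l by rewrite /x' addrAC subrr add0r.
have ndx : `|x' - x| <= `|t| by rewrite dx normrZ ler_piMr// norm_basis_vec.
have hx' : `|x' - x0| < rho.
  by rewrite -[x' - x0](subrKA x) (le_lt_trans (ler_normD _ _))//; lra.
have [_ _ _ /(_ x x' hx hx')[_ _ b3] _] := DF.
have e1 : `|h x' - h x| <= K * `|t|.
  by rewrite (le_trans (defining_lip _ _ hx hx'))// ler_wpM2l// (le_trans _ K1).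
have e2 : `|x' 0 j - x 0 j| <= K * `|t|.
  by rewrite (le_trans (coord_lip _ _))// ler_wpM2l// (le_trans _ K1).
have := lacunary_remainder a a01 om _ _ _ _ _ e1 e2.
have -> : x' 0 j - x 0 j = t * (j == l)%:R by rewrite -rV_subE dx !mxE eqxx.
have Hl : dot (H x) (x' - x) = t * H x 0 l by rewrite dx dotZr dot_basis_vec.
rewrite Hl in b3; have [_ lt8 _] := lacunary_bound a a01 om (h x) (x 0 j).
have b5 : `|h x' - h x - t * H x 0 l| <= C * (`|t| * `|t|).
  by rewrite (le_trans b3)// ler_wpM2l ?(ltW C0)// expr2 ler_pM.
have p1 : 146 * (K * `|t| * (K * `|t|) `^ a) <= k / 2 * `|t|.
  have Kt : 0 <= K by rewrite (le_trans _ K1).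
  rewrite powRM//; have -> : 146 * (K * `|t| * (K `^ a * `|t| `^ a)) =
    (146 * K * K `^ a * `|t| `^ a) * `|t| by ring.
  by rewrite ler_wpM2r// ltW// Hd// normr_ge0.
have p2 : 8 * (C * (`|t| * `|t|)) <= k / 2 * `|t|.
  have -> : 8 * (C * (`|t| * `|t|)) = `|t| * (16 * C) / 2 * `|t| by field.
  by rewrite ler_wpM2r// ler_wpM2r.
rewrite -/x'; move: lt8 b5 p1 p2.
move: (lacunary _ _ _ _) (lacunary a om (h x) _) (lacunary_t _ _ _ _) (lacunary_z _ _ _ _).
move=> L' L Lt Lz lt8 b5 p1 p2 b6.
have -> : L' - L - t * (Lt * H x 0 l + Lz * (j == l)%:R) =
  (L' - L - Lt * (h x' - h x) - Lz * (t * (j == l)%:R)) + Lt * (h x' - h x - t * H x 0 l).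
  by ring.
rewrite (le_trans (ler_normD _ _))// (splitr k) mulrDl lerD//.
  exact: le_trans b6 p1.
by rewrite normrM (le_trans _ p2)// ler_pM.
Qed.

Lemma is_derive_stream_function l x :
  is_derive x (basis_vec R l) stream_function (stream_gradient l x).
Proof.
have [hx|hx] := ltP `|x - x0| rho.
  have := is_deriveM (is_derive_lacunary l _ hx) (is_derive_cutoff_at x0 e l x).
  suff -> : stream_gradient l x = lacunary a om (h x) (x 0 j) *: dcutoff_at x0 e l x +
    cutoff_at x0 e x *: (lacunary_t a om (h x) (x 0 j) * H x 0 l +
     lacunary_z a om (h x) (x 0 j) * (j == l)%:R) by [].
  by rewrite addrC.
have ex : e < `|x - x0| by rewrite (lt_le_trans _ hx)// (lt_le_trans _ erho)// ltr_pMl// ltr1n.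
have [sx ->] := stream_zero _ (ltW ex).
apply: is_derive_remainder => k k0.
have near0 : \forall t \near (0 : R), `|t| < `|x - x0| - e.
  apply: (near_normP _ _).2; exists (`|x - x0| - e); first by rewrite subr_gt0.
  by move=> t; rewrite subr0.
apply: filterS near0 => t te.
have ex2 : e <= `|x + t *: basis_vec R l - x0|.
  have B1 : `|t *: basis_vec R l| <= `|t| by rewrite normrZ ler_piMr// norm_basis_vec.
  have -> : x + t *: basis_vec R l - x0 = (x - x0) - (- (t *: basis_vec R l)).
    by rewrite opprK addrAC.
  have := lerB_dist (x - x0) (- (t *: basis_vec R l)); rewrite normrN; lra.
have [-> _] := stream_zero _ ex2.
by rewrite sx mulr0 !subr0 normr0 mulr_ge0// ltW.
Qed.

Lemma stream_zero_boundary x l : bd Omega x -> stream_gradient l x = 0.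
Proof.
move=> bx; have [hx|hx] := ltP `|x - x0| rho.
  have [_ _ /(_ _ hx)[_ Hb] _ _] := DF; have hx0 : h x = 0 by apply/Hb.
  have hx00 : h x <= 0 by rewrite hx0.
  have [l1 l2 l3] := lacunary_le0 a om _ (x 0 j) hx00.
  by rewrite /stream_gradient l1 l2 l3 !mul0r !addr0 mulr0.
have ex : e <= `|x - x0| by rewrite (le_trans _ hx)// (le_trans _ erho)// ler_pMl// ler1n.
by have [_ ->] := stream_zero _ ex.
Qed.

End stream_function.

(** * The velocity and its normal component *)

Section velocity.
Context {R : realType}.
Variables (Omega : set 'rV[R]_3) (x0 : 'rV[R]_3) (rho C : R).
Variables (h : 'rV[R]_3 -> R) (H : 'rV[R]_3 -> 'rV[R]_3).
Hypothesis DF : defining_function Omega x0 rho C h H.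
Variables (delta eps e a : R) (i j : 'I_3).
Hypotheses (bx0 : bd Omega x0) (tub : tubular_radius Omega delta).
Hypotheses (eps0 : 0 < eps) (epsrho : 4 * eps <= rho) (epsdelta : 2 * eps <= delta)
  (epsC : 16 * C * eps <= 1).
Hypotheses (e0 : 0 < e) (eeps : 2 * e <= eps / 2) (a01 : 0 < a < 1) (ij : j != i).
Implicit Types (x y : 'rV[R]_3) (om : nat -> bool).
Local Notation nu := (unit_normal H).
Local Notation D om := (stream_gradient x0 h H e a om j).

Definition velocity om : 'rV[R]_3 -> 'rV[R]_3 := rotated_gradient i j (D om).

Let erho : 2 * e <= rho. Proof. have := eeps; have := epsrho; have := eps0; lra. Qed.
Let C1 : 1 <= C. Proof. by case: DF. Qed.
Let C0 : 0 < C. Proof. exact: lt_le_trans C1. Qed.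
Let a01' : 0 <= a <= 1. Proof. by case/andP: a01 => *; rewrite !ltW. Qed.

Let Dholder om l : holder_on setT a (D om l).
Proof. exact: stream_gradient_holder DF _ _ _ _ e0 erho a01 _. Qed.

Let Dzero om x l : e <= `|x - x0| -> D om l x = 0.
Proof. by move=> ex; have [_ ->] := stream_zero _ h H e a om j e0 _ ex. Qed.

Lemma dot_velocity om x v : dot (velocity om x) v = D om j x * v 0 i - D om i x * v 0 j.
Proof. exact: (dot_rotated_gradient i j (D om) x (fun l => v 0 l)). Qed.

Lemma velocity_boundary om y : bd Omega y -> velocity om y = 0.
Proof.
move=> by_; rewrite /velocity /rotated_gradient.
by rewrite !(stream_zero_boundary _ _ _ _ _ _ DF _ _ _ _ e0 erho)// !scale0r subrr.
Qed.

Lemma holder_velocity om : holder a Omega (velocity om).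
Proof.
have [Ci Ci0 [Bi Li]] := Dholder om i; have [Cj Cj0 [Bj Lj]] := Dholder om j.
have a_gt0 : 0 < a by case/andP: a01.
split; last first.
  apply: continuous_subspaceT => x.
  have ci := holder_on_continuous _ _ a_gt0 (Dholder om i) x.
  have cj := holder_on_continuous _ _ a_gt0 (Dholder om j) x.
  exact: (cvgB (cvgZr_tmp (a := basis_vec R i) cj) (cvgZr_tmp (a := basis_vec R j) ci)).
exists (Cj + Ci); split=> [x _|x y _ _].
  rewrite (le_trans (ler_normB _ _))// lerD// normrZ -[leRHS]mulr1 ler_pM ?norm_basis_vec//.
    exact: Bj.
  exact: Bi.
have -> : velocity om x - velocity om y =
    (D om j x - D om j y) *: basis_vec R i - (D om i x - D om i y) *: basis_vec R j.
  rewrite /velocity /rotated_gradient.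
  move: (D om j x) (D om j y) (D om i x) (D om i y) => p q p' q'.
  by apply/rowP => l; rewrite !mxE; ring.
have pw : `|x - y| `^ a <= enorm (x - y) `^ a.
  by rewrite ge0_ler_powR ?nnegrE ?norm_le_enorm ?enorm_ge0// ltW.
rewrite (le_trans (ler_normB _ _))// mulrDl lerD//
  normrZ -[leRHS]mulr1 ler_pM ?norm_basis_vec//.
  by rewrite (le_trans (Lj _ _ I I))// ler_wpM2l.
by rewrite (le_trans (Li _ _ I I))// ler_wpM2l.
Qed.

Lemma velocity_field_velocity om : velocity_field a Omega (velocity om).
Proof.
have a_gt0 : 0 < a by case/andP: a01.
split; first exact: holder_velocity.
  apply: (divergence_free_rotated_gradient _ _ _ (stream_function x0 h e a om j)).
  - apply: (holder_on_continuous _ a) => //.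
    exact: stream_function_holder DF _ _ _ _ e0 erho a01.
  - by move=> l; apply: (holder_on_continuous _ a).
  - by move=> l x; exact: is_derive_stream_function DF _ _ _ _ e0 erho a01 _ _.
by move=> y by_; rewrite velocity_boundary// dotC dot0r.
Qed.

Lemma normal_sqE om x : normal_sq Omega (velocity om) x =
  (D om j x * normal_ext Omega x 0 i - D om i x * normal_ext Omega x 0 j) ^+ 2.
Proof. by rewrite /normal_sq dot_velocity. Qed.

Lemma normal_sq_out om x : e <= `|x - x0| -> normal_sq Omega (velocity om) x = 0.
Proof. by move=> ex; rewrite normal_sqE !Dzero// !mul0r subrr expr0n. Qed.

Lemma normal_sq_boundary om y : bd Omega y -> normal_sq Omega (velocity om) y = 0.
Proof. by move=> by_; rewrite /normal_sq velocity_boundary// dotC dot0r expr0n. Qed.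

Lemma normal_sq_ge0 om x : 0 <= normal_sq Omega (velocity om) x.
Proof. exact: sqr_ge0. Qed.

Let e_eps x : `|x - x0| < 2 * e -> `|x - x0| < eps.
Proof. by have := eeps; have := eps0; lra. Qed.

(** The extended normal is known to be Lipschitz only near [x0]; the velocity vanishes outside the
    ball of radius [e], so [holder_on_extend] gives the rest of the space. *)
Lemma normal_sq_holder om : holder_on setT a (normal_sq Omega (velocity om)).
Proof.
apply: (holder_on_extend x0 e) => //; first by case/andP: a01'.
  have Hn l : holder_on [set x | `|x - x0| < 2 * e] a (fun x => normal_ext Omega x 0 l).
    apply: (lipschitz_holder_on _ _ (120 * C ^+ 3)) => //.
      exists 1 => x /e_eps hx; rewrite (le_trans (coord_le_norm _ _))//.
      by have [] := normal_ext_near _ _ _ _ _ _ DF _ _ bx0 tub eps0 epsrho epsdelta _ hx.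
    move=> x y /e_eps hx /e_eps hy; rewrite -rV_subE (le_trans (coord_le_norm _ _))//.
    exact: normal_ext_lip DF _ _ bx0 tub eps0 epsrho epsdelta epsC _ _ hx hy.
  apply: eq_holder_on (fun x _ => esym (normal_sqE om x)) _.
  have HD l := holder_onS _ _ _ _ (fun _ _ => I) (Dholder om l).
  by apply: holder_onX; apply: holder_onB; apply: holder_onM => //; exact: HD.
by move=> x; exact: normal_sq_out.
Qed.

(** The velocity is supported where the distance to the boundary is at most [delta], and there [phi]
    is 1. *)
Lemma cut_normal_sqE (phi : R -> R) om x : cutoff delta phi ->
  cut_normal_sq Omega phi (velocity om) x = normal_sq Omega (velocity om) x.
Proof.
move=> [_ _ _ phi1 _]; rewrite /cut_normal_sq.
have [ex|ex] := leP e `|x - x0|; first by rewrite normal_sq_out// mulr0.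
have ee : `|x - x0| < eps by apply: e_eps; rewrite (lt_le_trans ex)// ler_pMl// ler1n.
rewrite phi1 ?mul1r//; apply/andP; split.
  apply: lb_le_inf; first by exists (enorm (x - x0)); exists x0.
  by move=> _ [z _ <-]; exact: enorm_ge0.
exact: le_trans (dist_bd_near _ _ _ bx0 _ ee) epsdelta.
Qed.

Section offset.
Variables (y : 'rV[R]_3) (k : nat).
Hypotheses (by_ : bd Omega y) (ye : `|y - x0| < e).
Let s : R := scale k.
Hypotheses (se : s < e) (sC : 8 * C * s <= 1).
Let x := y - s *: nu y.

Let s0 : 0 < s. Proof. exact: scale_gt0. Qed.
Let ye2 : `|y - x0| < eps / 2.
Proof. by have := eeps; have := ye; have := e0; lra. Qed.
Let se2 : 0 <= s < eps / 2.
Proof. by rewrite (ltW s0) /=; have := se; have := eeps; have := e0; lra. Qed.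
Let yrho : `|y - x0| < rho.
Proof. by have := ye2; have := epsrho; have := eps0; lra. Qed.
Let xeps : `|x - x0| < eps.
Proof. exact: offset_near DF _ eps0 epsrho _ _ ye2 se2. Qed.
Let xrho : `|x - x0| < rho.
Proof. by have := xeps; have := epsrho; have := eps0; lra. Qed.
Let xy : `|x - y| <= s.
Proof.
rewrite /x addrAC subrr add0r normrN normrZ (gtr0_norm s0) ler_piMr ?(ltW s0)//.
exact: norm_unit_normal DF _ yrho.
Qed.

Lemma normal_ext_x : normal_ext Omega x = nu y.
Proof. exact: normal_ext_offset DF _ _ bx0 tub eps0 epsrho epsdelta epsC _ _ by_ ye2 se2. Qed.

(** Two errors of at most 1/8: the quadratic term of [normal_displacement], and the deviation of
    [enorm (H y)] from 1. *)
Lemma offset_depth : `|h x / s - 1| <= 4^-1.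
Proof.
have B := normal_displacement _ _ _ _ _ _ DF _ _ by_ yrho xrho.
have [_ _ _ _ /(_ _ yrho)[N _]] := DF.
have -> : h x / s - 1 = (h x - s * enorm (H y)) / s + (enorm (H y) - 1).
  by field; rewrite gt_eqF.
rewrite (le_trans (ler_normD _ _))//.
have : `|(h x - s * enorm (H y)) / s| <= 8^-1.
  rewrite normrM normfV (gtr0_norm s0) ler_pdivrMr// (le_trans B)// expr2.
  by have := sC; have := s0; nra.
by move: N; lra.
Qed.

Lemma offset_active : active k (h x).
Proof. by apply: le_lt_trans offset_depth _; lra. Qed.

(** At this depth only the flag of scale [k] is visible, so the phases can be chosen for one scale
    at a time. *)
Lemma normal_sq_offset_phase om :
  normal_sq Omega (velocity om) x = normal_sq Omega (velocity (fun=> om k)) x.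
Proof.
have A := offset_active; rewrite !normal_sqE /stream_gradient.
have [-> -> ->] := lacunary_active a om k _ (x 0 j) A.
by have [-> -> ->] := lacunary_active a (fun=> om k) k _ (x 0 j) A.
Qed.

(** With the gradient at [y] in place of that at [x], the terms with [swave_t] would cancel, because
    the normal is parallel to [H y]. The replacement and the derivative of the cutoff leave an error
    of order [s * s ^ a], one power of [s] below the main term. *)
Lemma offset_normal_component ph (M : R) : 4^-1 <= `|H y 0 i| ->
  0 <= M -> `|cutoff_at x0 e x| <= M -> (forall l, `|dcutoff_at x0 e l x| <= M) ->
  (cutoff_at x0 e x * swave_z a s ph (h x) (x 0 j)) ^+ 2 / 64 -
    (20 * M * C ^+ 2 * (s * s `^ a)) ^+ 2 <=
  normal_sq Omega (velocity (fun=> ph)) x.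
Proof.
move=> Hi M0 cM dM; have A := offset_active; rewrite normal_sqE normal_ext_x /stream_gradient.
have [-> -> ->] := lacunary_active a (fun=> ph) k _ (x 0 j) A; rewrite -/s.
have [w1 w2 w3] := swave_bound a s ph s0 (h x) (x 0 j).
have [_ _ _ Hc _] := DF; have [B1 B2 _] := Hc _ _ yrho xrho.
have /andP[g1 g2] := gradient_enorm _ _ _ _ _ _ DF _ yrho.
have N0 : 0 < enorm (H y) by lra.
rewrite eqxx (negbTE ij) mulr1 mulr0 addr0.
have nuE l : nu y 0 l = - (H y 0 l / enorm (H y)) by rewrite !mxE mulrC.
rewrite !nuE.
have cl l : `|H y 0 l| <= C by rewrite (le_trans (coord_le_norm _ _)).
have dl l : `|H x 0 l - H y 0 l| <= C * s.
  rewrite -rV_subE (le_trans (coord_le_norm _ _))// (le_trans B2)//.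
  by rewrite ler_wpM2l ?(ltW C0).
move: (cl i) (cl j) (dl i) (dl j) (dM i) (dM j) w1 w2 w3 cM Hi N0 g1 g2.
have sa0 : 0 <= s `^ a by exact: powR_ge0.
move: (s `^ a) sa0 (swave _ _ _ _ _) (swave_t _ _ _ _ _) (swave_z _ _ _ _ _) => sa sa0 w wt wz.
move: (cutoff_at _ _ _) (dcutoff_at _ _ i _) (dcutoff_at _ _ j _) => c ci cj.
move: (H y 0 i) (H y 0 j) (H x 0 i) (H x 0 j) (enorm (H y)) => yi yj xi xj N.
move=> ci_ cj_ di dj dci dcj w1 w2 w3 cM Hi N0 g1 g2.
(* All that is left besides the main term [c * wz * yi]: the gradient increment from [y] to [x], and
   the derivative falling on the cutoff. *)
pose E := c * wt * ((xj - yj) * yi - (xi - yi) * yj) + w * (cj * yi - ci * yj).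
have -> : (c * (wt * xj + wz) + w * cj) * - (yi / N) - (c * (wt * xi) + w * ci) * - (yj / N) =
    - ((c * wz * yi + E) / N) by rewrite /E; field; rewrite gt_eqF.
have E1 : `|E| <= 20 * M * C ^+ 2 * (s * sa).
  have q1 : `|(xj - yj) * yi - (xi - yi) * yj| <= C * s * C + C * s * C.
    by rewrite (le_trans (ler_normB _ _))// lerD// normrM ler_pM.
  have q2 : `|cj * yi - ci * yj| <= M * C + M * C.
    by rewrite (le_trans (ler_normB _ _))// lerD// normrM ler_pM.
  have q3 : `|c * wt * ((xj - yj) * yi - (xi - yi) * yj)| <= M * (8 * sa) * (C * s * C + C * s * C).
    by rewrite normrM ler_pM// normrM ler_pM.
  have q4 : `|w * (cj * yi - ci * yj)| <= s * sa * (M * C + M * C) by rewrite normrM ler_pM.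
  rewrite (le_trans (ler_normD _ _))// (le_trans (lerD q3 q4))//.
  have q5 : M * C * (s * sa) <= M * C ^+ 2 * (s * sa).
    rewrite ler_wpM2r ?mulr_ge0 ?(ltW s0)// ler_wpM2l// expr2 ler_peMr ?(ltW C0)//.
  have q6 : 0 <= M * C ^+ 2 * (s * sa).
    by apply: mulr_ge0; apply: mulr_ge0; rewrite ?sqr_ge0// ltW.
  move: q5 q6; rewrite expr2.
  have -> : M * (8 * sa) * (C * s * C + C * s * C) + s * sa * (M * C + M * C) =
    16 * (M * (C * C) * (s * sa)) + 2 * (M * C * (s * sa)) by ring.
  have -> : 20 * M * (C * C) * (s * sa) = 20 * (M * (C * C) * (s * sa)) by ring.
  by move: (M * C * _) (M * (C * C) * (s * sa)) => u v; lra.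
have E2 : E ^+ 2 <= (20 * M * C ^+ 2 * (s * sa)) ^+ 2.
  rewrite -[leLHS]real_normK ?num_real// lerXn2r ?nnegrE//.
  by rewrite (le_trans (normr_ge0 _) E1).
rewrite sqrrN expr_div_n ler_pdivlMr ?exprn_gt0//.
have Hi2 : 16^-1 <= yi ^+ 2.
  by rewrite -[leRHS]real_normK ?num_real//; move: Hi; move: `|yi| => z hz; nra.
have Nsq : N ^+ 2 <= 2 by rewrite expr2; nra.
have Nsq1 : 2^-1 <= N ^+ 2 by rewrite expr2; nra.
clear E1; move: E2; move: (20 * M * _ * _) E => k' E E2.
(* The factor 1/64 is 1/16 from the size of [yi], 1/2 from (A + E)^2 >= A^2 / 2 - E^2, and 1/2 from
   [N ^+ 2 <= 2]. *)
have A1 : (c * wz) ^+ 2 / 16 <= (c * wz * yi) ^+ 2.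
  by rewrite exprMn -mulrA; move: (sqr_ge0 (c * wz)) Hi2; rewrite expr2; nra.
have A2 : (c * wz * yi) ^+ 2 / 2 - E ^+ 2 <= (c * wz * yi + E) ^+ 2.
  have := sqr_ge0 (c * wz * yi + 2 * E); move: (c * wz * yi) => u; rewrite !expr2; lra.
move: (sqr_ge0 (c * wz * yi + E)) A1 A2 E2 Nsq Nsq1 (sqr_ge0 (c * wz)) (sqr_ge0 E) (sqr_ge0 k').
move: ((c * wz) ^+ 2) ((c * wz * yi) ^+ 2) ((c * wz * yi + E) ^+ 2) (E ^+ 2) (k' ^+ 2) (N ^+ 2).
move=> u v w' E' K' N' w0 A1 A2 E2 Nsq Nsq1 u0 E0 K0.
have [P|P] := leP (u / 64 - K') 0.
  by apply: le_trans w0; rewrite pmulr_lle0//; lra.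
have : (u / 64 - K') * N' <= (u / 64 - K') * 2 by rewrite ler_wpM2l// ltW.
lra.
Qed.

End offset.
End velocity.

(** * Lower bound for the difference quotients *)

Section surface_integrals.
Context {R : realType}.
Variables (S : {measure set (borel3 R) -> \bar R}).
Implicit Types (D A : set 'rV[R]_3) (f g : 'rV[R]_3 -> R).

(** Preimages of open intervals are relatively open in [D]: each is the trace on [D] of the union
    [V] of the balls on which membership persists. *)
Lemma holder_on_measurable D (a : R) f : closed D -> 0 < a -> holder_on D a f ->
  measurable_fun (D : set (borel3 R)) (f : borel3 R -> R).
Proof.
move=> cD a0 [C C0 [_ Hf]].
apply: (measurability _ (RGenOpens.measurableE R)) => _ [_ [p [q ->] <-]].
set O := `]p, q[%classic; set W := _ `&` _.
pose V := [set x : 'rV[R]_3 | exists y (r : R), [/\ W y, `|x - y| < r &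
  forall x', D x' -> `|x' - y| < r -> W x']].
have oV : open V.
  rewrite openE => x [y [r [Wy xy Hr]]].
  apply: (near_normP x V).2; exists (r - `|x - y|); first by rewrite subr_gt0.
  move=> z zx; exists y, r; split=> //.
  by rewrite -[z - y](subrKA x) (le_lt_trans (ler_normD _ _))//; lra.
have -> : W = D `&` V.
  apply/seteqP; split=> x [Dx Vx]; last by case: Vx => y [r [_ xy Hr]]; exact: Hr.
  split=> //; have oO : open O by exact: interval_open.
  have [eps eps0 Heps] := (near_normP (f x) O).1 (open_nbhs_nbhs (conj oO Vx)).
  have [r r0 Hr] := powR_lt_near C a eps C0 a0 eps0.
  exists x, r; split=> [||x' Dx' x'x]; first by split.
    by rewrite subrr normr0.
  split=> //; apply: Heps; rewrite (le_lt_trans (Hf _ _ Dx' Dx))// Hr//.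
  by rewrite normr_ge0.
apply: measurableI; first exact: closed_borel3.
exact: sub_sigma_algebra.
Qed.

Lemma holder_on_integrable D (a : R) f : closed D -> (S D < +oo)%E -> 0 < a ->
  holder_on D a f -> S.-integrable (D : set (borel3 R)) (EFin \o (f : borel3 R -> R)).
Proof.
move=> cD SD a0 Hf; apply: measurable_bounded_integrable => //.
- exact: closed_borel3.
- exact: holder_on_measurable Hf.
- have [C C0 [B _]] := Hf; exists C; split; first exact: num_real.
  by move=> y Cy x Dx; exact: le_trans (B _ Dx) (ltW Cy).
Qed.

Lemma Rintegral_lower_bound D A g (k : R) : closed D -> closed A -> A `<=` D ->
  (S A < +oo)%E ->
  S.-integrable (D : set (borel3 R)) (EFin \o (g : borel3 R -> R)) ->
  (forall y, D y -> 0 <= g y) -> 0 <= k -> (forall y, A y -> k <= g y) ->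
  k * fine (S A) <= \int[S]_(y in (D : set (borel3 R))) g y.
Proof.
move=> cD cA AD SA ig g0 k0 kg; rewrite /Rintegral.
have mD := closed_borel3 _ cD; have mA := closed_borel3 _ cA.
have SAf : S A \is a fin_num by rewrite ge0_fin_numE// measure_ge0.
have fin : (\int[S]_(y in (D : set (borel3 R))) (g y)%:E)%E \is a fin_num.
  exact: integrable_fin_num ig.
have mg := measurable_int _ ig.
rewrite -lee_fin fineK// EFinM fineK//.
rewrite -[leLHS](_ : \int[S]_(y in (A : set (borel3 R))) (k%:E) = _)%E; last exact: integral_cst.
apply: (@le_trans _ _ (\int[S]_(y in (A : set (borel3 R))) (g y)%:E)%E).
  apply: ge0_le_integral => //; exact: measurable_funS mD AD mg.
apply: ge0_subset_integral => //.
Qed.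

Lemma surf_int_localize Omega D g : D `<=` bd Omega ->
  (forall y, bd Omega y -> ~ D y -> g y = 0) ->
  surf_int Omega S g = \int[S]_(y in (D : set (borel3 R))) g y.
Proof.
move=> Db g0; rewrite /surf_int /Rintegral; congr fine.
rewrite integral_mkcond [RHS]integral_mkcond; apply: eq_integral => y _.
rewrite !patchE; case: ifPn => yb; case: ifPn => // yD.
  by rewrite g0//; [exact: set_mem|move: yD; rewrite notin_setE].
by move: yb; rewrite notin_setE => yb; case: yb; apply: Db; exact: set_mem.
Qed.

End surface_integrals.

(** * Difference quotients as integrals over a boundary cap *)

Section quotients.
Context {R : realType}.
Variables (Omega : set 'rV[R]_3) (x0 : 'rV[R]_3) (rho C : R).
Variables (h : 'rV[R]_3 -> R) (H : 'rV[R]_3 -> 'rV[R]_3).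
Hypothesis DF : defining_function Omega x0 rho C h H.
Variables (delta eps e a : R) (i j : 'I_3).
Hypotheses (bx0 : bd Omega x0) (tub : tubular_radius Omega delta).
Hypotheses (eps0 : 0 < eps) (epsrho : 4 * eps <= rho) (epsdelta : 2 * eps <= delta)
  (epsC : 16 * C * eps <= 1).
Hypotheses (e0 : 0 < e) (eeps : 2 * e <= eps / 2) (a01 : 0 < a < 1) (ij : j != i).
Hypothesis Hi : forall y, `|y - x0| < rho -> `|y - x0| <= e -> 4^-1 <= `|H y 0 i|.
Variable S : {measure set (borel3 R) -> \bar R}.
Hypothesis SD : forall r : R, 0 < r < rho ->
  (0 < S (bd Omega `&` [set y : 'rV[R]_3 | (`|y - x0| <= r)%R]) < +oo)%E.
Implicit Types (x y : 'rV[R]_3) (om : nat -> bool) (f : 'rV[R]_3 -> R).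
Local Notation nu := (unit_normal H).
Local Notation theta := (cutoff_at x0 e).
Local Notation cap r := (bd Omega `&` [set y : 'rV[R]_3 | `|y - x0| <= r]).
Local Notation vel := (velocity x0 h H e a i j).

Let erho : e < rho. Proof. have := eeps; have := epsrho; have := eps0; have := e0; lra. Qed.
Let C1 : 1 <= C. Proof. by case: DF. Qed.
Let C0 : 0 < C. Proof. exact: lt_le_trans C1. Qed.
Let a_gt0 : 0 < a. Proof. by case/andP: a01. Qed.
Let a01' : 0 <= a <= 1. Proof. by case/andP: a01 => *; rewrite !ltW. Qed.

Let capE y : cap e y -> bd Omega y /\ `|y - x0| < rho.
Proof. by move=> [by_ /= ye]; split=> //; exact: le_lt_trans ye erho. Qed.

Let closed_cap r : closed (cap r).
Proof. by apply: closedI; [exact: closed_bd|exact: closed_cball]. Qed.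

Let S_cap r : 0 < r < rho -> (S (cap r) < +oo)%E.
Proof. by move=> /SD/andP[]. Qed.

Let normal_cap y : cap e y -> normal Omega y = nu y.
Proof. by move=> /capE[by_ hy]; exact: outward_unit_normalP DF _ by_ hy. Qed.

Let offset_lip (s : R) y y' : cap e y -> cap e y' -> 0 <= s <= 1 ->
  `|(y - s *: nu y) - (y' - s *: nu y')| <= (1 + 20 * C ^+ 3) * `|y - y'|.
Proof.
move=> /capE[_ hy] /capE[_ hy'] /andP[s0 s1].
have -> : (y - s *: nu y) - (y' - s *: nu y') = (y - y') - s *: (nu y - nu y').
  by move: (nu y) (nu y') => u v; apply/rowP => l; rewrite !mxE; ring.
rewrite (le_trans (ler_normB _ _))// mulrDl mul1r lerD2l normrZ ger0_norm//.
have B := unit_normal_lip _ _ _ _ _ _ DF _ _ hy hy'.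
by rewrite (le_trans _ B)// ler_piMl.
Qed.

Lemma offset_in_Omega y (s : R) : cap e y -> 0 < s -> s < eps / 2 -> C * s < 7 / 8 ->
  Omega (y - s *: nu y).
Proof.
move=> ye s0 se sC; have [by_ hy] := capE _ ye.
have hx : `|y - s *: nu y - x0| < rho.
  have := offset_near _ _ _ _ _ _ DF _ eps0 epsrho y s.
  have ye2 : `|y - x0| < eps / 2.
    by case: ye => _ /= ye; rewrite (le_lt_trans ye)//; have := eeps; have := e0; lra.
  have s2 : 0 <= s < eps / 2 by rewrite (ltW s0).
  move=> /(_ ye2 s2) hx; apply: lt_trans hx _; have := epsrho; have := eps0; lra.
have [_ _ /(_ _ hx)[Ob _] _ _] := DF; apply/Ob.
have := normal_displacement _ _ _ _ _ _ DF _ _ by_ hy hx.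
have /andP[g1 _] := gradient_enorm _ _ _ _ _ _ DF _ hy.
rewrite ler_norml => /andP[b1 _].
have p1 : C * s ^+ 2 < s * (7 / 8) by rewrite expr2 mulrCA ltr_pM2l.
have p2 : s * (7 / 8) <= s * enorm (H y) by rewrite ler_wpM2l// ltW.
by lra.
Qed.

Definition weighted_offset f (s : R) y : R := f (y - s *: nu y) * theta y.

(** The set [E] is kept general for two uses: the squared normal component is Hoelder on the whole
    space, a pressure potential only on [closure Omega]. *)
Lemma integrable_offset f (E : set 'rV[R]_3) (s : R) : holder_on E a f -> 0 <= s <= 1 ->
  (forall y, cap e y -> E (y - s *: nu y)) ->
  S.-integrable (cap e : set (borel3 R)) (EFin \o (weighted_offset f s : borel3 R -> R)).
Proof.
move=> Hf s01 HE; apply: (holder_on_integrable _ _ a) => //.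
  by apply: S_cap; rewrite e0 erho.
apply: holder_onM.
  apply: (holder_on_comp _ E _ (1 + 20 * C ^+ 3) f (fun y => y - s *: nu y)) => //.
    exact: ltW.
  by move=> y y' Dy Dy'; exact: offset_lip.
have [Hc _] := cutoff_at_holder x0 e a rho a01'.
by apply: holder_onS Hc => y [_ /= ye]; exact: le_lt_trans ye erho.
Qed.

Definition offset_integral f (s : R) : R :=
  \int[S]_(y in (cap e : set (borel3 R))) weighted_offset f s y.

Lemma theta_out y : e <= `|y - x0| -> theta y = 0.
Proof. by move=> ye; have [] := cutoff_at_out _ _ _ (ltW e0) ye. Qed.

Lemma surf_int_cap g : (forall y, e <= `|y - x0| -> g y = 0) ->
  surf_int Omega S g = \int[S]_(y in (cap e : set (borel3 R))) g y.
Proof.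
move=> g0; apply: surf_int_localize => [y []//|y by_ Dy].
by apply: g0; rewrite leNgt; apply/negP => ye; apply: Dy; split=> //=; exact: ltW.
Qed.

Lemma offset_integralE f s :
  surf_int Omega S (fun y => f (y - s *: normal Omega y) * theta y) = offset_integral f s.
Proof.
rewrite surf_int_cap => [|y ye]; last by rewrite theta_out// mulr0.
by apply: eq_Rintegral => y /set_mem yD; rewrite /weighted_offset normal_cap.
Qed.

Lemma normal_quotientE f s :
  S.-integrable (cap e : set (borel3 R)) (EFin \o (weighted_offset f 0 : borel3 R -> R)) ->
  S.-integrable (cap e : set (borel3 R)) (EFin \o (weighted_offset f s : borel3 R -> R)) ->
  normal_quotient Omega S f theta s = s^-1 * (offset_integral f 0 - offset_integral f s).
Proof.
move=> i0 is_; have mD := closed_borel3 _ (closed_cap e).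
rewrite /normal_quotient surf_int_cap => [|y ye]; last by rewrite theta_out// mulr0.
rewrite /offset_integral -RintegralB// -RintegralZl//; last exact: integrableB i0 is_.
apply: eq_Rintegral => y /set_mem yD; rewrite /weighted_offset normal_cap// scale0r subr0.
by ring.
Qed.

Lemma bd_test_theta : bd_test Omega theta.
Proof.
move=> y _; exists setT, theta; split=> //; first exact: openT.
exact: Ck_cutoff_at.
Qed.

Let nsq om := normal_sq Omega (vel om).

Let nsq_holder om : holder_on setT a (nsq om).
Proof. exact: normal_sq_holder DF _ _ _ _ _ _ bx0 tub eps0 epsrho epsdelta epsC e0 eeps a01 om. Qed.

Lemma integrable_normal_sq om s : 0 <= s <= 1 ->
  S.-integrable (cap e : set (borel3 R)) (EFin \o (weighted_offset (nsq om) s : borel3 R -> R)).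
Proof. by move=> s01; apply: (integrable_offset _ setT). Qed.

(** The velocity vanishes on the boundary, so the quotient reduces to its interior part, which has a
    sign. *)
Lemma normal_sq_quotient om s : 0 < s <= 1 ->
  normal_quotient Omega S (nsq om) theta s = - (offset_integral (nsq om) s / s).
Proof.
move=> /andP[s0 s1]; rewrite normal_quotientE; last 2 first.
- by apply: integrable_normal_sq; rewrite lexx ler01.
- by apply: integrable_normal_sq; rewrite (ltW s0).
have -> : offset_integral (nsq om) 0 = 0.
  rewrite /offset_integral -[RHS](_ : \int[S]_(y in (cap e : set (borel3 R))) 0 = 0).
    apply: eq_Rintegral => y /set_mem /capE[by_ _].
    rewrite /weighted_offset scale0r subr0 /nsq.
    by rewrite (normal_sq_boundary _ _ _ _ _ _ DF _ _ _ _ _ eps0 epsrho e0 eeps) ?mul0r.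
  by rewrite /Rintegral integral0.
by rewrite sub0r mulrN mulrC.
Qed.

Lemma scale_small (b : R) : 0 < b -> \forall k \near \oo, scale k < b.
Proof.
move=> b0; have /cvgrPdist_lt /(_ _ b0) := @scale_cvg0 R.
by apply: filterS => k; rewrite sub0r normrN gtr0_norm ?scale_gt0.
Qed.

Let theta_ge : exists2 eta0 : R, 0 < eta0 &
  forall x, `|x - x0| <= e / 4 -> eta0 <= theta x.
Proof.
(* In the sup-norm ball of radius [e / 4] the squared Euclidean distance to [x0] is at most
   [3 * e^2 / 16], less than half of [e^2]. *)
exists ((e ^+ 2 / 2) ^+ 5); first by rewrite exprn_gt0// divr_gt0// exprn_gt0.
move=> x xe; have B := norm_dot_le (x - x0) (x - x0).
have p1 : `|x - x0| * `|x - x0| <= e / 4 * (e / 4) by rewrite ler_pM.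
have P : e ^+ 2 / 2 <= paraboloid x0 e x.
  rewrite /paraboloid; have := ler_norm (dot (x - x0) (x - x0)).
  have e2 : 0 <= e ^+ 2 by exact: sqr_ge0.
  have E16 : e / 4 * (e / 4) = e ^+ 2 / 16 by field.
  rewrite E16 in p1; move: B p1 e2; move: (dot _ _) (e ^+ 2) (`|x - x0| * _) => u v w; lra.
have P0 : 0 <= e ^+ 2 / 2 by rewrite divr_ge0// sqr_ge0.
rewrite /cutoff_at /pospow max_r ?lerXn2r ?nnegrE//; exact: le_trans P.
Qed.

Let J ph k := offset_integral (nsq (fun=> ph)) (scale k).

(** By [dwave_sq] the sum of the two main terms does not depend on the phase at the point, so it is
    bounded below pointwise on the smaller cap of radius [e / 8], where the cutoff stays away from
    0. *)
Lemma phase_sum_lower : exists2 c : R, 0 < c & \forall k \near \oo,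
  c * (scale k `^ a * scale k `^ a) <= J true k + J false k.
Proof.
have [eta0 eta00 theta_ge'] := theta_ge.
have [[M1 M10 [BM1 _]] HM] := cutoff_at_holder x0 e a rho a01'.
have [M [M0 cM dM]] : exists M : R, [/\ 0 <= M,
    (forall x, `|x - x0| < rho -> `|theta x| <= M) &
    (forall l x, `|x - x0| < rho -> `|dcutoff_at x0 e l x| <= M)].
  have [m0 m00 [B0 _]] := HM 0; have [m1 m10 [B1 _]] := HM 1; have [m2 m20 [B2 _]] := HM 2%:R.
  exists (M1 + m0 + m1 + m2); split; first by rewrite !addr_ge0.
    by move=> x hx; rewrite (le_trans (BM1 _ hx))// -!addrA lerDl !addr_ge0.
  apply: forall_I3 => x hx.
  - by rewrite (le_trans (B0 _ hx))//; lra.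
  - by rewrite (le_trans (B1 _ hx))//; lra.
  - by rewrite (le_trans (B2 _ hx))//; lra.
pose K := 20 * M * C ^+ 2.
have SA : (0 < S (cap (e / 8)%R) < +oo)%E.
  by apply: SD; apply/andP; split; [rewrite divr_gt0|have := erho; have := e0; lra].
have SA0 : 0 < fine (S (cap (e / 8))) by apply: fine_gt0.
have c0 : 0 < (eta0 / 8) ^+ 3 by rewrite exprn_gt0// divr_gt0.
exists ((eta0 / 8) ^+ 3 * fine (S (cap (e / 8)))); first exact: mulr_gt0 c0 SA0.
have K0 : 0 <= K by rewrite /K; apply: mulr_ge0; [exact: mulr_ge0|exact: sqr_ge0].
(* Three smallness conditions on the scale: the error term is below the main term, the depth
   estimate applies, and offsets of the small cap stay within [e / 4] of [x0]. *)
have b1 : 0 < eta0 / (32 * (K + 1)) by rewrite divr_gt0// mulr_gt0// ltr_wpDl.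
have b2 : 0 < (8 * C)^-1 by rewrite invr_gt0 mulr_gt0.
have b3 : 0 < e / 8 by rewrite divr_gt0.
apply: filterS (filterI (scale_small _ b1) (filterI (scale_small _ b2) (scale_small _ b3))).
move=> k [s1 [s2 s3]]; set s : R := scale k in s1 s2 s3 *.
have s0 : 0 < s by exact: scale_gt0.
have s01 : 0 <= s <= 1 by rewrite (ltW s0) scale_le1.
have sC : 8 * C * s <= 1.
  by move: s2; rewrite -[_^-1]mul1r ltr_pdivlMr ?mulr_gt0// mulrC => /ltW.
have Ks : K * s <= eta0 / 32.
  have h1 : s * (32 * (K + 1)) < eta0 by rewrite -ltr_pdivlMr// mulr_gt0// ltr_wpDl.
  by rewrite ler_pdivlMr//; have := s0; nra.
have se : s < e by have := e0; lra.
rewrite /J /offset_integral -RintegralD//; last 3 first.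
- exact: closed_borel3.
- exact: integrable_normal_sq.
- exact: integrable_normal_sq.
have -> : (eta0 / 8) ^+ 3 * fine (S (cap (e / 8))) * (s `^ a * s `^ a) =
  (eta0 / 8) ^+ 3 * (s `^ a * s `^ a) * fine (S (cap (e / 8))) by ring.
have th0 x : 0 <= theta x by exact: cutoff_at_ge0.
have capS : cap (e / 8) `<=` cap e.
  by move=> y [by_ /= ye]; split=> //=; rewrite (le_trans ye)//; have := e0; lra.
have SAf : (S (cap (e / 8)%R) < +oo)%E by case/andP: SA.
have mD := closed_borel3 _ (closed_cap e).
have iD := integrableD mD (integrable_normal_sq (fun=> true) s s01)
  (integrable_normal_sq (fun=> false) s s01).
have D0 y : cap e y -> 0 <= weighted_offset (nsq (fun=> true)) s y +
    weighted_offset (nsq (fun=> false)) s y.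
  by move=> _; apply: addr_ge0; apply: mulr_ge0; rewrite ?th0//; exact: normal_sq_ge0.
have k0 : 0 <= (eta0 / 8) ^+ 3 * (s `^ a * s `^ a).
  by apply: mulr_ge0; [exact: ltW|apply: mulr_ge0; exact: powR_ge0].
apply: (Rintegral_lower_bound S (cap e) (cap (e / 8)) _ _ (closed_cap e)
  (closed_cap (e / 8)) capS SAf iD D0 k0).
move=> y [by_ /= ye8].
have ye : `|y - x0| < e by have := e0; lra.
have yr : `|y - x0| < rho by exact: lt_trans ye erho.
have xs : `|y - s *: nu y - x0| <= e / 4.
  rewrite addrAC (le_trans (ler_normB _ _))// normrZ gtr0_norm//.
  have : s * `|nu y| <= s by rewrite ler_piMr ?(ltW s0)// (norm_unit_normal _ _ _ _ _ _ DF).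
  by move: ye8 s3; lra.
have xr : `|y - s *: nu y - x0| < rho by have := erho; have := e0; lra.
have yH := Hi _ yr (ltW ye).
have F ph := offset_normal_component _ _ _ _ _ _ DF _ _ _ a _ _ bx0 tub eps0 epsrho
  epsdelta epsC e0 eeps ij y k by_ ye se sC ph M yH M0 (cM _ xr) (fun l => dM l _ xr).
have Ft := F true; have Ff := F false.
have tx := theta_ge' _ xs.
have ty : eta0 <= theta y by apply: theta_ge'; have := e0; lra.
have dep := offset_depth _ _ _ _ _ _ DF _ _ eps0 epsrho e0 eeps y k by_ ye se sC.
have bmp := bump_ge _ dep.
move: Ft Ff; rewrite /weighted_offset /swave_z -/s -/K /nsq.
have := dwave_sq ((y - s *: nu y) 0 j / s).
move: (dwave true _) (dwave false _) => wt wf wsq.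
move: bmp tx ty (powR_ge0 s a); move: (bump _) (theta _) (theta y) (s `^ a) => b tx ty sa.
move: (normal_sq _ _ _) (normal_sq _ _ _) => Ft Ff b2' tx0 ty0 sa0 Gt Gf.
(* Main terms: (eta0/2)^2 / 64 = eta0^2 / 256, as the bump is at least 1/2. Two errors: 2
   (eta0/32)^2 = eta0^2 / 512. The difference is eta0^2 / 512, and the weight [theta y >= eta0] then
   gives [(eta0 / 8) ^+ 3]. *)
have sum : sa ^+ 2 * ((eta0 / 8) ^+ 2 / 8) <= Ft + Ff.
  have E1 : (tx * (sa * (b * wt))) ^+ 2 + (tx * (sa * (b * wf))) ^+ 2 =
      sa ^+ 2 * (tx * b) ^+ 2 by rewrite -[in RHS](mulr1 (_ ^+ 2)) -wsq; ring.
  have E2 : (K * (s * sa)) ^+ 2 = sa ^+ 2 * (K * s) ^+ 2 by ring.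
  have tb : eta0 / 2 <= tx * b by rewrite ler_pM ?(ltW eta00).
  have tb2 : (eta0 / 2) ^+ 2 <= (tx * b) ^+ 2.
    by rewrite lerXn2r ?nnegrE ?divr_ge0 ?(ltW eta00)// (le_trans _ tb)// divr_ge0 ?ltW.
  have Ks2 : (K * s) ^+ 2 <= (eta0 / 32) ^+ 2.
    have Ks0 : 0 <= K * s by apply: mulr_ge0 => //; exact: ltW.
    by rewrite lerXn2r// nnegrE divr_ge0// ltW.
  have q1 : sa ^+ 2 * (eta0 / 2) ^+ 2 <= sa ^+ 2 * (tx * b) ^+ 2 by rewrite ler_wpM2l ?sqr_ge0.
  have q2 : sa ^+ 2 * (K * s) ^+ 2 <= sa ^+ 2 * (eta0 / 32) ^+ 2 by rewrite ler_wpM2l ?sqr_ge0.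
  have q3 : sa ^+ 2 * (eta0 / 2) ^+ 2 = 4^-1 * (sa ^+ 2 * eta0 ^+ 2) by field.
  have q4 : sa ^+ 2 * (eta0 / 32) ^+ 2 = 32^-1 * 32^-1 * (sa ^+ 2 * eta0 ^+ 2) by ring.
  rewrite E2 in Gt Gf; rewrite q3 in q1; rewrite q4 in q2.
  have -> : sa ^+ 2 * ((eta0 / 8) ^+ 2 / 8) = 8^-1 * 8^-1 * 8^-1 * (sa ^+ 2 * eta0 ^+ 2) by ring.
  move: E1 Gt Gf q1 q2.
  move: (_ ^+ 2) ((tx * (sa * (b * wf))) ^+ 2) (sa ^+ 2 * (tx * b) ^+ 2) (sa ^+ 2 * (K * s) ^+ 2).
  move: (sa ^+ 2 * eta0 ^+ 2) => p u v w z; lra.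
rewrite -mulrDl (addrC Ff).
have -> : (eta0 / 8) ^+ 3 * (sa * sa) = sa ^+ 2 * ((eta0 / 8) ^+ 2 / 8) * eta0 by ring.
apply: ler_pM => //; [|exact: ltW].
by apply: mulr_ge0; [exact: sqr_ge0|apply: divr_ge0; [exact: sqr_ge0|]].
Qed.

Lemma offset_integral_phase om k : scale k < e -> 8 * C * scale k <= 1 ->
  offset_integral (nsq om) (scale k) = J (om k) k.
Proof.
move=> se sC; apply: eq_Rintegral => y /set_mem [by_ ye]; rewrite /weighted_offset.
have [ye'|ye'] := ltP `|y - x0| e.
  congr (_ * _).
  exact: (normal_sq_offset_phase _ _ _ _ _ _ DF _ _ _ _ _ eps0 epsrho e0 eeps
    y k by_ ye' se sC om).
have := theta_out _ ye'; move: (theta y) (nsq _ _) (nsq om _) => t u v ->.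
by rewrite !mulr0.
Qed.

Lemma offset_integral_best : exists om, exists2 c : R, 0 < c & \forall k \near \oo,
  c * (scale k `^ a * scale k `^ a) <= offset_integral (nsq om) (scale k).
Proof.
have [c c0 Hc] := phase_sum_lower.
(* At each scale the phase with the larger integral is taken; it carries at least half of the
   sum. *)
exists (fun k => J false k <= J true k), (c / 2); first by rewrite divr_gt0.
have b2 : 0 < (8 * C)^-1 by rewrite invr_gt0 mulr_gt0.
apply: filterS (filterI Hc (filterI (scale_small _ b2) (scale_small _ e0))).
move=> k [sum [s2 s3]].
have sC : 8 * C * scale k <= 1.
  by move: s2; rewrite -[_^-1]mul1r ltr_pdivlMr ?mulr_gt0// mulrC => /ltW.
rewrite offset_integral_phase//; move: sum; rewrite mulrAC; move: (c * _) => u /=.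
by case: (leP (J false k) (J true k)); move: (J true k) (J false k) => x y; lra.
Qed.

End quotients.

(** * The pressure *)

Section holder_closure.
Context {R : realType}.
Implicit Types (Omega : set 'rV[R]_3) (a : R).

Lemma within_closure_approx Omega (f : 'rV[R]_3 -> R) x (e d : R) :
  {within closure Omega, continuous f} -> closure Omega x -> 0 < e -> 0 < d ->
  exists y, [/\ Omega y, `|x - y| < d & `|f x - f y| < e].
Proof.
move=> cf cx e0 d0.
have := (subspace_continuousP (closure Omega) f).1 cf x cx.
move=> /cvgrPdist_lt /(_ _ e0); rewrite near_withinE => /near_normP [r r0 Hr].
have [y [Oy xy]] := cx _ (nbhsx_ballx x (Num.min d r) ltac:(by rewrite lt_min d0)).
rewrite -ball_normE /= lt_min in xy; case/andP: xy => xd xr.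
exists y; split=> //; apply: Hr; first by rewrite distrC.
exact: subset_closure.
Qed.

(** Approximating points of [Omega] are taken within half of the distance of [x] and [y], so their
    sup distance at most doubles. Passing to the Euclidean norm costs another factor 2, whence
    [4 ^ a]. *)
Lemma holder_on_closure Omega a (f : 'rV[R]_3 -> R) : 0 <= a -> holder a Omega f ->
  holder_on (closure Omega) a f.
Proof.
move=> a0 [[C [BC HC]] cf]; have near x e d := within_closure_approx Omega f x e d cf.
have CO x : closure Omega x -> 0 <= C.
  move=> cx; have [y [Oy _ _]] := near x 1 1 cx ltr01 ltr01.
  exact: le_trans (normr_ge0 (f y)) (BC _ Oy).
exists (`|C| * 4 `^ a); first by rewrite mulr_ge0// powR_ge0.
split=> [x cx|x y cx cy]; have C0 := CO x cx; rewrite (ger0_norm C0).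
  have H4 : C <= C * 4 `^ a by rewrite ler_peMr// powR_ge1// ler1n.
  apply: le_trans H4; apply/ler_addgt0Pr => e e0.
  have [z [Oz _ H]] := near x e 1 cx e0 ltr01.
  have := BC _ Oz; have := ler_distD (f z) (f x) 0; rewrite !subr0; lra.
have [->|xy] := eqVneq x y; first by rewrite !subrr normr0 !mulr_ge0// powR_ge0.
have d0 : 0 < `|x - y| / 2 by rewrite divr_gt0// normr_gt0 subr_eq0.
apply/ler_addgt0Pr => e e0; have e2 : 0 < e / 2 by rewrite divr_gt0.
have [x' [Ox xx fx]] := near x _ _ cx e2 d0.
have [y' [Oy yy fy]] := near y _ _ cy e2 d0.
have B : enorm (x' - y') <= 4 * `|x - y|.
  rewrite (le_trans (enorm_le_norm _))//.
  have := ler_distD x x' y'; have := ler_distD y x y'; rewrite (distrC x' x).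
  by move: xx yy; lra.
have P : C * enorm (x' - y') `^ a <= C * 4 `^ a * `|x - y| `^ a.
  rewrite -mulrA ler_wpM2l// -powRM// ge0_ler_powR// nnegrE ?enorm_ge0 ?mulr_ge0//.
have := HC _ _ Ox Oy; have := ler_distD (f x') (f x) (f y).
have := ler_distD (f y') (f x') (f y); rewrite (distrC (f y')).
by move: P fx fy; lra.
Qed.

Lemma holder_onT_holder Omega a (f : 'rV[R]_3 -> R) : 0 < a -> holder_on setT a f ->
  holder a Omega f.
Proof.
move=> a0 Hf; have cf := holder_on_continuous _ _ a0 Hf.
case: Hf => C C0 [BC HC]; split; last exact: continuous_subspaceT.
exists C; split=> [x _|x y _ _]; first exact: BC.
rewrite (le_trans (HC _ _ I I))// ler_wpM2l// ge0_ler_powR ?nnegrE ?enorm_ge0 ?(ltW a0)//.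
exact: norm_le_enorm.
Qed.

Lemma holderB Omega a (f g : 'rV[R]_3 -> R) : holder a Omega f -> holder a Omega g ->
  holder a Omega (fun x => f x - g x).
Proof.
move=> [[C [BC HC]] cf] [[D [BD HD]] cg]; split; last first.
  by move=> x; apply: cvgB; [exact: cf|exact: cg].
exists (C + D); split=> [x Ox|x y Ox Oy].
  by rewrite (le_trans (ler_normB _ _))// lerD// ?BC ?BD.
rewrite mulrDl (_ : f x - g x - _ = (f x - f y) - (g x - g y)); last by ring.
by rewrite (le_trans (ler_normB _ _))// lerD// ?HC ?HD.
Qed.

End holder_closure.

(** Differentiability is asked only for positive arguments, as in the trace condition on the
    pressure; at 0 continuity from the right replaces it. *)
Lemma MVT_at_right {R : realType} (f df : R -> R) (b s : R) :
  f t @[t --> 0^'+] --> f 0 ->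
  (forall t : R, 0 < t < b -> is_derive t (1 : R) f (df t)) -> 0 < s < b ->
  exists2 t : R, 0 < t < s & f s - f 0 = df t * s.
Proof.
move=> f0 Hf /andP[s0 sb].
have Hf' (t : R) : t \in `]0, s[ -> is_derive t (1 : R) f (df t).
  by rewrite in_itv /= => /andP[t0 ts]; apply: Hf; rewrite t0 (lt_trans ts).
have cf : {within `[0, s], continuous f}.
  apply/continuous_within_itvP => //; split=> //.
    by move=> t /Hf'; exact: is_derive1_continuous.
  apply: cvg_at_left_filter; apply: (is_derive1_continuous _ _ (df s)).
  by apply: Hf; rewrite s0.
by have [t] := MVT s0 Hf' cf; rewrite in_itv /= subr0; exists t.
Qed.

(** * Failure of the normal derivatives *)

Section normal_derivatives.
Context {R : realType}.
Variables (Omega : set 'rV[R]_3) (x0 : 'rV[R]_3) (rho C : R).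
Variables (h : 'rV[R]_3 -> R) (H : 'rV[R]_3 -> 'rV[R]_3).
Hypothesis DF : defining_function Omega x0 rho C h H.
Variables (delta eps e a : R) (i j : 'I_3).
Hypotheses (bx0 : bd Omega x0) (tub : tubular_radius Omega delta).
Hypotheses (eps0 : 0 < eps) (epsrho : 4 * eps <= rho) (epsdelta : 2 * eps <= delta)
  (epsC : 16 * C * eps <= 1).
Hypotheses (e0 : 0 < e) (eeps : 2 * e <= eps / 2) (a01 : 0 < a < 1) (ij : j != i).
Hypothesis Hi : forall y, `|y - x0| < rho -> `|y - x0| <= e -> 4^-1 <= `|H y 0 i|.
Variable S : {measure set (borel3 R) -> \bar R}.
Hypothesis SD : forall r : R, 0 < r < rho ->
  (0 < S (bd Omega `&` [set y : 'rV[R]_3 | (`|y - x0| <= r)%R]) < +oo)%E.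
Implicit Types (x y : 'rV[R]_3) (om : nat -> bool) (f : 'rV[R]_3 -> R).
Local Notation theta := (cutoff_at x0 e).
Local Notation cap r := (bd Omega `&` [set y : 'rV[R]_3 | `|y - x0| <= r]).
Local Notation nsq om := (normal_sq Omega (velocity x0 h H e a i j om)).
Local Notation quotient om := (normal_quotient Omega S (nsq om) theta).

Let C1 : 1 <= C. Proof. by case: DF. Qed.
Let C0 : 0 < C. Proof. exact: lt_le_trans C1. Qed.
Let a_gt0 : 0 < a. Proof. by case/andP: a01. Qed.

Let a01' : 0 <= a <= 1. Proof. by case/andP: a01 => *; rewrite !ltW. Qed.

Lemma quotient_along_scale : exists om, exists2 c : R, 0 < c & \forall k \near \oo,
  c * (scale k `^ a * scale k `^ a) <= - quotient om (scale k) * scale k.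
Proof.
have [om [c c0 Hc]] := offset_integral_best _ _ _ _ _ _ DF _ _ _ a _ _ bx0 tub eps0 epsrho
  epsdelta epsC e0 eeps a01 ij Hi _ SD.
exists om, c => //; apply: filterS Hc => k Hk.
rewrite (normal_sq_quotient _ _ _ _ _ _ DF _ _ _ a _ _ bx0 tub eps0 epsrho
  epsdelta epsC e0 eeps a01 _ SD) ?scale_gt0 ?scale_le1//.
by rewrite opprK divfK// gt_eqF// scale_gt0.
Qed.


(** A finite limit [l] would bound the quotients along the scales by [|l| + 1], and then c <= (|l| +
    1) r^{1-2a} with r tending to 0, impossible for 2a < 1. For 2a = 1 the quotients along the
    scales stay below [- c]. *)
Lemma normal_sq_not_differentiable : exists om,
  (2 * a < 1 -> forall l : R, ~ (quotient om s @[s --> 0^'+] --> l)) /\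
  (2 * a = 1 -> ~ (quotient om s @[s --> 0^'+] --> (0 : R))).
Proof.
have [om [c c0 Hc]] := quotient_along_scale; exists om.
have along (l : R) : quotient om s @[s --> 0^'+] --> l ->
    quotient om (scale k) @[k --> \oo] --> l.
  move=> /cvg_at_rightP; apply; split; last exact: scale_cvg0.
  by move=> k; exact: scale_gt0.
move: (quotient om) Hc along => q Hc along.
have sqa (s : R) : 0 < s -> s `^ a * s `^ a = s `^ (2 * a).
  move=> s0; have -> : 2 * a = a + a by ring.
  by rewrite powRD//; apply/implyP => _; rewrite gt_eqF.
split=> [a2 l /along /cvgrPdist_lt /(_ _ ltr01) Hl|a2 /along /cvgrPdist_lt /(_ _ c0) Hl].
  have [d d0 Hd] := powR_lt_near (`|l| + 1) (1 - 2 * a) c ltac:(by []) ltac:(by lra) c0.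
  have [k [h1 [h2 h3]]] := filter_ex (filterI Hc (filterI Hl (scale_small _ d0))).
  have s0 := @scale_gt0 R k.
  have : (`|l| + 1) * scale k `^ (1 - 2 * a) < c by apply: Hd; rewrite ltW.
  apply/negP; rewrite -leNgt -(ler_pM2r (powR_gt0 (2 * a) s0)) -mulrA -powRD; last first.
    by apply/implyP => _; rewrite gt_eqF.
  rewrite subrK powRr1 ?(ltW s0)// -sqa// (le_trans h1)// ler_wpM2r ?(ltW s0)//.
  have := ler_distD l 0 (q (scale k)); rewrite !sub0r normrN.
  by have := ler_norm (- q (scale k)); rewrite !normrN; move: h2; lra.
have [k [h1 h2]] := filter_ex (filterI Hc Hl); have s0 := @scale_gt0 R k.
move: h1; rewrite sqa// a2 powRr1 ?(ltW s0)// ler_pM2r//; move: h2; rewrite sub0r.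
by have := ler_norm (- q (scale k)); lra.
Qed.

Lemma norm_Rintegral_le (D : set 'rV[R]_3) (f : 'rV[R]_3 -> R) (k : R) : closed D ->
  (S D < +oo)%E -> S.-integrable (D : set (borel3 R)) (EFin \o (f : borel3 R -> R)) ->
  (forall y, D y -> `|f y| <= k) ->
  `|\int[S]_(y in (D : set (borel3 R))) f y| <= k * fine (S D).
Proof.
move=> cD SDf fi fk; have mD := closed_borel3 _ cD.
rewrite (le_trans (le_normr_Rintegral mD fi))// -(Rintegral_cst S mD k).
apply: le_Rintegral => //; first exact: integrable_norm fi.
exact: (holder_on_integrable S D a (cst k) cD SDf a_gt0 (holder_on_cst D a k)).
Qed.

Local Notation I f s := (offset_integral Omega x0 H e S f s).
Local Notation nu := (unit_normal H).

Section pressure.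
Variable (P : 'rV[R]_3 -> R).
Hypothesis HP : holder a Omega P.
(** The first two bounds keep inward offsets of the cap in the chart and inside [Omega], where [P]
    is controlled; 1 serves the Lipschitz bound of the offset map, and [delta] is the range of the
    trace condition. *)
Let b : R := Num.min (Num.min (eps / 2) (2 * C)^-1) (Num.min 1 delta).

Let b0 : 0 < b.
Proof.
rewrite !lt_min divr_gt0//= invr_gt0 mulr_gt0//= ltr01.
by have := epsdelta; have := eps0; lra.
Qed.

Let bE : [/\ b <= eps / 2, b <= (2 * C)^-1, b <= 1 & b <= delta].
Proof. by split; rewrite !ge_min lexx ?orbT. Qed.

Let erho : e < rho.
Proof. have := eeps; have := epsrho; have := eps0; have := e0; lra. Qed.

Let closed_cap : closed (cap e).
Proof. by apply: closedI; [exact: closed_bd|exact: closed_cball]. Qed.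

Let S_cap : (S (cap e) < +oo)%E.
Proof. by have /andP[] := SD e (introT andP (conj e0 erho)). Qed.

Let offset_closure y (s : R) : 0 <= s < b -> cap e y -> closure Omega (y - s *: nu y).
Proof.
move=> /andP[]; rewrite le_eqVlt => /predU1P[<- _ [[cy _] _]|s0 sb ye].
  by rewrite scale0r subr0.
have [b1 b2 _ _] := bE; apply: subset_closure.
apply: (offset_in_Omega _ _ _ _ _ _ DF _ _ eps0 epsrho e0 eeps) => //.
  exact: lt_le_trans sb b1.
have : s < (2 * C)^-1 by exact: lt_le_trans sb b2.
by rewrite -[_^-1]mul1r ltr_pdivlMr ?mulr_gt0//; lra.
Qed.

Lemma integrable_offset_closure (s : R) : 0 <= s < b ->
  S.-integrable (cap e : set (borel3 R))
    (EFin \o (weighted_offset x0 H e P s : borel3 R -> R)).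
Proof.
move=> sb; apply: (integrable_offset _ _ _ _ _ _ DF _ _ a eps0 epsrho e0 eeps a01 _ SD P
  (closure Omega)).
- exact: holder_on_closure (ltW a_gt0) HP.
- by have [_ _ b1 _] := bE; case/andP: sb => -> /ltW sb; exact: le_trans b1.
- by move=> y; exact: offset_closure.
Qed.

(** The trace condition differentiates only at positive [s]. The missing continuity at 0 comes from
    the Hoelder bound of [P] up to the boundary. *)
Let offset_integral_cvg0 : I P s @[s --> 0^'+] --> I P 0.
Proof.
have [K K0 [_ HK]] := holder_on_closure _ _ _ (ltW a_gt0) HP.
have [[M M0 [BM _]] _] := cutoff_at_holder x0 e a rho a01'.
have L (s : R) : 0 <= s < b -> `|I P 0 - I P s| <= (K * M * fine (S (cap e))) * s `^ a.
  move=> sb; have s0 : 0 <= s by case/andP: sb.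
  have zb : 0 <= (0 : R) < b by rewrite lexx b0.
  have mD := closed_borel3 _ closed_cap.
  have i0 := integrable_offset_closure 0 zb; have i1 := integrable_offset_closure s sb.
  rewrite /offset_integral -(RintegralB mD i0 i1).
  rewrite [leRHS](_ : _ = K * s `^ a * M * fine (S (cap e))); last by ring.
  apply: (norm_Rintegral_le (cap e) _ _ closed_cap S_cap (integrableB mD i0 i1)).
  move=> y ye; rewrite /weighted_offset -mulrBl normrM.
  have yr : `|y - x0| < rho by case: ye => _ /= ye; exact: le_lt_trans ye erho.
  apply: ler_pM => //; last exact: BM.
  rewrite (le_trans (HK _ _ (offset_closure _ _ zb ye) (offset_closure _ _ sb ye)))//.
  rewrite ler_wpM2l// ge0_ler_powR ?nnegrE ?(ltW a_gt0)//.
  rewrite scale0r subr0 opprB addrC subrK normrZ ger0_norm// ler_piMr//.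
  exact: norm_unit_normal DF _ yr.
have F0 : 0 <= K * M * fine (S (cap e)) by rewrite !mulr_ge0// fine_ge0.
apply/cvgrPdist_lt => r r0; have [d d0 Hd] := powR_lt_near _ _ _ F0 a_gt0 r0.
near=> s; have s0 : 0 <= s by apply: ltW; near: s; exact: nbhs_right_gt.
apply: le_lt_trans (L s _) (Hd s _); rewrite s0 /=; near: s; exact: nbhs_right_lt.
Unshelve. all: by end_near. Qed.

Lemma pressure_normal_derivative u : normal_trace_condition Omega S delta u P ->
  exists l : R, normal_quotient Omega S P theta s @[s --> 0^'+] --> l.
Proof.
move=> [G [_ cG dG _]]; exists (- G 0 theta).
have delta0 : 0 < delta by case: tub.
have dI (s : R) : 0 < s < delta -> is_derive s (1 : R) (fun t => I P t) (G s theta).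
  move=> sd; have E : (fun t : R => surf_int Omega S
      (fun y => P (y - t *: normal Omega y) * theta y)) = (fun t => I P t).
    by apply/funext => t; exact: (offset_integralE _ _ _ _ _ _ DF _ _ eps0 epsrho e0 eeps).
  by rewrite -E; exact: dG s sd theta (bd_test_theta _ _ _).
have mvt (s : R) : 0 < s < b ->
    exists2 t : R, 0 < t < s & normal_quotient Omega S P theta s = - G t theta.
  move=> /andP[s0 sb]; have [_ _ _ bd] := bE; have sd := lt_le_trans sb bd.
  have [t ts E] := MVT_at_right (fun t => I P t) (fun t => G t theta) delta s
    offset_integral_cvg0 dI (introT andP (conj s0 sd)).
  exists t => //.
  rewrite (normal_quotientE _ _ _ _ _ _ DF _ _ eps0 epsrho e0 eeps).
  - by rewrite -[I P 0 - _]opprB E mulrN mulrCA mulVf ?mulr1 ?gt_eqF.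
  - by apply: integrable_offset_closure; rewrite lexx b0.
  - by apply: integrable_offset_closure; rewrite sb (ltW s0).
apply/cvgrPdist_lt => r r0; pose N := H2norm Omega S theta.
have N1 : 0 < N + 1 by rewrite ltr_wpDl// sqrtr_ge0.
(* Continuity of [G] in the dual norm is tested on the single function [theta]; [N + 1] covers a
   vanishing norm. *)
have [|eta [eta0 Heta]] := cG 0 _ (r / (N + 1)) (divr_gt0 r0 N1); first by rewrite lexx.
near=> s.
have s0 : 0 < s by near: s; exact: nbhs_right_gt.
have sb : s < b by near: s; exact: nbhs_right_lt.
have seta : s < eta by near: s; exact: nbhs_right_lt.
have [|t /andP[t0 ts] ->] := mvt s; first by rewrite s0.
have [_ _ _ bd] := bE.
rewrite opprK addrC; have := Heta t _ _ theta (bd_test_theta _ _ _).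
rewrite subr0 gtr0_norm// (lt_trans ts seta) (ltW t0) (lt_trans ts (lt_le_trans sb bd)).
move=> /(_ erefl erefl) B; apply: le_lt_trans B _; rewrite -/N mulrAC ltr_pdivrMr//.
by rewrite ltr_pM2l// ltrDl.
Unshelve. all: by end_near. Qed.

Lemma normal_quotientB_integrable (f g : 'rV[R]_3 -> R) (s : R) :
  (forall t : R, t = 0 \/ t = s -> S.-integrable (cap e : set (borel3 R))
    (EFin \o (weighted_offset x0 H e f t : borel3 R -> R))) ->
  (forall t : R, t = 0 \/ t = s -> S.-integrable (cap e : set (borel3 R))
    (EFin \o (weighted_offset x0 H e g t : borel3 R -> R))) ->
  normal_quotient Omega S (fun x => f x - g x) theta s =
  normal_quotient Omega S f theta s - normal_quotient Omega S g theta s.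
Proof.
move=> fi gi; have mD := closed_borel3 _ closed_cap.
have E (t : R) : weighted_offset x0 H e (fun x => f x - g x) t =
    (fun y => weighted_offset x0 H e f t y - weighted_offset x0 H e g t y).
  by apply/funext => y; rewrite /weighted_offset mulrBl.
have fgi (t : R) : t = 0 \/ t = s -> S.-integrable (cap e : set (borel3 R))
    (EFin \o (weighted_offset x0 H e (fun x => f x - g x) t : borel3 R -> R)).
  move=> t0; rewrite E; have := integrableB mD (fi t t0) (gi t t0).
  by apply: eq_integrable => // y _; rewrite /= EFinB.
have EI (t : R) : t = 0 \/ t = s -> I (fun x => f x - g x) t = I f t - I g t.
  by move=> t0; rewrite /offset_integral E (RintegralB mD (fi t t0) (gi t t0)).
have Q F := normal_quotientE _ _ _ _ _ _ DF _ _ eps0 epsrho e0 eeps S F s.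
rewrite !Q; [|by auto..].
rewrite !EI; [|by auto..]; move: (I f 0) (I g 0) (I f s) (I g s) => p q u v; ring.
Qed.

(** If these quotients converged, subtracting them from the convergent quotients of [P] would give a
    limit for the squared normal component. *)
Lemma potential_not_differentiable u om : normal_trace_condition Omega S delta u P ->
  (forall l : R, ~ (quotient om s @[s --> 0^'+] --> l)) ->
  ~ cvg (normal_quotient Omega S (fun x => P x - nsq om x) theta s @[s --> 0^'+]).
Proof.
move=> /pressure_normal_derivative[l Hl] nl /cvg_ex[m Hm].
apply: (nl (l - m)); apply: cvg_trans (cvgB Hl Hm); apply: near_eq_cvg.
near=> s.
have s0 : 0 < s by near: s; exact: nbhs_right_gt.
have sb : s < b by near: s; exact: nbhs_right_lt.
have [_ _ b1 _] := bE.
have fi (t : R) : t = 0 \/ t = s -> S.-integrable (cap e : set (borel3 R))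
    (EFin \o (weighted_offset x0 H e P t : borel3 R -> R)).
  by move=> [->|->]; apply: integrable_offset_closure; rewrite ?lexx ?b0 ?sb ?(ltW s0).
have gi (t : R) : t = 0 \/ t = s -> S.-integrable (cap e : set (borel3 R))
    (EFin \o (weighted_offset x0 H e (nsq om) t : borel3 R -> R)).
  move=> ts; apply: (integrable_normal_sq _ _ _ _ _ _ DF _ _ _ a _ _ bx0 tub eps0 epsrho
    epsdelta epsC e0 eeps a01 _ SD).
  by case: ts => ->; rewrite ?lexx ?ler01 ?(ltW s0) ?(le_trans (ltW sb)).
have := normal_quotientB_integrable _ _ _ fi gi.
rewrite !fctE; move: (normal_quotient _ _ _ _ _) (normal_quotient _ _ _ _ _)
  (normal_quotient _ _ _ _ _).
by move=> q1 q2 q3 ->; ring.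
Unshelve. all: by end_near. Qed.

End pressure.

End normal_derivatives.

(** * Choice of the parameters and conclusion *)

Section assembly.
Context {R : realType}.
Variables (Omega : set 'rV[R]_3) (S : {measure set (borel3 R) -> \bar R}).
Hypotheses (Omega_open : open Omega) (Omega_C4 : Ck_boundary 4 Omega)
  (S_surface : is_surface_measure Omega S).

Lemma boundary_chart x0 : bd Omega x0 -> exists rho C h H,
  defining_function Omega x0 rho C h H /\
  (forall e : R, 0 < e < rho ->
    (0 < S (bd Omega `&` [set y : 'rV[R]_3 | (`|y - x0| <= e)%R]) < +oo)%E).
Proof.
move=> bx0; have [r [Q [g [C4 chart]]]] := Omega_C4 _ bx0.
have C2 : Ck 2 setT g by exact: Ck_le C4.
have [rho [C []]] := chart_defining_function _ x0 _ _ _ Omega_open C2 chart.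
set k := (X in X^-1); have k0 : k != 0.
  by rewrite gt_eqF// sqrtr_gt0 !ltr_pwDl ?sqr_ge0.
set h := (X in defining_function _ _ _ _ X _); set H := (X in defining_function _ _ _ _ _ X).
move=> DF rhor gC; exists rho, C, h, H; split=> //.
have [/andP[rho0 _] _ bdE _ _] := DF.
apply: (surface_measure_cball _ _ r rho C Q g S bx0 (Ck_le _ 1 _ _ _ _ C4)) => //.
move=> x hx; have [_ ->] := bdE x hx; rewrite /h; split=> [/eqP|->].
  by rewrite mulf_eq0 invr_eq0 (negbTE k0) subr_eq0 => /eqP.
by rewrite subrr mulr0.
Qed.

Lemma large_coordinate (v : 'rV[R]_3) : 7 / 8 <= enorm v -> exists i, 2^-1 < `|v 0 i|.
Proof.
move=> v1; apply: contrapT => no.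
have small i : v 0 i * v 0 i <= 4^-1.
  have : `|v 0 i| <= 2^-1 by rewrite leNgt; apply/negP => vi; apply: no; exists i.
  have := ler_norm (v 0 i * v 0 i); rewrite normrM; have := normr_ge0 (v 0 i); nra.
(* Three coordinates of size at most 1/2 give a squared length of at most 3/4 = 48/64, short of
   49/64. *)
have : (7 / 8) ^+ 2 <= enorm v ^+ 2 by rewrite lerXn2r ?nnegrE ?enorm_ge0.
rewrite sqr_enorm /dot sum_ord3 expr2.
have := small 0; have := small 1; have := small 2%:R; lra.
Qed.

Hypotheses (Omega_bounded : bounded_set Omega) (Omega_sc : simply_connected Omega).
Variables (delta : R) (phi : R -> R).
Hypotheses (delta_tub : tubular_radius Omega delta) (phi_cutoff : cutoff delta phi).

Lemma lacunary_velocity (a : R) : 0 < a < 1 -> exists u,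
  [/\ velocity_field a Omega u,
      2 * a < 1 -> ~ normal_derivative_in_D' Omega S (normal_sq Omega u) /\
        forall p, associated_pressure a Omega S delta phi u p ->
          holder a Omega p /\ ~ normal_derivative_in_D' Omega S p &
      2 * a = 1 -> ~ normal_derivative_eq0 Omega S (normal_sq Omega u)].
Proof.
move=> a01; have [[x Ox] _ _] := Omega_sc.
have [x0 bx0] := bd_nonempty _ _ Omega_open Omega_bounded Ox.
have [rho [C [h [H [DF SD]]]]] := boundary_chart _ bx0.
have [/andP[rho0 _] C1 _ LH _] := DF; have C0 : 0 < C by exact: lt_le_trans C1.
have delta0 : 0 < delta by case: delta_tub.
have x0x0 : `|x0 - x0| < rho by rewrite subrr normr0.
have [i Hi0] : exists i, 2^-1 < `|H x0 0 i|.
  by apply: large_coordinate; have /andP[] := gradient_enorm _ _ _ _ _ _ DF _ x0x0.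
have [j ij] : exists j : 'I_3, j != i.
  by have [->|i0] := eqVneq i 0; [exists 1|exists 0; rewrite eq_sym].
(* [rho / 4] keeps the feet of points [eps]-close to [x0] in the chart, [delta / 2] puts these
   points where nearest points are unique and [phi] is 1, and [(16 * C)^-1] is the smallness
   required by [normal_foot_lip] for two displacements of length at most [2 * eps]. *)
pose eps := Num.min (rho / 4) (Num.min (delta / 2) (16 * C)^-1).
have eps0 : 0 < eps by rewrite !lt_min !divr_gt0//= invr_gt0 mulr_gt0.
have [eps1 eps2 eps3] : [/\ eps <= rho / 4, eps <= delta / 2 & eps <= (16 * C)^-1].
  by split; rewrite !ge_min lexx ?orbT.
have epsrho : 4 * eps <= rho by lra.
have epsdelta : 2 * eps <= delta by lra.
have epsC : 16 * C * eps <= 1 by move: eps3; rewrite -[_^-1]mul1r ler_pdivlMr ?mulr_gt0// mulrC.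
pose e := eps / 4; have e0 : 0 < e by rewrite divr_gt0.
have eeps : 2 * e <= eps / 2 by rewrite /e; lra.
(* The coordinate exceeds 1/2 at [x0] and changes by at most [C * e <= 1/64]. *)
have Hi y : `|y - x0| < rho -> `|y - x0| <= e -> 4^-1 <= `|H y 0 i|.
  move=> hy ye; have [_ B _] := LH _ _ x0x0 hy.
  have := coord_le_norm (H y - H x0) i; rewrite rV_subE => B'.
  have p1 : C * `|y - x0| <= C * e by rewrite ler_pM2l.
  have p2 : C * e <= 64^-1 by rewrite /e; lra.
  have := ler_normB (H y 0 i) (H y 0 i - H x0 0 i); rewrite opprB addrC subrK.
  by move: B B' p1 p2 Hi0; lra.
have [om [lt_half half]] := normal_sq_not_differentiable _ _ _ _ _ _ DF _ _ _ _ _ _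
  bx0 delta_tub eps0 epsrho epsdelta epsC e0 eeps a01 ij Hi _ SD.
have theta_test := bd_test_theta Omega x0 e.
exists (velocity x0 h H e a i j om); split.
- exact: velocity_field_velocity DF _ _ _ _ _ eps0 epsrho e0 eeps a01 om.
- move=> a2; have nl := lt_half a2; split=> [D|p [P [[HP _ trace _] ->]]].
    by have /cvg_ex[l] := D _ theta_test; exact: nl.
  rewrite (_ : (fun x => P x - _) = (fun x => P x -
      normal_sq Omega (velocity x0 h H e a i j om) x)); last first.
    apply/funext => z; congr (_ - _).
    exact: cut_normal_sqE bx0 eps0 epsdelta e0 eeps _ _ _ phi_cutoff.
  split.
    apply: holderB => //; apply: holder_onT_holder; first by case/andP: a01.
    exact: normal_sq_holder DF _ _ _ _ _ _ bx0 delta_tub eps0 epsrho epsdelta epsC e0 eeps a01 om.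
  move=> D; have := D _ theta_test.
  exact: potential_not_differentiable DF _ _ _ _ _ _ bx0 delta_tub eps0 epsrho epsdelta epsC
    e0 eeps a01 _ SD _ HP _ _ trace nl.
- by move=> a2 D; exact: half a2 (D _ theta_test).
Qed.

End assembly.

Theorem theorem1p11 (R : realType) (Omega : set 'rV[R]_3)
    (S : {measure set (borel3 R) -> \bar R}) (delta : R) (phi : R -> R)
    (Omega_open : open Omega) (Omega_bounded : bounded_set Omega)
    (Omega_sc : simply_connected Omega) (Omega_C4 : Ck_boundary 4 Omega)
    (S_surface : is_surface_measure Omega S)
    (delta_tub : tubular_radius Omega delta) (phi_cutoff : cutoff delta phi) :
  (forall alpha : R, 0 < alpha < 2^-1 ->
     exists u : 'rV[R]_3 -> 'rV[R]_3,
       [/\ velocity_field alpha Omega u,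
           ~ normal_derivative_in_D' Omega S (normal_sq Omega u) &
           forall p, associated_pressure alpha Omega S delta phi u p ->
             holder alpha Omega p /\ ~ normal_derivative_in_D' Omega S p]) /\
  (exists u : 'rV[R]_3 -> 'rV[R]_3,
     velocity_field 2^-1 Omega u /\
     ~ normal_derivative_eq0 Omega S (normal_sq Omega u)).
Proof.
have main := lacunary_velocity Omega S Omega_open Omega_C4 S_surface Omega_bounded Omega_sc
  delta phi delta_tub phi_cutoff.
split=> [alpha /andP[a0 a2]|].
  have [|u [Hu nD _]] := main alpha; first by rewrite a0; lra.
  have [|n1 n2] := nD; first by lra.
  by exists u.
have [|u [Hu _ n0]] := main 2^-1; first by lra.
by exists u; split=> //; apply: n0; lra.
Qed.
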